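(* Let $\sigma>0$, $c>0$ be smooth on $\bar\Omega$, $\beta=\frac1{\sigma c^2}$, and let $u$ be a smooth solution on $\bar Q$ of the initial-boundary value problem $$\beta\partial_t^2u=L(\sigma)u+f\ \text{ in } Q,\qquad u=g\ \text{ on } \partial\Omega\times(0,T),\qquad u|_{t=0}=\varphi_0,\ \ \partial_tu|_{t=0}=\varphi_1\ \text{ in }\Omega,$$ where $f,g,\varphi_0,\varphi_1$ are the corresponding smooth data. Put $u_k=L_k(\sigma)u$, $1\le k\le n$. Let $\hat\sigma$ be any one of $\hat\sigma_I,\hat\sigma_S,\hat\sigma_G$ and let $\sigma^{(k)}$ be either $\sigma$ or $\tilde\sigma^{(k)}$, where in the latter case $\sigma$ is assumed to be given and smooth in $x_k$ on $\bar\Omega^{(k)}$ for each $k$. Consider the finite-difference scheme for $v\approx u$, $v_1\approx u_1,\dots,v_n\approx u_n$ consisting of the equations $$\Lambda_tv=\Big(I+\frac1\beta\frac{h_t^2}{12}\Lambda(\sigma)\Big)\Big[\frac1\beta(v_1+\dots+v_n+f)\Big]+\frac1\beta\frac{h_t^2}{12}\Lambda_tf,\tag{a}$$ $$s_k(\sigma)(\sigma^{(k)}v_k)=\Lambda_k(\sigma)v,\quad 1\le k\le n,\tag{b}$$ on $\omega_{\mathbf h}\times\omega^{h_t}$, the boundary conditions $$v|_{\partial\omega_{\mathbf h}}=g,\qquad v_k|_{\partial\omega_{\mathbf h}}=g_k,\quad 1\le k\le n,\tag{c}$$ and the initial conditions $v^0=\varphi_0$ on $\bar\omega_{\mathbf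 h}$ and, on $\omega_{\mathbf h}$, $$(\delta_tv)^0=\varphi_1+\frac{h_t^2}6\frac1\beta\Lambda(\sigma)\varphi_1+\frac{h_t}2\Big\{\Big(I+\frac{h_t^2}{12}\frac1\beta\Lambda(\sigma)\Big)\Big[\frac1\beta(v_1^0+\dots+v_n^0+f_0)\Big]+\frac23\frac1\beta\big(f|_{t=h_t/2}-f_0\big)\Big\},\tag{d}$$ $$s_k(\sigma)(\sigma^{(k)}v_k^0)=\Lambda_k(\sigma)\varphi_0,\quad 1\le k\le n.\tag{e}$$ Then the truncation errors of equations (a) and (b) are of the orders $\mathcal O(|\mathbf h|^4+h_t^4)$ and $\mathcal O(h_k^4)$ respectively, the truncation error of the boundary conditions (c) equals $0$, and the truncation errors of the initial conditions (d) and (e) are of the orders $\mathcal O(|\mathbf h|^4+h_t^4)$ and $\mathcal O(h_k^4)$ respectively.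
   Context: Let $n\ge1$, $\Omega=(0,X_1)\times\dots\times(0,X_n)$, $Q=\Omega\times(0,T)$, and let $\bar\Omega^{(k)}$ be the set obtained from $\bar\Omega$ by replacing $[0,X_k]$ with $[-X_k,2X_k]$. Put $L_k(\sigma)u=\partial_k\big(\frac1\sigma\partial_ku\big)$ and $L(\sigma)=L_1(\sigma)+\dots+L_n(\sigma)$. $I$ is the identity operator. Time mesh: $t_m=mh_t$, $0\le m\le M$, $h_t=T/M$, $M\ge2$; $\bar\omega^{h_t}=\{t_0,\dots,t_M\}$, $\omega^{h_t}=\bar\omega^{h_t}\setminus\{0,T\}$; $y^m=y(t_m)$; $(\delta_ty)^m=\frac{y^{m+1}-y^m}{h_t}$, $(\Lambda_ty)^m=\frac{y^{m+1}-2y^m+y^{m-1}}{h_t^2}$; $f_0=f|_{t=0}$. Space mesh: for each $l$, $h_l=X_l/N_l$ with integer $N_l\ge2$; $\mathbf h=(h_1,\dots,h_n)$; the nodes are $x_{\mathbf i}=(i_1h_1,\dots,i_nh_n)$. The mesh $\bar\omega_{\mathbf h}$ consists of the nodes with $0\le i_l\le N_l$ for all $l$, $\omega_{\mathbf h}$ of the nodes with $1\le i_l\le N_l-1$ for all $l$, and $\partial\omega_{\mathbf h}=\bar\omega_{\mathbf h}\setminus\omega_{\mathbf h}$. $\mathbf e_1,\dots,\mathbf e_n$ is the canonical basis of $\mathbb R^n$, $w_{\mathbf i}=w(x_{\mathbf i})$, $x_{\mathbf i-0.5\mathbf e_k}=x_{\mathbf i}-0.5h_k\mathbf e_k$. Mean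 values: $\hat\sigma_{\mathbf i-0.5\mathbf e_k}$ denotes one of (the same choice throughout) - $\hat\sigma_{I(\mathbf i-0.5\mathbf e_k)}=\frac1{h_k}\int_{(i_k-1)h_k}^{i_kh_k}\sigma\,dx_k$ (the other coordinates being fixed equal to those of $x_{\mathbf i}$), - $\hat\sigma_{S(\mathbf i-0.5\mathbf e_k)}=\frac16\big(\sigma(x_{\mathbf i-\mathbf e_k})+4\sigma(x_{\mathbf i-0.5\mathbf e_k})+\sigma(x_{\mathbf i})\big)$, - $\hat\sigma_{G(\mathbf i-0.5\mathbf e_k)}=\frac12\big(\sigma(x_{\mathbf i-0.5\mathbf e_k}-\theta_Gh_k\mathbf e_k)+\sigma(x_{\mathbf i-0.5\mathbf e_k}+\theta_Gh_k\mathbf e_k)\big)$, $\theta_G=\frac1{2\sqrt3}$, and $\hat\sigma_{\mathbf i+0.5\mathbf e_k}=\hat\sigma_{(\mathbf i+\mathbf e_k)-0.5\mathbf e_k}$. Also $\tilde\sigma^{(k)}_{\mathbf i}=\big[\frac12\big(\frac1{\hat\sigma_{\mathbf i-0.5\mathbf e_k}}+\frac1{\hat\sigma_{\mathbf i+0.5\mathbf e_k}}\big)\big]^{-1}$. Operators: $$\Lambda_k(\sigma)w_{\mathbf i}=\frac1{h_k}\Big(\frac{w_{\mathbf i+\mathbf e_k}-w_{\mathbf i}}{\hat\sigma_{\mathbf i+0.5\mathbf e_k}h_k}-\frac{w_{\mathbf i}-w_{\mathbf i-\mathbf e_k}}{\hat\sigma_{\mathbf i-0.5\mathbf e_k}h_k}\Big),\quad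 s_k(\sigma)w_{\mathbf i}=\frac1{\sigma^{(k)}_{\mathbf i}}w_{\mathbf i}+\frac{h_k^2}{12}\Lambda_k(\sigma)w_{\mathbf i},$$ and $\Lambda(\sigma)=\Lambda_1(\sigma)+\dots+\Lambda_n(\sigma)$. Boundary data: $g_k=\beta\partial_t^2g-\sum_{1\le l\le n,\,l\ne k}L_l(\sigma)g-f$ for $x_k=0,X_k$, and $g_k=L_k(\sigma)g$ for $x_l=0,X_l$, $1\le l\le n$, $l\ne k$. The values of $v_k$ and $g_k$ at nodes lying on more than one facet of $\bar\Omega$ are not used in the scheme, so the condition $v_k=g_k$ is considered only at nodes of $\partial\omega_{\mathbf h}$ lying on exactly one facet. Truncation error of an equation: the difference of its two sides after substituting $v=u$, $v_k=u_k=L_k(\sigma)u$ (restricted to the mesh). The $\mathcal O$-bounds are uniform over the nodes at which the equation is posed: there are constants $C,h_0>0$, independent of the meshes and nodes, such that the absolute value of the truncation error is at most $C$ times the indicated quantity whenever $|\mathbf h|\le h_0$ and $h_t\le h_0$. ''Smooth'' means having continuous derivatives of as high order as needed on the indicated closed set. *)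

(* Defs.v *)
From HB Require Import structures.
From mathcomp Require Import all_boot all_order all_algebra.
From mathcomp Require Import all_classical all_reals all_analysis.

Set Implicit Arguments.
Unset Strict Implicit.
Unset Printing Implicit Defensive.

Import Order.TTheory GRing.Theory Num.Theory.
Import numFieldNormedType.Exports.

Local Open Scope classical_set_scope.
Local Open Scope ring_scope.

(* Derivatives relative to a set D.  [dwithin D e w x] is the library's
   directional derivative ['D_e w x], with the increments restricted to those
   for which x + s e stays in D: the usual derivative at the interior points
   of a box, the one-sided one at its faces.  It depends only on the values of
   w on D. *)
Section Within.
Context {R : realType} {E : normedModType R}.
Implicit Types (D : set E) (e x : E) (w : E -> R).

Definition dquot w x e (s : R) : R := s^-1 * (w (x + s *: e) - w x).

Definition incr D x e : set_system R :=
  within [set s | D (x + s *: e)] (0 : R)^'.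

Definition dwithin D e w x : R := lim (dquot w x e @ incr D x e).

Definition derivable_within D e w x : Prop := cvg (dquot w x e @ incr D x e).

(* w has on D all iterated derivatives of order <= K along the directions
   in [dirs] (mixed ones included), and they are continuous on D. *)
Fixpoint Ck_on (dirs : set E) D (K : nat) w : Prop :=
  {within D, continuous w} /\
  if K is K'.+1 then
    forall e, dirs e ->
      (forall x, D x -> derivable_within D e w x) /\
      Ck_on dirs D K' (dwithin D e w)
  else True.

End Within.

Section Domain.
Context {R : realType} {n : nat}.
Implicit Types (X : 'I_n -> R) (T : R) (x : 'rV[R]_n) (k : 'I_n).

Definition Omega X : set 'rV[R]_n := [set x | forall l, 0 < x 0 l < X l].

Definition cOmega X : set 'rV[R]_n := [set x | forall l, 0 <= x 0 l <= X l].

(* the closed box with [0, X_k] replaced by [-X_k, 2 X_k] *)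
Definition cOmega_ext X k : set 'rV[R]_n :=
  [set x | forall l, if l == k then - X l <= x 0 l <= 2 * X l
                     else 0 <= x 0 l <= X l].

Definition bOmega X : set 'rV[R]_n := cOmega X `\` Omega X.

(* the closed facet x_j = 0 (b = false) or x_j = X_j (b = true) *)
Definition facet X (j : 'I_n) (b : bool) : set 'rV[R]_n :=
  [set x | cOmega X x /\ x 0 j = if b then X j else 0].

Definition on_single_facet X j b x : Prop :=
  facet X j b x /\
  forall j' b', facet X j' b' x -> j' = j /\ b' = b.

Definition cyl (A : set 'rV[R]_n) T : set ('rV[R]_n * R) :=
  [set p | A p.1 /\ 0 <= p.2 <= T].

Definition ek k : 'rV[R]_n := delta_mx 0 k.
Definition ekT k : 'rV[R]_n * R := (ek k, 0).
Definition eT : 'rV[R]_n * R := (0, 1).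

Definition smooth_space X K (w : 'rV[R]_n -> R) : Prop :=
  Ck_on (range ek) (cOmega X) K w.

Definition smooth_in k (D : set 'rV[R]_n) K (w : 'rV[R]_n -> R) : Prop :=
  Ck_on [set ek k] D K w.

Definition smooth_spacetime X T K (w : 'rV[R]_n * R -> R) : Prop :=
  Ck_on (range ekT `|` [set eT]) (cyl (cOmega X) T) K w.

(* smoothness of boundary data: on every closed facet times [0, T], with
   respect to t and to the coordinates of the facet *)
Definition smooth_boundary X T K (w : 'rV[R]_n * R -> R) : Prop :=
  forall j b, Ck_on ([set ekT l | l in [set l | l != j]] `|` [set eT])
                    (cyl (facet X j b) T) K w.

Definition dx (D : set ('rV[R]_n * R)) k := dwithin D (ekT k).
Definition dt (D : set ('rV[R]_n * R)) := dwithin D eT.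

Definition Lk (D : set ('rV[R]_n * R)) (sigma : 'rV[R]_n -> R) k
    (w : 'rV[R]_n * R -> R) : 'rV[R]_n * R -> R :=
  dx D k (fun p => (sigma p.1)^-1 * dx D k w p).

Definition beta (sigma c : 'rV[R]_n -> R) x : R := (sigma x * c x ^+ 2)^-1.

Definition is_solution X T (sigma c : 'rV[R]_n -> R)
    (f g : 'rV[R]_n * R -> R) (phi0 phi1 : 'rV[R]_n -> R)
    (u : 'rV[R]_n * R -> R) : Prop :=
  let Q := cyl (cOmega X) T in
  [/\ forall x (t : R), Omega X x -> 0 < t < T ->
        beta sigma c x * dt Q (dt Q u) (x, t)
        = \sum_(k < n) Lk Q sigma k u (x, t) + f (x, t),
      forall x (t : R), bOmega X x -> 0 < t < T -> u (x, t) = g (x, t),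
      forall x, Omega X x -> u (x, 0) = phi0 x
    & forall x, Omega X x -> dt Q u (x, 0) = phi1 x].

(* The boundary value g_k on the facet (j, b).  The derivatives are taken
   along the facet, so that only the values of g on the boundary matter. *)
Definition gk X T (sigma c : 'rV[R]_n -> R) (f g : 'rV[R]_n * R -> R)
    (j : 'I_n) (b : bool) (k : 'I_n) (p : 'rV[R]_n * R) : R :=
  let D := cyl (facet X j b) T in
  if j == k then
    beta sigma c p.1 * dt D (dt D g) p
    - \sum_(l < n | l != k) Lk D sigma l g p - f p
  else Lk D sigma k g p.

End Domain.

(* The choice of the mean value: integral, Simpson, Gauss. *)
Inductive mean_rule := MeanI | MeanS | MeanG.

Section Mesh.
Context {R : realType} {n : nat}.

Definition step (X : 'I_n -> R) (N : 'I_n -> nat) (l : 'I_n) : R :=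
  X l / (N l)%:R.

Definition step_norm (h : 'I_n -> R) : R := Num.sqrt (\sum_(l < n) h l ^+ 2).

(* Multi-indices are integer vectors, since the tilde coefficients at the
   boundary nodes involve the half-integer points outside the domain. *)
Definition cmesh (N : 'I_n -> nat) (i : 'rV[int]_n) : Prop :=
  forall l, 0 <= i 0 l <= (N l)%:Z.

Definition mesh (N : 'I_n -> nat) (i : 'rV[int]_n) : Prop :=
  forall l, 1 <= i 0 l <= (N l)%:Z - 1.

Definition bmesh (N : 'I_n -> nat) (i : 'rV[int]_n) : Prop :=
  cmesh N i /\ ~ mesh N i.

Definition ei (k : 'I_n) : 'rV[int]_n := delta_mx 0 k.

Definition set_coord (x : 'rV[R]_n) (k : 'I_n) (y : R) : 'rV[R]_n :=
  \row_l (if l == k then y else x 0 l).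

Definition Lambda_t (ht : R) (y : nat -> R) (m : nat) : R :=
  (y m.+1 - 2 * y m + y m.-1) / ht ^+ 2.

Definition delta_t (ht : R) (y : nat -> R) (m : nat) : R :=
  (y m.+1 - y m) / ht.

Section Operators.
Variables (mr : mean_rule) (tilde : bool) (sigma : 'rV[R]_n -> R).
Variable h : 'I_n -> R.
Implicit Types (i : 'rV[int]_n) (w : 'rV[int]_n -> R) (k : 'I_n).

Definition node i : 'rV[R]_n := \row_l ((i 0 l)%:~R * h l).

(* the mean value at i - 0.5 e_k *)
Definition hat_minus k i : R :=
  let mid := node i - (h k / 2) *: ek k in
  match mr with
  | MeanI =>
      (h k)^-1 *
      \int[lebesgue_measure]_(y in `[(i 0 k - 1)%:~R * h k, (i 0 k)%:~R * h k])
         sigma (set_coord (node i) k y)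
  | MeanS => (sigma (node (i - ei k)) + 4 * sigma mid + sigma (node i)) / 6
  | MeanG =>
      let theta := (2 * Num.sqrt 3)^-1 in
      (sigma (mid - (theta * h k) *: ek k)
       + sigma (mid + (theta * h k) *: ek k)) / 2
  end.

Definition hat_plus k i : R := hat_minus k (i + ei k).

Definition sigma_tilde k i : R :=
  (((hat_minus k i)^-1 + (hat_plus k i)^-1) / 2)^-1.

Definition sigma_k k i : R :=
  if tilde then sigma_tilde k i else sigma (node i).

Definition Lambda_k k w i : R :=
  (h k)^-1 * ((w (i + ei k) - w i) / (hat_plus k i * h k)
              - (w i - w (i - ei k)) / (hat_minus k i * h k)).

Definition Lambda w i : R := \sum_(k < n) Lambda_k k w i.

Definition s_k k w i : R :=
  (sigma_k k i)^-1 * w i + h k ^+ 2 / 12 * Lambda_k k w i.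

End Operators.

Definition restr (h : 'I_n -> R) (ht : R) (w : 'rV[R]_n * R -> R)
    (i : 'rV[int]_n) (m : nat) : R :=
  w (node h i, m%:R * ht).

(* Differences of the two sides of the equations of the scheme, as functions
   of the unknowns v (i, m) and v_k (k, i, m). *)
Section Scheme.
Variables (mr : mean_rule) (tilde : bool) (sigma c : 'rV[R]_n -> R).
Variables (f : 'rV[R]_n * R -> R) (phi0 phi1 : 'rV[R]_n -> R).
Variables (h : 'I_n -> R) (ht : R).
Variables (v : 'rV[int]_n -> nat -> R) (vk : 'I_n -> 'rV[int]_n -> nat -> R).
Implicit Types (i : 'rV[int]_n) (m : nat) (k : 'I_n) (w : 'rV[int]_n -> R).

Let binv i : R := (beta sigma c (node h i))^-1.
Let fh := restr h ht f.
Let Lam w i : R := Lambda mr sigma h w i.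
Let Lam_k k w i : R := Lambda_k mr sigma h k w i.

(* I + (1/beta) (ht^2/12) Lambda(sigma) *)
Let B w i : R := w i + binv i * (ht ^+ 2 / 12) * Lam w i.

(* (1/beta) (v_1 + ... + v_n + f) at time level m *)
Let W m i : R := binv i * (\sum_(k < n) vk k i m + fh i m).

Definition resid_a i m : R :=
  Lambda_t ht (v i) m
  - (B (W m) i + binv i * (ht ^+ 2 / 12) * Lambda_t ht (fh i) m).

Definition resid_b k i m : R :=
  s_k mr tilde sigma h k (fun j => sigma_k mr tilde sigma h k j * vk k j m) i
  - Lam_k k (fun j => v j m) i.

Definition resid_d i : R :=
  delta_t ht (v i) 0
  - (phi1 (node h i)
     + ht ^+ 2 / 6 * binv i * Lam (fun j => phi1 (node h j)) i
     + ht / 2 * (B (W 0) i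
                 + 2 / 3 * binv i * (f (node h i, ht / 2) - fh i 0))).

Definition resid_e k i : R :=
  s_k mr tilde sigma h k (fun j => sigma_k mr tilde sigma h k j * vk k j 0) i
  - Lam_k k (fun j => phi0 (node h j)) i.

End Scheme.

End Mesh.

(* Main.v *)
Require Import Defs.
From HB Require Import structures.
From mathcomp Require Import all_boot all_order all_algebra.
From mathcomp Require Import all_classical all_reals all_analysis.
From mathcomp Require Import ring lra zify.
Import Order.TTheory GRing.Theory Num.Theory.
Import numFieldNormedType.Exports.
Set Implicit Arguments.
Unset Strict Implicit.
Unset Printing Implicit Defensive.
Local Open Scope classical_set_scope.
Local Open Scope ring_scope.

(** Everything rests on one expansion of the weighted second difference in a
    direction k.  Let w be smooth and let p = w' / sigma be its flux, where the
    prime is the derivative in x_k; then w' = sigma p and L_k w = p'.  All three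
    mean values of sigma over a cell are exact for cubics and symmetric, so that
    they have the same expansion in the step h, up to a fourth-order coefficient
    which is the same on both sides of a node and cancels.  Taylor's formula for w
    and sigma then gives ([Lambda_expansion])

      Lambda_k w = L_k w + (h^2 / 12) L_k (sigma L_k w) + O(h^4).

    - Equations (b) and (e).  For w = u and u_k = L_k u the correction term is
      L_k (sigma u_k), and the same expansion, applied to sigma u_k, says that
      Lambda_k (sigma u_k) differs from it by O(h^2); this is the operator s_k
      ([compact_scheme_truncation]).  If sigma^(k) is the harmonic mean, then
      sigma^(k) - sigma = h^2 r + O(h^4) with r smooth, and Lambda_k maps
      (sigma^(k) - sigma) u_k to O(h^2) ([tilde_perturbation]).
    - Equations (a) and (d).  The differential equation holds up to the boundary
      by continuity, hence (u_1 + ... + u_n + f) / beta is u_tt at all nodes.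
      As d/dt commutes with L_k (Schwarz), beta u_tttt = L u_tt + f_tt
      ([equation_t]), so that the terms with the factor h_t^2 in the scheme
      reproduce the next terms of the Taylor expansions in t, with Lambda for L
      at the price of h_t^2 O(|h|^2) ([interior_truncation],
      [initial_truncation]).
    - Conditions (c).  By continuity in t, g is the trace of u on each closed
      facet, for 0 <= t <= T, and the derivatives of g along the facet are those
      of u; the rest is the equation on the facet ([boundary_uk]).

    The bounds are uniform because the meshes, nodes and times are treated as an
    index set: [expansion] says that a quantity indexed by it is a polynomial in
    the step plus a remainder, with all coefficients bounded.  The coefficients
    multiply like power series, and the vanishing of those of low order is a
    rational identity between derivatives of sigma and p at one point.  The
    bounds on the derivatives come from compactness of the closed cylinder. *)

(** * Calculus of derivatives relative to a set *)

Section Derivative.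
Context {R : realType} {E : normedModType R}.
Implicit Types (D dirs : set E) (e x : E) (w v : E -> R).

(** The value is carried by the relation, because [dwithin] is a limit that may
    fail to exist. *)
Definition is_dwithin D e w x (l : R) : Prop := dquot w x e @ incr D x e --> l.

(** At a point from which no small increment along e stays in D, [incr] is the
    trivial filter and [dwithin] is meaningless; this excludes such points, and
    makes the derivative unique. *)
Definition accessible dirs D : Prop :=
  forall e x, dirs e -> D x -> ProperFilter (incr D x e).

#[local] Instance incr_filter D x e : Filter (incr D x e).
Proof. exact: within_filter. Qed.

Lemma incr_all D x e (P : set R) :
  (forall s, s != 0 -> D (x + s *: e) -> P s) -> incr D x e P.
Proof. by move=> sP; apply: (@filterE _ (nbhs (0 : R))) => s s0 Ds; apply: sP. Qed.

Lemma incr_cvg0 D x e : s @[s --> incr D x e] --> (0 : R).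
Proof. by move=> A A0; apply: cvg_within; apply: cvg_within. Qed.

Lemma derivable_is_dwithin D e w x : derivable_within D e w x ->
  is_dwithin D e w x (dwithin D e w x).
Proof. by []. Qed.

Lemma is_dwithin_derivable D e w x l : is_dwithin D e w x l -> derivable_within D e w x.
Proof. by move=> wl; apply: cvgP wl. Qed.

Lemma is_dwithinE D e w x l : ProperFilter (incr D x e) -> is_dwithin D e w x l ->
  dwithin D e w x = l.
Proof. by move=> PF; apply: cvg_lim. Qed.

Lemma dquot_near D e w v x : (forall y, D y -> w y = v y) -> D x ->
  {near incr D x e, dquot w x e =1 dquot v x e}.
Proof. by move=> wv Dx; apply: incr_all => s _ Ds; rewrite /dquot !wv. Qed.

Lemma is_dwithin_ext D e w v x l : (forall y, D y -> w y = v y) -> D x ->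
  is_dwithin D e w x l -> is_dwithin D e v x l.
Proof.
by move=> wv Dx; apply: cvg_trans; apply: near_eq_cvg; apply: dquot_near.
Qed.

Lemma dwithin_ext D e w v x : (forall y, D y -> w y = v y) -> D x ->
  dwithin D e w x = dwithin D e v x.
Proof.
move=> wv Dx; rewrite /dwithin.
suff -> : dquot w x e @ incr D x e = dquot v x e @ incr D x e by [].
rewrite eqEsubset; split => A.
  exact: (near_eq_cvg (dquot_near e wv Dx)).
exact: (near_eq_cvg (dquot_near e (fun y Dy => esym (wv y Dy)) Dx)).
Qed.

Lemma is_dwithin_cst D e x (c : R) : is_dwithin D e (fun=> c) x 0.
Proof.
rewrite /is_dwithin (_ : dquot _ x e = (fun=> 0)); first exact: cvg_cst.
by apply/funext => s; rewrite /dquot subrr mulr0.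
Qed.

Lemma is_dwithinD D e w v x l k : is_dwithin D e w x l -> is_dwithin D e v x k ->
  is_dwithin D e (fun y => w y + v y) x (l + k).
Proof.
move=> wl vk; rewrite /is_dwithin
  (_ : dquot _ x e = (fun s => dquot w x e s + dquot v x e s)); first exact: cvgD.
by apply/funext => s; rewrite /dquot -mulrDr; congr (_ * _); ring.
Qed.

Lemma is_dwithin_incr D e w x l : is_dwithin D e w x l ->
  w (x + s *: e) @[s --> incr D x e] --> w x.
Proof.
move=> wl; have : w x + s * dquot w x e s @[s --> incr D x e] --> w x + 0 * l.
  by apply: cvgD; [exact: cvg_cst | apply: cvgM => //; exact: incr_cvg0].
rewrite mul0r addr0; apply: cvg_trans; apply: near_eq_cvg.
by apply: incr_all => s s0 _; rewrite /dquot mulVKf// addrC subrK.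
Qed.

Lemma is_dwithinM D e w v x l k : is_dwithin D e w x l -> is_dwithin D e v x k ->
  is_dwithin D e (fun y => w y * v y) x (l * v x + w x * k).
Proof.
move=> wl vk; rewrite /is_dwithin (_ : dquot _ x e =
  (fun s => dquot w x e s * v (x + s *: e) + w x * dquot v x e s)).
  apply: cvgD; last by apply: cvgM => //; exact: cvg_cst.
  by apply: cvgM => //; exact: is_dwithin_incr vk.
by apply/funext => s; rewrite /dquot; ring.
Qed.

(** As for the product, the rule is obtained by passing to the limit in an identity
    between difference quotients. *)
Lemma is_dwithinV D e w x l : (forall y, D y -> w y != 0) -> D x ->
  is_dwithin D e w x l -> is_dwithin D e (fun y => (w y)^-1) x (- (l * (w x)^-1 * (w x)^-1)).
Proof.
move=> w0 Dx wl.
have : - (dquot w x e s * (w (x + s *: e))^-1 * (w x)^-1) @[s --> incr D x e]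
    --> - (l * (w x)^-1 * (w x)^-1).
  apply: cvgN; apply: cvgM; last exact: cvg_cst.
  by apply: cvgM => //; apply: cvgV; [exact: w0 | exact: is_dwithin_incr wl].
apply: cvg_trans; apply: near_eq_cvg; apply: incr_all => s s0 Ds.
by rewrite /dquot; field; rewrite s0 !w0.
Qed.

End Derivative.

Section Smooth.
Context {R : realType} {E : normedModType R}.
Variables (D dirs : set E).
Hypothesis acc : accessible dirs D.
Implicit Types (e x : E) (w v : E -> R).

Let cts w := {within D, continuous w}.

Lemma cts_ext w v : (forall y, D y -> w y = v y) -> cts w -> cts v.
Proof.
move=> wv /subspace_continuousP cw; apply/subspace_continuousP => x Dx.
suff: v y @[y --> within D (nbhs x)] --> v x by [].
have: w y @[y --> within D (nbhs x)] --> w x by exact: cw.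
rewrite (wv x Dx); apply: cvg_trans; apply: near_eq_cvg.
by apply: (@filterE _ (nbhs x)) => y Dy; exact: wv.
Qed.

Lemma Ck_cts K w : Ck_on dirs D K w -> cts w.
Proof. by case: K => [|K] []. Qed.

Lemma Ck_ext K w v : (forall y, D y -> w y = v y) ->
  Ck_on dirs D K w -> Ck_on dirs D K v.
Proof.
elim: K w v => [|K IH] w v wv [cw] /= Hw; split=> //; try exact: cts_ext wv cw.
move=> e de; have [dw Cw] := Hw e de; split.
  move=> x Dx; apply: (@is_dwithin_derivable _ _ _ _ _ _ (dwithin D e w x)).
  exact: (is_dwithin_ext wv Dx (derivable_is_dwithin (dw x Dx))).
by apply: IH Cw => y Dy; exact: dwithin_ext.
Qed.

Lemma Ck_is_dwithin K w e x : Ck_on dirs D K.+1 w -> dirs e -> D x ->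
  is_dwithin D e w x (dwithin D e w x).
Proof. by case=> _ /= Hw de Dx; exact: (Hw e de).1. Qed.

Lemma Ck_dw K w e : Ck_on dirs D K.+1 w -> dirs e ->
  Ck_on dirs D K (dwithin D e w).
Proof. by case=> _ /= Hw de; exact: (Hw e de).2. Qed.

(** The inductive way to prove smoothness: by exhibiting the derivatives.  That
    [dwithin] agrees with the exhibited function uses uniqueness of limits. *)
Lemma CkS K w (dw : E -> E -> R) : cts w ->
  (forall e x, dirs e -> D x -> is_dwithin D e w x (dw e x)) ->
  (forall e, dirs e -> Ck_on dirs D K (dw e)) -> Ck_on dirs D K.+1 w.
Proof.
move=> cw wdw Cdw; split=> // e de; split.
  by move=> x Dx; exact: is_dwithin_derivable (wdw e x de Dx).
apply: Ck_ext (Cdw e de) => y Dy; apply/esym/is_dwithinE; first exact: acc.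
exact: wdw.
Qed.

Lemma CkW K w : Ck_on dirs D K.+1 w -> Ck_on dirs D K w.
Proof.
elim: K w => [|K IH] w Cw; first by split=> //; exact: Ck_cts Cw.
apply: CkS; first exact: Ck_cts Cw.
  by move=> e x de Dx; exact: Ck_is_dwithin Cw _ _.
by move=> e de; apply: IH; exact: Ck_dw Cw _.
Qed.

Lemma Ck_le K K' w : (K' <= K)%N -> Ck_on dirs D K w -> Ck_on dirs D K' w.
Proof.
move=> /subnK <-; elim: (K - K')%N => // j IH; rewrite addSn => /CkW; exact: IH.
Qed.

Lemma Ck_cst K (c : R) : Ck_on dirs D K (fun=> c).
Proof.
elim: K c => [|K IH] c; first by split => // x; exact: cvg_cst.
apply: (@CkS _ _ (fun _ _ => 0)) => //; first by move=> x; exact: cvg_cst.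
by move=> *; exact: is_dwithin_cst.
Qed.

Lemma CkD K w v : Ck_on dirs D K w -> Ck_on dirs D K v ->
  Ck_on dirs D K (fun y => w y + v y).
Proof.
elim: K w v => [|K IH] w v Cw Cv.
  by split=> // x; apply: cvgD; [exact: (Ck_cts Cw) | exact: (Ck_cts Cv)].
apply: (@CkS _ _ (fun e y => dwithin D e w y + dwithin D e v y)).
- by move=> x; apply: cvgD; [exact: (Ck_cts Cw) | exact: (Ck_cts Cv)].
- by move=> e x de Dx; apply: is_dwithinD; apply: Ck_is_dwithin; eassumption.
- by move=> e de; apply: IH; apply: Ck_dw.
Qed.

Lemma CkM K w v : Ck_on dirs D K w -> Ck_on dirs D K v ->
  Ck_on dirs D K (fun y => w y * v y).
Proof.
elim: K w v => [|K IH] w v Cw Cv.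
  by split=> // x; apply: cvgM; [exact: (Ck_cts Cw) | exact: (Ck_cts Cv)].
apply: (@CkS _ _ (fun e y => dwithin D e w y * v y + w y * dwithin D e v y)).
- by move=> x; apply: cvgM; [exact: (Ck_cts Cw) | exact: (Ck_cts Cv)].
- by move=> e x de Dx; apply: is_dwithinM; apply: Ck_is_dwithin; eassumption.
- by move=> e de; apply: CkD; apply: IH; (exact: Ck_dw || exact: CkW).
Qed.

Lemma CkN K w : Ck_on dirs D K w -> Ck_on dirs D K (fun y => - w y).
Proof.
move=> Cw; apply: Ck_ext (CkM (Ck_cst K (-1)) Cw) => y _; exact: mulN1r.
Qed.

Lemma CkB K w v : Ck_on dirs D K w -> Ck_on dirs D K v ->
  Ck_on dirs D K (fun y => w y - v y).
Proof. by move=> Cw Cv; apply: CkD => //; exact: CkN. Qed.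

Lemma Ck_sum K (I : finType) (P : pred I) (w : I -> E -> R) :
  (forall i, Ck_on dirs D K (w i)) ->
  Ck_on dirs D K (fun y => \sum_(i | P i) w i y).
Proof.
move=> Cw; elim: (index_enum I) => [|i r IH].
  by apply: Ck_ext (Ck_cst K 0) => y _; rewrite big_nil.
case Pi: (P i); last by apply: Ck_ext IH => y _; rewrite big_cons Pi.
by apply: Ck_ext (CkD (Cw i) IH) => y _; rewrite big_cons Pi.
Qed.

(** The derivative of 1/w is - w' (1/w) (1/w), in which 1/w occurs with one order
    of smoothness less. *)
Lemma CkV K w : (forall y, D y -> w y != 0) -> Ck_on dirs D K w ->
  Ck_on dirs D K (fun y => (w y)^-1).
Proof.
move=> w0; elim: K => [|K IH] Cw.
all: have cw : cts (fun y => (w y)^-1) by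
  apply/subspace_continuousP => x Dx; apply: cvgV; [exact: w0 |];
  exact: ((subspace_continuousP _ _).1 (Ck_cts Cw) x Dx).
  by split.
apply: (@CkS _ _ (fun e y => - (dwithin D e w y * (w y)^-1 * (w y)^-1))) => //.
- by move=> e x de Dx; apply: is_dwithinV => //; exact: Ck_is_dwithin Cw _ _.
- move=> e de; have IHw := IH (CkW Cw); apply: CkN; apply: CkM => //.
  by apply: CkM => //; exact: Ck_dw Cw _.
Qed.

Lemma dwithin_add K w v e x : Ck_on dirs D K.+1 w -> Ck_on dirs D K.+1 v ->
  dirs e -> D x ->
  dwithin D e (fun y => w y + v y) x = dwithin D e w x + dwithin D e v x.
Proof.
move=> Cw Cv de Dx; apply: is_dwithinE; first exact: acc.
by apply: is_dwithinD; apply: Ck_is_dwithin; eassumption.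
Qed.

Lemma dwithin_mul K w v e x : Ck_on dirs D K.+1 w -> Ck_on dirs D K.+1 v ->
  dirs e -> D x ->
  dwithin D e (fun y => w y * v y) x = dwithin D e w x * v x + w x * dwithin D e v x.
Proof.
move=> Cw Cv de Dx; apply: is_dwithinE; first exact: acc.
by apply: is_dwithinM; apply: Ck_is_dwithin; eassumption.
Qed.

Lemma dwithin_sum K (I : finType) (P : pred I) (w : I -> E -> R) e x :
  (forall i, Ck_on dirs D K.+1 (w i)) -> dirs e -> D x ->
  dwithin D e (fun y => \sum_(i | P i) w i y) x = \sum_(i | P i) dwithin D e (w i) x.
Proof.
move=> Cw de Dx; apply: is_dwithinE; first exact: acc.
elim: (index_enum I) => [|i r IH].
  rewrite big_nil; apply: (@is_dwithin_ext _ _ _ _ (fun=> 0)) => //.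
    by move=> y _; rewrite big_nil.
  exact: is_dwithin_cst.
rewrite big_cons; case Pi: (P i); last first.
  by apply: is_dwithin_ext IH => // y _; rewrite big_cons Pi.
apply: (@is_dwithin_ext _ _ _ _ (fun y => w i y + \sum_(j <- r | P j) w j y)) => //.
  by move=> y _; rewrite big_cons Pi.
by apply: is_dwithinD IH; exact: Ck_is_dwithin (Cw i) _ _.
Qed.

End Smooth.

(** * Taylor's formula and the symmetry of second derivatives *)

Section Lines.
Context {R : realType} {E : normedModType R}.
Implicit Types (D dirs : set E) (e x : E) (w v : E -> R).

Lemma cts_comp {T U V : topologicalType} (A : set T) (B : set U)
    (f : T -> U) (g : U -> V) : continuous f -> (forall t, A t -> B (f t)) ->
  {within B, continuous g} -> {within A, continuous (g \o f)}.
Proof.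
move=> cf AB /subspace_continuousP cg; apply/subspace_continuousP => t At.
have : f s @[s --> within A (nbhs t)] --> within B (nbhs (f t)).
  move=> P /= BP; have := cf t _ BP; rewrite /nbhs /= => fP.
  rewrite /within /=; near=> s => As.
  by have : (B (f s) -> P (f s)); [near: s; exact: fP | apply; exact: AB].
by move=> /cvg_comp; apply; exact: (cg (f t) (AB t At)).
Unshelve. all: by end_near. Qed.

Lemma line_continuous x e : continuous (fun s : R => x + s *: e).
Proof.
by move=> s; apply: cvgD; [exact: cvg_cst | apply: cvgZl; exact: cvg_id].
Qed.

Lemma line_cts D e w x (a b : R) : {within D, continuous w} ->
  (forall s : R, a <= s <= b -> D (x + s *: e)) ->
  {within `[a, b], continuous (fun s => w (x + s *: e))}.
Proof.
move=> cw Dab.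
apply: (@cts_comp _ _ _ [set` `[a, b]] D (fun s => x + s *: e) w).
- exact: line_continuous.
- by move=> s /=; rewrite in_itv /=; exact: Dab.
- exact: cw.
Qed.

(** At an interior point of a segment contained in D all small increments are
    allowed, so that the derivative relative to D is an ordinary one. *)
Lemma line_is_derive D e w x (a b s l : R) :
  (forall s : R, a <= s <= b -> D (x + s *: e)) -> a < s < b ->
  is_dwithin D e w (x + s *: e) l ->
  is_derive s 1 (fun s => w (x + s *: e)) l.
Proof.
move=> Dab /andP[as_ sb] wl.
suff H : (fun h => h^-1 *: (((fun s => w (x + s *: e)) \o shift s) (h *: 1)
    - w (x + s *: e))) @ (0 : R)^' --> l.
  by split; [apply: cvgP H | apply: cvg_lim].
move=> A /wl wA.
have {}wA : \forall h \near (0 : R)^', D ((x + s *: e) + h *: e) ->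
  A (dquot w (x + s *: e) e h) by exact: wA.
have D0 : \forall h \near (0 : R)^', a <= s + h <= b.
  near=> h.
  have : `|h| < Num.min (s - a) (b - s).
    near: h; apply: dnbhs0_lt; rewrite lt_min; lra.
  rewrite lt_min !ltr_norml; lra.
rewrite /nbhs /=; near=> h.
have Dh : D ((x + s *: e) + h *: e).
  by rewrite -addrA -scalerDl; apply: Dab; near: h.
have : A (dquot w (x + s *: e) e h) by move: Dh; near: h.
by rewrite /dquot /= /shift /= (_ : h *: 1 = h) -1?addrA -1?scalerDl 1?[h + s]addrC//; exact: mulr1.
Unshelve. all: by end_near. Qed.

Definition tpoly (c : nat -> R) n : {poly R} := \poly_(j < n) (c j / (j`!)%:R).

Lemma deriv_tpoly (c : nat -> R) n :
  (tpoly c n.+1)^`() = tpoly (fun j => c j.+1) n.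
Proof.
apply/polyP => j; rewrite coef_deriv !coef_poly ltnS.
case: ltnP => jn; last by rewrite mul0rn.
by rewrite -[LHS]mulr_natr factS natrM invfM -mulrA [_^-1 * _^-1]mulrC -mulrA mulVf ?mulr1//.
Qed.

Lemma tpoly0 (c : nat -> R) n : (tpoly c n.+1).[0] = c 0%N.
Proof.
rewrite horner_poly big_ord_recl /= expr0 mulr1 fact0 divr1 big1 ?addr0// => j _.
by rewrite /= expr0n mulr0.
Qed.

(** The mean value theorem from 0 to y, for y of either sign. *)
Lemma mean_value_between (f df : R -> R) (a b y : R) : a <= 0 <= b -> a <= y <= b ->
  (forall s, a < s < b -> is_derive s 1 f (df s)) ->
  {within `[a, b], continuous f} ->
  exists2 z, `|z| <= `|y| & a <= z <= b /\ f y - f 0 = df z * y.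
Proof.
move=> ab0 aby dfP cf; have [y0|y0] := leP 0 y.
  have [||z] := @MVT_segment _ f df 0 y y0.
  - by move=> z; rewrite in_itv /= => zy; apply: dfP; lra.
  - apply: continuous_subspaceW cf => z /=; rewrite !in_itv /=; lra.
  rewrite in_itv /= subr0 => zy fz; exists z; first by rewrite !ger0_norm; lra.
  by split=> //; lra.
have [||z] := @MVT_segment _ f df y 0 (ltW y0).
- by move=> z; rewrite in_itv /= => zy; apply: dfP; lra.
- apply: continuous_subspaceW cf => z /=; rewrite !in_itv /=; lra.
rewrite in_itv /= => zy fz; exists z; first by rewrite !ler0_norm; lra.
by split; lra.
Qed.

Definition iter_dwithin D e j w : E -> R := iter j (dwithin D e) w.

Lemma iter_dwithinSr D e j w : iter_dwithin D e j.+1 w = iter_dwithin D e j (dwithin D e w).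
Proof. by rewrite /iter_dwithin iterSr. Qed.

(** Induction on the order: the derivative of the remainder of order K + 1 of w is
    the remainder of order K of w', and the mean value theorem integrates the
    bound.  The factor 1/K! is lost. *)
Lemma taylor D dirs e K w x (a b M : R) :
  Ck_on dirs D K w -> dirs e -> a <= 0 <= b ->
  (forall s : R, a <= s <= b -> D (x + s *: e)) ->
  (forall s : R, a <= s <= b -> `|iter_dwithin D e K w (x + s *: e)| <= M) ->
  forall y, a <= y <= b ->
  `|w (x + y *: e) - (tpoly (fun j => iter_dwithin D e j w x) K).[y]| <= M * `|y| ^+ K.
Proof.
move=> + de ab0 Dab; elim: K w => [|K IH] w Cw wM y aby.
  by rewrite expr0 mulr1 /tpoly poly_def big_ord0 horner0 subr0; exact: wM.
pose c j := iter_dwithin D e j w x.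
have H z : a <= z <= b -> `|dwithin D e w (x + z *: e) -
    (tpoly (fun j => c j.+1) K).[z]| <= M * `|z| ^+ K.
  move=> abz; have := IH (dwithin D e w) _ _ z abz.
  rewrite (_ : tpoly _ _ = tpoly (fun j => c j.+1) K); first apply.
  - exact: Ck_dw Cw _.
  - by move=> s abs; rewrite -iter_dwithinSr; exact: wM.
  - by rewrite /tpoly; under eq_poly do rewrite -iter_dwithinSr.
pose r z := w (x + z *: e) - (tpoly c K.+1).[z].
have [||z zy [abz ryE]] := @mean_value_between r
  (fun z => dwithin D e w (x + z *: e) - (tpoly (fun j => c j.+1) K).[z])
  _ _ _ ab0 aby.
- move=> z abz; rewrite -deriv_tpoly; apply: is_deriveB.
  by apply: (line_is_derive Dab abz); apply: Ck_is_dwithin Cw de _; apply: Dab; lra.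
- apply: within_continuousB; first by apply: line_cts Dab; exact: Ck_cts Cw.
  by apply: continuous_subspaceT; exact: continuous_horner.
have r0 : r 0 = 0 by rewrite /r tpoly0 scale0r addr0 subrr.
move: ryE; rewrite r0 subr0 /r => ->.
rewrite normrM exprSr mulrA ler_wpM2r//; apply: le_trans (H z abz) _.
have M0 : 0 <= M by apply: le_trans (wM y aby).
by rewrite ler_wpM2l// lerXn2r ?nnegrE.
Qed.

(** This extends identities from the interior of a convex set to its boundary:
    x is joined to an interior point by the segment. *)
Lemma zero_closure D w x e : {within D, continuous w} ->
  (forall s : R, 0 <= s <= 1 -> D (x + s *: e)) ->
  (forall s : R, 0 < s <= 1 -> w (x + s *: e) = 0) -> w x = 0.
Proof.
move=> cw Dx w0; have := line_cts cw Dx.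
move=> /subspace_continuousP cs.
have wx : w (x + s *: e) @[s --> within [set` `[0, 1]] (nbhs (0 : R))] --> w (x + (0 : R) *: e).
  by apply: cs; rewrite /= in_itv /= lexx ler01.
rewrite scale0r addr0 in wx; move/cvgrPdist_lt : wx => wx.
apply/eqP; apply: contraT => wx0.
have /wx : 0 < `|w x| by rewrite normr_gt0.
rewrite /within /= => /nbhs_ballP[d /= d0 dw].
pose s := Num.min (d / 2) 1.
have s01 : 0 < s <= 1 by rewrite lt_min ltr01 ge_min lexx orbT andbT divr_gt0.
have := dw s; rewrite /ball /= w0// subr0 ltxx; apply.
  rewrite sub0r normrN gtr0_norm; last by case/andP: s01.
  by rewrite gt_min ltr_pdivrMr// ltr_pMr// ltr1n.
by rewrite in_itv /=; case/andP: s01 => /ltW -> ->.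
Qed.

Lemma compact_bounded_fun D w : compact D -> {within D, continuous w} ->
  exists2 M, 0 < M & forall x, D x -> `|w x| <= M.
Proof.
move=> cD cw; have := compact_bounded (continuous_compact cw cD).
move=> /pinfty_ex_gt0[M M0 wM]; exists M => // x Dx.
by apply: wM; exists x.
Qed.

Lemma within_cts_dist D w p (eps : R) : {within D, continuous w} -> D p ->
  0 < eps -> exists2 d : R, 0 < d & forall q, D q -> `|q - p| < d -> `|w q - w p| < eps.
Proof.
move=> /subspace_continuousP cw Dp e0.
have wp : w q @[q --> within D (nbhs p)] --> w p by exact: cw.
move/cvgrPdist_lt : wp => /(_ _ e0); rewrite /within /= => /nbhs_ballP[d /= d0 dw].
exists d => // q Dq qp; rewrite distrC; apply: dw => //.
by rewrite -ball_normE /= distrC.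
Qed.

(** Two applications of the mean value theorem, in the direction e2 and then in the
    direction e1, to the second mixed difference over a square of side d. *)
Lemma mixed_difference D dirs e1 e2 w p (r d : R) : Ck_on dirs D 2 w ->
  dirs e1 -> dirs e2 -> 0 < d <= r ->
  (forall s t : R, `|s| <= r -> `|t| <= r -> D (p + s *: e1 + t *: e2)) ->
  exists s t : R, [/\ `|s| <= d, `|t| <= d &
    w (p + d *: e1 + d *: e2) - w (p + d *: e1) - w (p + d *: e2) + w p
    = dwithin D e1 (dwithin D e2 w) (p + s *: e1 + t *: e2) * d * d].
Proof.
move=> Cw d1 d2 dr Dst.
have r0 : - r <= 0 <= r by lra.
have rd : - r <= d <= r by lra.
have nd : `|d| <= r by rewrite ler_norml; lra.
have n0 : `|0 : R| <= r by rewrite normr0; lra.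
have Dt s : `|s| <= r -> forall t : R, - r <= t <= r -> D (p + s *: e1 + t *: e2).
  by move=> sr t tr; apply: Dst => //; rewrite ler_norml.
have D0 : forall t : R, - r <= t <= r -> D (p + t *: e2).
  by move=> t /(Dt 0 n0); rewrite scale0r addr0.
have [||t td [rt H]] := @mean_value_between
  (fun t => w (p + d *: e1 + t *: e2) - w (p + t *: e2))
  (fun t => dwithin D e2 w (p + d *: e1 + t *: e2) - dwithin D e2 w (p + t *: e2))
  _ _ _ r0 rd.
- move=> t rt; apply: is_deriveB.
    apply: (line_is_derive (Dt d nd) rt); apply: Ck_is_dwithin Cw d2 _; apply: Dt => //; lra.
  apply: (line_is_derive D0 rt); apply: Ck_is_dwithin Cw d2 _; apply: D0; lra.
- apply: within_continuousB.
    by apply: line_cts (Dt d nd); exact: Ck_cts Cw.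
  by apply: line_cts D0; exact: Ck_cts Cw.
have Cw2 : Ck_on dirs D 1 (dwithin D e2 w) by exact: Ck_dw.
have nt : `|t| <= r by apply: le_trans td _.
have Ds : forall s : R, - r <= s <= r -> D (p + t *: e2 + s *: e1).
  by move=> s sr; rewrite addrAC; apply: Dst => //; rewrite ler_norml.
have [||s sd [rs H']] := @mean_value_between
  (fun s => dwithin D e2 w (p + t *: e2 + s *: e1))
  (fun s => dwithin D e1 (dwithin D e2 w) (p + t *: e2 + s *: e1))
  _ _ _ r0 rd.
- move=> s rs'; apply: (line_is_derive Ds rs'); apply: Ck_is_dwithin Cw2 d1 _; apply: Ds; lra.
- by apply: line_cts Ds; exact: Ck_cts Cw2.
have dd : `|d| = d by rewrite ger0_norm; lra.
exists s, t; rewrite -dd; split=> //; rewrite dd.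
move: H; rewrite !scale0r !addr0 => H.
move: H'; rewrite scale0r addr0 ![p + t *: e2 + _]addrAC => H'.
by rewrite -H' -H; ring.
Qed.

(** The mixed difference is symmetric in e1 and e2, so that by [mixed_difference]
    the two mixed derivatives take the same value at points near p. *)
Lemma schwarz_interior D dirs e1 e2 w p (r : R) : Ck_on dirs D 2 w ->
  dirs e1 -> dirs e2 -> 0 < r ->
  (forall s t : R, `|s| <= r -> `|t| <= r -> D (p + s *: e1 + t *: e2)) ->
  dwithin D e1 (dwithin D e2 w) p = dwithin D e2 (dwithin D e1 w) p.
Proof.
move=> Cw d1 d2 r0 Dst.
have Dp : D p.
  by have := Dst 0 0; rewrite normr0 !scale0r !addr0; apply; exact: ltW.
apply/eqP; rewrite -subr_eq0 -normr_le0; apply/ler_addgt0Pl => e e0.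
have C12 : {within D, continuous (dwithin D e1 (dwithin D e2 w))}.
  by apply: (@Ck_cts _ _ _ dirs 0); do 2 ?[apply: Ck_dw => //].
have C21 : {within D, continuous (dwithin D e2 (dwithin D e1 w))}.
  by apply: (@Ck_cts _ _ _ dirs 0); do 2 ?[apply: Ck_dw => //].
have e20 : 0 < e / 2 by lra.
have [d d0 fd] := within_cts_dist C12 Dp e20.
have [d' d'0 gd] := within_cts_dist C21 Dp e20.
(* |s e1 + t e2| <= z c whenever |s|, |t| <= z *)
pose c := 1 + `|e1| + `|e2|.
have c1 : 1 <= c by rewrite /c -addrA lerDl addr_ge0.
have c0 : 0 < c by lra.
pose z := Num.min r (Num.min d d' / 2 / c).
have z0 : 0 < z by rewrite lt_min r0 !divr_gt0// lt_min d0.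
have zr : 0 < z <= r by rewrite z0 ge_min lexx.
have small (s t : R) : `|s| <= z -> `|t| <= z ->
    `|p + s *: e1 + t *: e2 - p| < d /\ `|p + s *: e1 + t *: e2 - p| < d'.
  move=> sz tz.
  have -> : p + s *: e1 + t *: e2 - p = s *: e1 + t *: e2.
    by rewrite addrAC [p + _]addrC addrK.
  have H : `|s *: e1 + t *: e2| <= Num.min d d' / 2.
    apply: le_trans (ler_normD _ _) _; rewrite !normrZ.
    have : z * c <= Num.min d d' / 2 by rewrite -ler_pdivlMr// ge_min lexx orbT.
    have := ler_wpM2r (normr_ge0 e1) sz; have := ler_wpM2r (normr_ge0 e2) tz.
    rewrite /c; have := normr_ge0 e1; have := normr_ge0 e2; nra.
  have m0 : 0 < Num.min d d' by rewrite lt_min d0.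
  have : `|s *: e1 + t *: e2| < Num.min d d' by apply: le_lt_trans H _; lra.
  by rewrite lt_min => /andP[].
have [s [t [sz tz H]]] := mixed_difference Cw d1 d2 zr Dst.
have [|t' [s' [t'z s'z H']]] := mixed_difference Cw d2 d1 zr (p := p).
  by move=> a b ar br; rewrite addrAC; exact: Dst.
have Hz (a b : R) : `|a| <= z -> `|b| <= z -> D (p + a *: e1 + b *: e2).
  by case/andP: zr => _ zr az bz; apply: Dst; [exact: le_trans az zr | exact: le_trans bz zr].
have := fd _ (Hz _ _ sz tz) (small _ _ sz tz).1.
have := gd _ (Hz _ _ s'z t'z) (small _ _ s'z t'z).2.
suff -> : dwithin D e1 (dwithin D e2 w) (p + s *: e1 + t *: e2) =
    dwithin D e2 (dwithin D e1 w) (p + s' *: e1 + t' *: e2).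
  by rewrite !ltr_norml addr0 ler_norml; lra.
apply: (@mulIf _ z); first by rewrite gt_eqF.
apply: (@mulIf _ z); first by rewrite gt_eqF.
rewrite -H (addrAC p (s' *: e1)) -H' [p + z *: e2 + _]addrAC; ring.
Qed.

End Lines.

(** * Expansions in the step, uniform over a family *)

Lemma factRE (R : realType) : ((0`!)%:R = 1 :> R) * ((1`!)%:R = 1 :> R) *
  ((2`!)%:R = 2 :> R) * ((3`!)%:R = 6 :> R) * ((4`!)%:R = 24 :> R) *
  ((5`!)%:R = 120 :> R).
Proof. by []. Qed.

Section Expansion.
Context {R : realType} {I : Type}.
Variables (P : set I) (h : I -> R).
Hypothesis h01 : forall x, P x -> 0 < h x <= 1.
Implicit Types (F G : I -> R) (c d : nat -> I -> R).

(** The families are indexed by I; the bound is uniform on the part P of I. *)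
Definition ubounded F : Prop := exists C, forall x, P x -> `|F x| <= C.

Lemma ubounded_ext F G : (forall x, P x -> F x = G x) -> ubounded F -> ubounded G.
Proof. by move=> FG [C FC]; exists C => x Px; rewrite -FG// FC. Qed.

Lemma ubounded_cst (a : R) : ubounded (fun=> a).
Proof. by exists `|a|. Qed.

Lemma uboundedD F G : ubounded F -> ubounded G -> ubounded (fun x => F x + G x).
Proof.
move=> [C FC] [C' GC]; exists (C + C') => x Px.
by rewrite (le_trans (ler_normD _ _))// lerD// (FC, GC).
Qed.

Lemma uboundedM F G : ubounded F -> ubounded G -> ubounded (fun x => F x * G x).
Proof.
move=> [C FC] [C' GC]; exists (C * C') => x Px.
by rewrite normrM ler_pM// (FC, GC).
Qed.

Lemma uboundedN F : ubounded F -> ubounded (fun x => - F x).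
Proof. by move=> [C FC]; exists C => x Px; rewrite normrN FC. Qed.

Lemma uboundedB F G : ubounded F -> ubounded G -> ubounded (fun x => F x - G x).
Proof. by move=> bF bG; apply: uboundedD => //; exact: uboundedN. Qed.

Lemma uboundedX F n : ubounded F -> ubounded (fun x => F x ^+ n).
Proof.
move=> [C FC]; exists (C ^+ n) => x Px.
by rewrite normrX lerXn2r ?nnegrE// ?FC// (le_trans _ (FC x Px)).
Qed.

Lemma uboundedV F m : 0 < m -> (forall x, P x -> m <= F x) -> ubounded (fun x => (F x)^-1).
Proof.
move=> m0 mF; exists m^-1 => x Px; rewrite ger0_norm ?invr_ge0 ?(le_trans (ltW m0)) ?mF//.
by rewrite lef_pV2 ?posrE ?(lt_le_trans m0) ?mF.
Qed.

Lemma uboundedh : ubounded h.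
Proof. by exists 1 => x /h01/andP[h0 h1]; rewrite gtr0_norm. Qed.

Lemma ubounded_gt0 F : ubounded F -> exists2 C, 0 < C & forall x, P x -> `|F x| <= C.
Proof.
move=> [C FC]; exists (`|C| + 1); first by have := normr_ge0 C; lra.
by move=> x Px; rewrite (le_trans (FC x Px))// (le_trans (ler_norm C))// lerDl ler01.
Qed.

(** F = c_0 + c_1 h + ... + c_(q-1) h^(q-1) + O(h^q), with bounded coefficients.
    The remainder is peeled off one power of h at a time, which makes the product
    rule a plain induction. *)
Fixpoint expansion (q : nat) F c : Prop :=
  if q is q'.+1 then
    ubounded (c 0%N) /\ exists2 F1, (forall x, P x -> F x = c 0%N x + h x * F1 x)
                             & expansion q' F1 (fun n => c n.+1)
  else ubounded F.

Lemma expansion_bnd q F c : expansion q F c -> ubounded F.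
Proof.
elim: q F c => [|q IH] F c //= [b0 [F1 FE /IH b1]].
have := uboundedD b0 (uboundedM uboundedh b1).
by apply: ubounded_ext => x /FE ->.
Qed.

Lemma expansion_ext q F G c d : (forall x, P x -> F x = G x) ->
  (forall n x, (n < q)%N -> P x -> c n x = d n x) -> expansion q F c -> expansion q G d.
Proof.
elim: q F G c d => [|q IH] F G c d FG cd /=; first exact: ubounded_ext.
move=> [b0 [F1 FE E1]]; split; first by apply: ubounded_ext b0 => x; exact: cd.
exists F1; first by move=> x Px; rewrite -FG// FE// (cd 0%N).
by apply: IH E1 => // n x nq; exact: cd.
Qed.

Lemma expansionD q F G c d : expansion q F c -> expansion q G d ->
  expansion q (fun x => F x + G x) (fun n x => c n x + d n x).
Proof.
elim: q F G c d => [|q IH] F G c d /=; first exact: uboundedD.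
move=> [b0 [F1 FE E1]] [b'0 [G1 GE E'1]]; split; first exact: uboundedD.
exists (fun x => F1 x + G1 x); last exact: (IH F1 G1 (fun n => c n.+1) (fun n => d n.+1)).
by move=> x Px; rewrite FE// GE//; ring.
Qed.

Lemma expansionZ q a F c : ubounded a -> expansion q F c ->
  expansion q (fun x => a x * F x) (fun n x => a x * c n x).
Proof.
move=> ba; elim: q F c => [|q IH] F c /=; first exact: uboundedM.
move=> [b0 [F1 FE E1]]; split; first exact: uboundedM.
exists (fun x => a x * F1 x); last exact: (IH F1 (fun n => c n.+1)).
by move=> x Px; rewrite FE//; ring.
Qed.

Lemma expansionB q F G c d : expansion q F c -> expansion q G d ->
  expansion q (fun x => F x - G x) (fun n x => c n x - d n x).
Proof.
move=> EF EG; have := expansionD EF (expansionZ (ubounded_cst (-1)) EG).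
by apply: expansion_ext => *; rewrite mulN1r.
Qed.

Definition cshift c n : I -> R := if n is n'.+1 then c n' else fun=> 0.

Lemma expansionW q F c : expansion q.+1 F c -> expansion q F c.
Proof.
elim: q F c => [|q IH] F c EF; first exact: expansion_bnd EF.
case: EF => b0 [F1 FE E1]; split=> //; exists F1 => //; exact: IH.
Qed.

Lemma expansionh q F c : expansion q F c -> expansion q.+1 (fun x => h x * F x) (cshift c).
Proof.
move=> EF; split; first exact: ubounded_cst.
by exists F => // x _; rewrite add0r.
Qed.

Lemma expansion_cst q F : ubounded F -> expansion q F (fun n => if n is 0%N then F else fun=> 0).
Proof.
have E0 : forall k, expansion k (fun=> 0) (fun _ _ => 0).
  elim=> [|k IH] /=; first exact: ubounded_cst.
  split; first exact: ubounded_cst.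
  by exists (fun=> 0) => // x _; rewrite mulr0 addr0.
case: q => [|q] //= bF; split=> //.
by exists (fun=> 0) => [x _|//]; rewrite mulr0 addr0.
Qed.

(** The coefficients of a product of power series, in a form that computes. *)
Fixpoint cauchy_prod c d n : I -> R := fun x =>
  if n is n'.+1 then c 0%N x * d n'.+1 x + cauchy_prod (fun n => c n.+1) d n' x
  else c 0%N x * d 0%N x.

Lemma expansionM q F G c d : expansion q F c -> expansion q G d ->
  expansion q (fun x => F x * G x) (cauchy_prod c d).
Proof.
elim: q F c => [|q IH] F c /=; first exact: uboundedM.
move=> [b0 [F1 FE E1]] EG; have [b'0 [G1 GE E'1]] := EG.
split; first exact: uboundedM.
exists (fun x => c 0%N x * G1 x + F1 x * G x).
  by move=> x Px; rewrite FE// [in LHS]GE//; rewrite GE//; ring.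
exact: expansionD (expansionZ b0 E'1) (IH _ _ E1 (expansionW EG)).
Qed.

(** Dividing by h is possible because h > 0. *)
Lemma expansion_of_bound q F c : (forall n, (n < q)%N -> ubounded (c n)) ->
  (exists C, forall x, P x -> `|F x - \sum_(n < q) c n x * h x ^+ n| <= C * h x ^+ q) ->
  expansion q F c.
Proof.
elim: q F c => [|q IH] F c bc [C FC].
  by exists C => x /FC; rewrite big_ord0 subr0 expr0 mulr1.
split; first exact: bc.
exists (fun x => (F x - c 0%N x) / h x).
  move=> x /h01/andP[h0 _]; rewrite mulrC divfK ?gt_eqF//; ring.
apply: IH => [n nq|]; first exact: bc.
exists C => x Px; have /andP[h0 _] := h01 Px.
rewrite -(ler_pM2r h0) -mulrA -exprSr -[X in _ * X <= _](gtr0_norm h0) -normrM.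
apply: le_trans (FC x Px); rewrite big_ord_recl /= expr0 mulr1 le_eqVlt; apply/orP; left.
apply/eqP; congr (`| _ |); rewrite mulrBl divfK ?gt_eqF// big_distrl /= opprD addrA.
by congr (_ - _); apply: eq_bigr => i _; rewrite /bump /= add1n exprSr mulrA.
Qed.

(** How expansions are used: if all listed coefficients vanish, then F = O(h^q). *)
Lemma expansion_small q F c : expansion q F c ->
  (forall n x, (n < q)%N -> P x -> c n x = 0) ->
  exists C, forall x, P x -> `|F x| <= C * h x ^+ q.
Proof.
elim: q F c => [|q IH] F c /=.
  by move=> [C FC] _; exists C => x /FC; rewrite expr0 mulr1.
move=> [_ [F1 FE E1]] c0; have [|C FC] := IH F1 _ E1.
  by move=> n x nq; exact: c0.
exists C => x Px; rewrite FE// c0// add0r exprS normrM mulrCA.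
have /andP[h0 _] := h01 Px.
by rewrite gtr0_norm// ler_pM2l// FC.
Qed.

(** The mean of y^n over m - 1 <= y <= m. *)
Definition unit_moment (n : nat) (m : R) : R := (m ^+ n.+1 - (m - 1) ^+ n.+1) / n.+1%:R.

(** The n-th derivative of a product from those of the factors, by the product rule
    rather than with binomial coefficients. *)
Fixpoint leibniz (s p : nat -> R) (n : nat) : R :=
  if n is n'.+1 then leibniz (fun j => s j.+1) p n' + leibniz s (fun j => p j.+1) n'
  else s 0%N * p 0%N.

Variables (s : nat -> I -> R) (m : R) (m0 : 0 < m).
Hypothesis s0m : forall x, P x -> m <= s 0%N x.

Lemma ubounded_s0V : ubounded (fun x => (s 0%N x)^-1).
Proof. exact: uboundedV m0 _. Qed.

(** The expansion of a mean value of sigma over the cell on the left (e = -1) or on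
    the right (e = 1) of a node, in terms of the derivatives s of sigma there: the
    moments of 1, y, y^2, y^3 over [0, 1] are divided by the factorials, and kappa is
    the fourth one divided by 4!, which depends on the mean value chosen. *)
Definition hat_coef (kappa e : R) (n : nat) : I -> R := fun x =>
  nth 0 [:: s 0%N x; e * s 1%N x / 2; s 2%N x / 6; e * s 3%N x / 24;
            kappa * s 4%N x] n.

(** * The expansion of the flux difference *)

Section Flux.
Variables (p : nat -> I -> R) (kappa : R) (a b du dv : I -> R).
Hypothesis am : forall x, P x -> m <= a x.
Hypothesis bm : forall x, P x -> m <= b x.
Hypothesis bs : forall n, (n < 5)%N -> ubounded (s n).
Hypothesis bp : forall n, (n < 5)%N -> ubounded (p n).
Hypothesis Ea : expansion 5 a (hat_coef kappa (-1)).
Hypothesis Eb : expansion 5 b (hat_coef kappa 1).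
Hypothesis Edu : expansion 5 du (fun n x => leibniz (s^~ x) (p^~ x) n / (n.+1`!)%:R).
Hypothesis Edv : expansion 5 dv (fun n x => (-1) ^+ n * leibniz (s^~ x) (p^~ x) n / (n.+1`!)%:R).

(** This is p''' + (sigma' p' / sigma)', that is L_k (sigma p') in terms of the
    derivatives of sigma and p at a point. *)
Definition flux2 x : R := p 3%N x + (s 2%N x * p 1%N x + s 1%N x * p 2%N x) / s 0%N x
  - s 1%N x ^+ 2 * p 1%N x / s 0%N x ^+ 2.

Lemma ubounded_flux2 : ubounded flux2.
Proof.
have b0 := ubounded_s0V.
apply: uboundedB; last first.
  apply: uboundedM; first by apply: uboundedM; [apply: uboundedX; exact: bs | exact: bp].
  by under eq_fun do rewrite -exprVn; exact: uboundedX.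
apply: uboundedD; first exact: bp.
by apply: uboundedM => //; apply: uboundedD; apply: uboundedM; (exact: bs || exact: bp).
Qed.

(** Multiplying by the two mean values a and b gives an expression which is
    polynomial in the expanded quantities; its five lowest coefficients vanish
    identically, and the division by h a b costs one order.  Here du and dv are
    the difference quotients of w to the right and to the left, whose coefficients
    come from w' = sigma p. *)
Lemma flux_difference4 : exists C, forall x, P x ->
  `|(h x)^-1 * (du x / b x - dv x / a x) - (p 1%N x + h x ^+ 2 / 12 * flux2 x)|
  <= C * h x ^+ 4.
Proof.
have Eq : expansion 5 (fun x => p 1%N x + h x * (h x * (flux2 x / 12))) _ :=
  expansionD (expansion_cst 5 (bp (isT : (1 < 5)%N)))
   (expansionh (expansionh (expansion_cst 3 (uboundedM ubounded_flux2 (ubounded_cst 12^-1))))).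
have EE := expansionB (expansionW (expansionh (expansionM (expansionM Ea Eb) Eq)))
  (expansionB (expansionM Ea Edu) (expansionM Eb Edv)).
have [|C HC] := expansion_small EE.
  move=> n x n5 Px.
  have sx : s 0%N x != 0 by rewrite gt_eqF// (lt_le_trans m0)// s0m.
  case: n n5 => [|[|[|[|[|//]]]]] _;
  by rewrite /= /hat_coef /flux2 /leibniz /= ?factRE ?expr0 ?expr1; field.
exists (C / m / m) => x Px.
have /andP[h0 _] := h01 Px.
have ax := lt_le_trans m0 (am Px); have bx := lt_le_trans m0 (bm Px).
rewrite (_ : _ - _ = - (h x * (a x * b x * (p 1%N x + h x * (h x * (flux2 x / 12))))
    - (a x * du x - b x * dv x)) / (h x * a x * b x)); last first.
  by field; rewrite !gt_eqF.
rewrite normrM normrN normfV !normrM (gtr0_norm h0) (gtr0_norm ax) (gtr0_norm bx).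
rewrite ler_pdivrMr ?mulr_gt0//; apply: le_trans (_ : _ <= C * h x ^+ 5) _.
  exact: HC.
have C0 : 0 <= C * h x ^+ 5 by apply: le_trans (HC x Px).
rewrite (_ : _ / _ / _ * _ * _ = C * h x ^+ 5 * ((a x / m) * (b x / m))); last first.
  by field; rewrite gt_eqF.
by rewrite ler_peMr// mulr_ege1// ler_pdivlMr// mul1r (am, bm).
Qed.

Lemma flux_difference2 : exists C, forall x, P x ->
  `|(h x)^-1 * (du x / b x - dv x / a x) - p 1%N x| <= C * h x ^+ 2.
Proof.
have [C HC] := flux_difference4; have [F F0 HF] := ubounded_gt0 ubounded_flux2.
exists (C + F) => x Px; have /andP[h0 h1] := h01 Px.
have Fx := HF x Px; have zC := HC x Px; rewrite opprD addrA in zC.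
set z := _ - p 1%N x in zC *.
have C0 : 0 <= C * h x ^+ 4 by apply: le_trans (HC x Px).
have h20 : 0 <= h x ^+ 2 by rewrite exprn_ge0// ltW.
have h4 : C * h x ^+ 4 <= C * h x ^+ 2.
  apply: ler_wpM2l; first by rewrite -(pmulr_lge0 _ (exprn_gt0 4 h0)).
  by rewrite ler_wiXn2l// ltW.
have -> : z = (z - h x ^+ 2 / 12 * flux2 x) + h x ^+ 2 / 12 * flux2 x.
  by rewrite subrK.
apply: le_trans (ler_normD _ _) _; rewrite mulrDl lerD//; first exact: le_trans h4.
rewrite normrM ger0_norm; last by rewrite divr_ge0.
by rewrite mulrC ler_pM// ?divr_ge0// ler_pdivrMr// ler_peMr// ler1n.
Qed.

End Flux.

(** * The harmonic mean of two mean values *)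

Section HarmonicMean.
Hypothesis bs : forall n, (n < 4)%N -> ubounded (s n).

(** With a and b the mean values on both sides of a node, 2ab/(a + b) - sigma =
    h^2 r + O(h^4), where r = sigma''/6 - sigma'^2/(4 sigma). *)
Definition harm0 x : R := s 2%N x / 6 - s 1%N x ^+ 2 / (4 * s 0%N x).

(** The derivative of the coefficient r above. *)
Definition harm1 x : R := s 3%N x / 6 - s 1%N x * s 2%N x / (2 * s 0%N x)
  + s 1%N x ^+ 3 / (4 * s 0%N x ^+ 2).

Lemma ubounded_harm0 : ubounded harm0.
Proof.
apply: uboundedB; first by apply: uboundedM; [exact: bs | exact: ubounded_cst].
under eq_fun do rewrite invfM mulrA mulrAC.
apply: uboundedM; last exact: ubounded_cst.
by apply: uboundedM; [apply: uboundedX; exact: bs | exact: ubounded_s0V].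
Qed.

Lemma ubounded_harm1 : ubounded harm1.
Proof.
have b0 := ubounded_s0V.
apply: uboundedD; first apply: uboundedB.
- by apply: uboundedM; [exact: bs | exact: ubounded_cst].
- under eq_fun do rewrite invfM mulrA mulrAC.
  apply: uboundedM; last exact: ubounded_cst.
  by apply: uboundedM => //; apply: uboundedM; exact: bs.
- under eq_fun do rewrite invfM mulrA mulrAC -exprVn.
  apply: uboundedM; last exact: ubounded_cst.
  by apply: uboundedM; [apply: uboundedX; exact: bs | exact: uboundedX].
Qed.

(** The difference between the harmonic mean and sigma at the point x + j h,
    expanded at x.  One base point x is used for all nodes of the stencil, because
    the cells next to a boundary node lie partly outside the domain.  The identity
    is checked after multiplication by a + b. *)
Lemma harmonic_mean_expansion (j : R) (a b sj : I -> R) :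
  (forall x, P x -> m <= a x) -> (forall x, P x -> m <= b x) ->
  expansion 4 a (fun n x => s n x / (n`!)%:R * unit_moment n j) ->
  expansion 4 b (fun n x => s n x / (n`!)%:R * unit_moment n (j + 1)) ->
  expansion 4 sj (fun n x => s n x / (n`!)%:R * j ^+ n) ->
  expansion 4 (fun x => (((a x)^-1 + (b x)^-1) / 2)^-1 - sj x)
    (fun n x => nth 0 [:: 0; 0; harm0 x; j * harm1 x] n).
Proof.
move=> am bm Ea Eb Esj.
have Eq : expansion 4 (fun x => h x * (h x * (harm0 x + h x * (j * harm1 x)))) _ :=
  expansionh (expansionh (expansionD (expansion_cst 2 ubounded_harm0)
    (expansionh (expansion_cst 1 (uboundedM (ubounded_cst j) ubounded_harm1))))).
have EE := expansionB (expansionB (expansionM (expansion_cst 4 (ubounded_cst 2)) (expansionM Ea Eb))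
   (expansionM (expansionD Ea Eb) Esj)) (expansionM (expansionD Ea Eb) Eq).
have [|C HC] := expansion_small EE.
  move=> n x n4 Px.
  have sx : s 0%N x != 0 by rewrite gt_eqF// (lt_le_trans m0)// s0m.
  case: n n4 => [|[|[|[|//]]]] _;
  by rewrite /= /unit_moment /harm0 /harm1 ?factRE ?expr0 ?expr1; field.
apply: expansion_of_bound.
  move=> [|[|[|[|//]]]] _ /=; try exact: ubounded_cst; first exact: ubounded_harm0.
  by apply: uboundedM; [exact: ubounded_cst | exact: ubounded_harm1].
exists (C / (2 * m)) => x Px.
have ax := lt_le_trans m0 (am x Px); have bx := lt_le_trans m0 (bm x Px).
rewrite !big_ord_recl big_ord0 /=.
rewrite (_ : _ - _ = (2 * (a x * b x) - (a x + b x) * sj x -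
    (a x + b x) * (h x * (h x * (harm0 x + h x * (j * harm1 x))))) / (a x + b x)); last first.
  by field; rewrite !gt_eqF ?addr_gt0.
rewrite normrM normfV (gtr0_norm (addr_gt0 ax bx)) ler_pdivrMr ?addr_gt0//.
apply: le_trans (HC x Px) _.
have C0 : 0 <= C * h x ^+ 4 by apply: le_trans (HC x Px).
rewrite (_ : _ / _ * _ * _ = C * h x ^+ 4 * ((a x + b x) / (2 * m))); last first.
  by field; rewrite gt_eqF.
rewrite ler_peMr// ler_pdivlMr ?mulr_gt0// mul1r.
have := am x Px; have := bm x Px; lra.
Qed.

(** A second difference divides by h^2, hence a perturbation of size h^2 may be
    expected to give O(1).  If it varies smoothly from node to node, namely as
    h^2 (r_0 + j h r_1) for j = -1, 0, 1, then two more powers of h are gained. *)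
Lemma flux_difference_perturbation (kappa : R) (a b w0 w1 wp : I -> R) (r : nat -> I -> R) :
  (forall x, P x -> m <= a x) -> (forall x, P x -> m <= b x) ->
  expansion 4 a (hat_coef kappa (-1)) -> expansion 4 b (hat_coef kappa 1) ->
  expansion 4 w1 (fun n x => nth 0 [:: 0; 0; r 0%N x; -1 * r 1%N x] n) ->
  expansion 4 w0 (fun n x => nth 0 [:: 0; 0; r 0%N x; 0 * r 1%N x] n) ->
  expansion 4 wp (fun n x => nth 0 [:: 0; 0; r 0%N x; 1 * r 1%N x] n) ->
  exists C, forall x, P x ->
  `|(h x)^-1 * ((wp x - w0 x) / (b x * h x) - (w0 x - w1 x) / (a x * h x))|
    <= C * h x ^+ 2.
Proof.
move=> am bm Ea Eb E1 E0 Ep.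
have EE := expansionB (expansionM Ea (expansionB Ep E0)) (expansionM Eb (expansionB E0 E1)).
have [|C HC] := expansion_small EE.
  move=> n x n4 Px.
  by case: n n4 => [|[|[|[|//]]]] _; rewrite /= /hat_coef /=; ring.
exists (C / m / m) => x Px.
have /andP[h0 _] := h01 Px.
have ax := lt_le_trans m0 (am x Px); have bx := lt_le_trans m0 (bm x Px).
rewrite (_ : _^-1 * _ = (a x * (wp x - w0 x) - b x * (w0 x - w1 x)) /
   (h x ^+ 2 * a x * b x)); last by field; rewrite !gt_eqF.
rewrite normrM normfV (gtr0_norm (_ : 0 < h x ^+ 2 * a x * b x)) ?mulr_gt0 ?exprn_gt0//.
rewrite ler_pdivrMr ?mulr_gt0 ?exprn_gt0//; apply: le_trans (HC x Px) _.
have C0 : 0 <= C * h x ^+ 4 by apply: le_trans (HC x Px).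
rewrite (_ : _ / _ / _ * _ * _ = C * h x ^+ 4 * ((a x / m) * (b x / m))); last first.
  by field; rewrite gt_eqF.
by rewrite ler_peMr// mulr_ege1// ler_pdivlMr// mul1r (am, bm).
Qed.

End HarmonicMean.
End Expansion.

(** * Mean values over a cell *)

Section Mean.
Context {R : realType}.

Definition mean_value (mr : mean_rule) (h : R) (phi : R -> R) (y : R) : R :=
  match mr with
  | MeanI => h^-1 * \int[lebesgue_measure]_(z in `[y - h, y]) phi z
  | MeanS => (phi (y - h) + 4 * phi (y - h / 2) + phi y) / 6
  | MeanG =>
      let theta := (2 * Num.sqrt 3)^-1 in
      (phi (y - h / 2 - theta * h) + phi (y - h / 2 + theta * h)) / 2
  end.

(** The means of y^n over m - 1 <= y <= m according to the three rules. *)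
Definition rule_moment (mr : mean_rule) (n : nat) (m : R) : R :=
  match mr with
  | MeanI => unit_moment n m
  | MeanS => ((m - 1) ^+ n + 4 * (m - 2^-1) ^+ n + m ^+ n) / 6
  | MeanG =>
      let theta := (2 * Num.sqrt 3)^-1 in
      ((m - 2^-1 - theta) ^+ n + (m - 2^-1 + theta) ^+ n) / 2
  end.

Lemma gauss_node2 : ((2 * Num.sqrt 3)^-1 : R) ^+ 2 = 12^-1.
Proof. by rewrite exprVn exprMn sqr_sqrtr ?ler0n//; congr (_^-1); ring. Qed.

Lemma rule_moment_lt4 mr n m : (n < 4)%N -> rule_moment mr n m = unit_moment n m.
Proof.
move=> n4; case: mr => //=; rewrite /unit_moment.
  by case: n n4 => [|[|[|[|//]]]] _; field.
set t := (2 * _)^-1; have t2 : t ^+ 2 = 12^-1 := gauss_node2.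
have t3 : t ^+ 3 = 12^-1 * t by rewrite exprSr t2.
case: n n4 => [|[|[|[|//]]]] _; try by field.
  have -> : (m - 2^-1 - t) ^+ 2 + (m - 2^-1 + t) ^+ 2 = 2 * (m - 2^-1) ^+ 2 + 2 * t ^+ 2 by ring.
  by rewrite t2; field.
have -> : (m - 2^-1 - t) ^+ 3 + (m - 2^-1 + t) ^+ 3
  = 2 * (m - 2^-1) ^+ 3 + 6 * (m - 2^-1) * t ^+ 2 by ring.
by rewrite t2; field.
Qed.

(** The fourth moments differ from one rule to another; the cancellation in
    [flux_difference4] only needs this symmetry about 0. *)
Lemma rule_moment4_sym mr : rule_moment mr 4 0 = rule_moment mr 4 1.
Proof.
case: mr => /=; rewrite /unit_moment; first by field.
  by field.
by field; rewrite sqrtr_eq0; lra.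
Qed.

Lemma gauss_node_itv : 0 <= ((2 * Num.sqrt 3)^-1 : R) <= 2^-1.
Proof.
have s3 : 1 <= Num.sqrt 3 :> R by rewrite -[leLHS]sqrtr1 ler_sqrt; lra.
apply/andP; split; first by rewrite invr_ge0 mulr_ge0// sqrtr_ge0.
by rewrite lef_pV2 ?posrE//; lra.
Qed.

Lemma Rintegral_deriv (F : {poly R}) (a b : R) : a < b ->
  \int[lebesgue_measure]_(z in `[a, b]) F^`().[z] = F.[b] - F.[a].
Proof.
move=> ab; rewrite /Rintegral (@continuous_FTC2 _ _ (horner F))//.
- by apply: continuous_subspaceT; exact: continuous_horner.
- split.
  + by move=> x _; exact: derivable_horner.
  + by apply: cvg_at_right_filter; exact: continuous_horner.
  + by apply: cvg_at_left_filter; exact: continuous_horner.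
- by move=> x _; rewrite derivE.
Qed.

(** Only monotonicity of the integral is used: phi lies between the polynomials
    F' - eps and F' + eps, whose integrals are explicit. *)
Lemma Rintegral_approx (phi : R -> R) (F : {poly R}) (a b eps : R) : a < b ->
  {within `[a, b], continuous phi} ->
  (forall z, a <= z <= b -> `|phi z - F^`().[z]| <= eps) ->
  `|\int[lebesgue_measure]_(z in `[a, b]) phi z - (F.[b] - F.[a])| <= eps * (b - a).
Proof.
move=> ab cphi phiF.
have int_cts (f : R -> R) : {within `[a, b], continuous f} ->
    lebesgue_measure.-integrable `[a, b] (EFin \o f).
  by move=> cf; apply: continuous_compact_integrable => //; exact: segment_compact.
have int_poly (G : {poly R}) : lebesgue_measure.-integrable `[a, b] (EFin \o horner G).
  by apply: int_cts; apply: continuous_subspaceT; exact: continuous_horner.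
have bound (e : R) : (F + e *: 'X).[b] - (F + e *: 'X).[a] = F.[b] - F.[a] + e * (b - a).
  by rewrite !hornerE; ring.
have d (e : R) z : (F + e *: 'X)^`().[z] = F^`().[z] + e.
  by rewrite derivD derivZ derivX !hornerE.
have lo : (F + (- eps) *: 'X).[b] - (F + (- eps) *: 'X).[a] <=
    \int[lebesgue_measure]_(z in `[a, b]) phi z.
  rewrite -Rintegral_deriv//; apply: le_Rintegral => //; try exact: int_cts.
  by move=> z; rewrite /= in_itv /= => /phiF; rewrite d ler_norml; lra.
have hi : \int[lebesgue_measure]_(z in `[a, b]) phi z <=
    (F + eps *: 'X).[b] - (F + eps *: 'X).[a].
  rewrite -Rintegral_deriv//; apply: le_Rintegral => //; try exact: int_cts.
  by move=> z; rewrite /= in_itv /= => /phiF; rewrite d ler_norml; lra.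
by move: lo hi; rewrite !bound ler_norml; lra.
Qed.

(** Each rule is a positive functional with value 1 on constants, so that it
    does not increase the distance to a polynomial. *)
Lemma mean_approx mr (h : R) (phi : R -> R) (x m : R) (c : nat -> R) q (eps : R) :
  0 < h -> {within `[x + (m - 1) * h, x + m * h], continuous phi} ->
  (forall z, x + (m - 1) * h <= z <= x + m * h ->
     `|phi z - \sum_(n < q) c n * (z - x) ^+ n| <= eps) ->
  `|mean_value mr h phi (x + m * h) - \sum_(n < q) c n * rule_moment mr n m * h ^+ n| <= eps.
Proof.
move=> h0 cphi phic.
have [t0 t1] := andP gauss_node_itv.
case: mr => /=.
- pose G : {poly R} := \poly_(n < q.+1) (if n is n'.+1 then c n' / n'.+1%:R else 0).
  pose p : {poly R} := \poly_(n < q) c n.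
  have Gp : G^`() = p.
    apply/polyP => n; rewrite coef_deriv !coef_poly ltnS; case: ltnP => _; last by rewrite mul0rn.
    by rewrite -[LHS]mulr_natr divfK// pnatr_eq0.
  pose F := G \Po ('X - x%:P).
  have Fp z : F^`().[z] = \sum_(n < q) c n * (z - x) ^+ n.
    by rewrite /F deriv_comp Gp derivXsubC mulr1 horner_comp horner_poly !hornerE.
  have hE : x + m * h - h = x + (m - 1) * h by ring.
  rewrite hE; have ab : x + (m - 1) * h < x + m * h by rewrite -hE ltrBlDr ltrDl.
  have := @Rintegral_approx phi F _ _ eps ab cphi.
  have -> : x + m * h - (x + (m - 1) * h) = h by ring.
  have -> : F.[x + m * h] - F.[x + (m - 1) * h] =
      h * \sum_(n < q) c n * unit_moment n m * h ^+ n.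
    rewrite /F !horner_comp !hornerE !(addrC x) !addrK !horner_poly !big_ord_recl /= !mul0r !add0r.
    rewrite -sumrB mulr_sumr; apply: eq_bigr => n _; rewrite /unit_moment /bump /= add1n.
    rewrite !exprMn (exprS h); set u := m ^+ n.+1; set v := (m - 1) ^+ n.+1.
    set k := h ^+ n; field; by rewrite addrC natr1 pnatr_eq0.
  move=> H; set S := \sum_(n < q) _ in H *; set J := (\int[_]_(_ in _) _)%R in H *.
  have {}H : `|J - h * S| <= eps * h by apply: H => z zab; rewrite Fp; exact: phic.
  have -> : h^-1 * J - S = (J - h * S) / h by field; rewrite gt_eqF.
  by rewrite normrM normfV (gtr0_norm h0) ler_pdivrMr.
- have -> : \sum_(n < q) c n * (((m - 1) ^+ n + 4 * (m - 2^-1) ^+ n + m ^+ n) / 6) * h ^+ n =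
   (\sum_(n < q) c n * (x + m * h - h - x) ^+ n +
   4 * (\sum_(n < q) c n * (x + m * h - h / 2 - x) ^+ n) +
    \sum_(n < q) c n * (x + m * h - x) ^+ n) / 6.
    rewrite mulr_sumr -!big_split /= mulr_suml; apply: eq_bigr => n _.
    have -> : x + m * h - h - x = (m - 1) * h by ring.
    have -> : x + m * h - h / 2 - x = (m - 2^-1) * h by ring.
    have -> : x + m * h - x = m * h by ring.
    by rewrite !exprMn; ring.
  have := phic (x + m * h - h) ltac:(nra); have := phic (x + m * h - h / 2) ltac:(nra).
  have := phic (x + m * h) ltac:(nra); rewrite !ler_norml; lra.
set t := (2 * _)^-1 in t0 t1 *.
have -> : \sum_(n < q) c n * (((m - 2^-1 - t) ^+ n + (m - 2^-1 + t) ^+ n) / 2) * h ^+ n =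
 (\sum_(n < q) c n * (x + m * h - h / 2 - t * h - x) ^+ n +
  \sum_(n < q) c n * (x + m * h - h / 2 + t * h - x) ^+ n) / 2.
  rewrite -!big_split /= mulr_suml; apply: eq_bigr => n _.
  have -> : x + m * h - h / 2 - t * h - x = (m - 2^-1 - t) * h by ring.
  have -> : x + m * h - h / 2 + t * h - x = (m - 2^-1 + t) * h by ring.
  by rewrite !exprMn; ring.
have := phic (x + m * h - h / 2 - t * h) ltac:(nra).
have := phic (x + m * h - h / 2 + t * h) ltac:(nra).
by rewrite !ler_norml; lra.
Qed.

End Mean.

(** * Boxes and cylinders *)

Section Accessible.
Context {R : realType} {E : normedModType R}.
Implicit Types (D : set E) (x e : E).

(** It suffices that a half-open segment starting at x stays in D. *)
Lemma segment_proper D x e (s0 : R) : s0 != 0 ->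
  (forall t, 0 < t <= 1 -> D (x + (t * s0) *: e)) -> ProperFilter (incr D x e).
Proof.
move=> s0n Ds; split; last exact: within_filter.
rewrite /incr /within /= => /nbhs_ballP[d /= d0 H].
have a0 : 0 < `|s0| by rewrite normr_gt0.
pose t := Num.min 1 (d / 2 / `|s0|).
have t0 : 0 < t by rewrite lt_min ltr01 !divr_gt0.
have t1 : 0 < t <= 1 by rewrite t0 ge_min lexx.
have td : t * `|s0| < d.
  apply: (@le_lt_trans _ _ (d / 2)); last lra.
  by rewrite -ler_pdivlMr// ge_min lexx orbT.
apply: (H (t * s0)).
- by rewrite -ball_normE /= sub0r normrN normrM gtr0_norm.
- by rewrite mulf_neq0// gt_eqF.
- exact: Ds.
Qed.

(** Derivatives in a direction that stays in the smaller set can be computed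
    in either set.  This identifies derivatives along a facet with those in the
    cylinder. *)
Lemma dwithin_restrict (D D' : set E) e (w v : E -> R) x :
  (forall s : R, D (x + s *: e) <-> D' (x + s *: e)) ->
  (forall y, D y -> w y = v y) -> D x ->
  dwithin D e w x = dwithin D' e v x.
Proof.
move=> DD' wv Dx; rewrite (dwithin_ext e wv Dx) /dwithin /incr.
suff -> : [set s : R | D (x + s *: e)] = [set s | D' (x + s *: e)] by [].
by apply/seteqP; split => s /= /DD'.
Qed.

Lemma iter_dwithin_ext D e j (w v : E -> R) x : (forall y, D y -> w y = v y) -> D x ->
  iter_dwithin D e j w x = iter_dwithin D e j v x.
Proof.
by elim: j w v => [|j IH] w v wv Dx; [exact: wv|];
  rewrite !iter_dwithinSr; apply: IH => // y; exact: dwithin_ext.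
Qed.

Lemma iter_dwithinS D e j (w : E -> R) : iter_dwithin D e j.+1 w = dwithin D e (iter_dwithin D e j w).
Proof. by []. Qed.

Lemma Ck_iter_dwithin (D dirs : set E) e K j (w : E -> R) : Ck_on dirs D (j + K) w ->
  dirs e -> Ck_on dirs D K (iter_dwithin D e j w).
Proof.
move=> + de; elim: j w => [//|j IH] w; rewrite addSn iter_dwithinSr => Cw.
by apply: IH; exact: Ck_dw.
Qed.

Lemma iter_dwithin_mul (D dirs : set E) e K j (w v : E -> R) x : accessible dirs D ->
  Ck_on dirs D (j + K) w -> Ck_on dirs D (j + K) v -> dirs e -> D x ->
  iter_dwithin D e j (fun y => w y * v y) x =
  leibniz (fun i => iter_dwithin D e i w x) (fun i => iter_dwithin D e i v x) j.
Proof.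
move=> acc + + de Dx; elim: j w v => [//|j IH] w v Cw Cv.
rewrite iter_dwithinSr (@iter_dwithin_ext _ _ _ _
  (fun y => dwithin D e w y * v y + w y * dwithin D e v y) x)//; last first.
  by move=> y Dy; apply: (dwithin_mul acc Cw Cv).
have C1 : Ck_on dirs D (j + K) (dwithin D e w) by exact: Ck_dw Cw _.
have C2 : Ck_on dirs D (j + K) (dwithin D e v) by exact: Ck_dw Cv _.
have Cw' := CkW acc Cw; have Cv' := CkW acc Cv.
rewrite /= -/(leibniz _ _ j).
have addn : forall i (f g : E -> R), Ck_on dirs D (i + K) f -> Ck_on dirs D (i + K) g ->
    iter_dwithin D e i (fun y => f y + g y) x = iter_dwithin D e i f x + iter_dwithin D e i g x.
  elim=> [//|i IHi] f g Cf Cg; rewrite iter_dwithinSr (@iter_dwithin_ext _ _ _ _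
    (fun y => dwithin D e f y + dwithin D e g y) x)//; last first.
    by move=> y Dy; exact: (dwithin_add acc Cf Cg).
  by rewrite !iter_dwithinSr IHi//; exact: Ck_dw.
rewrite addn; try exact: CkM.
rewrite !IH//; congr (leibniz _ _ j + leibniz _ _ j); apply/funext => i;
  by rewrite -iter_dwithinS iter_dwithinSr.
Qed.

End Accessible.

Section Box.
Context {R : realType} {n : nat}.
Implicit Types (lo hi : 'I_n -> R) (x : 'rV[R]_n).

Definition box lo hi : set 'rV[R]_n := [set x | forall l, lo l <= x 0 l <= hi l].

Lemma shift_coord x s k l : (x + s *: ek k) 0 l = x 0 l + (if l == k then s else 0).
Proof. by rewrite !mxE eqxx /=; case: (l == k); rewrite ?mulr1 ?mulr0. Qed.

Lemma compact_box lo hi : compact (box lo hi).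
Proof.
have := @rV_compact R n (fun i => [set` `[lo i, hi i]]) (fun i => @segment_compact _ _ _).
congr compact; apply/seteqP; split=> x /= H l; by have := H l; rewrite ?in_itv.
Qed.

Lemma box_segment lo hi x k : (forall l, lo l < hi l) -> box lo hi x ->
  exists2 s0 : R, s0 != 0 & forall t, 0 < t <= 1 -> box lo hi (x + (t * s0) *: ek k).
Proof.
move=> lohi Bx; have := lohi k; have := Bx k; move=> xk lk.
have [xm|xm] := leP (x 0 k) ((lo k + hi k) / 2).
- exists ((hi k - lo k) / 2); first by rewrite gt_eqF; lra.
  move=> t t01 l; rewrite shift_coord; case: eqP => [->|_]; last by rewrite addr0; exact: Bx.
  nra.
- exists (- (hi k - lo k) / 2); first by rewrite lt_eqF; lra.
  move=> t t01 l; rewrite shift_coord; case: eqP => [->|_]; last by rewrite addr0; exact: Bx.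
  nra.
Qed.

Lemma accessible_box lo hi (dirs : set 'rV[R]_n) : (forall l, lo l < hi l) ->
  dirs `<=` range ek -> accessible dirs (box lo hi).
Proof.
move=> lohi de e x /de[k _ <-] Bx; have [s0 s0n] := box_segment k lohi Bx.
exact: segment_proper.
Qed.

Lemma cOmega_extE X k : cOmega_ext X k =
  box (fun l => if l == k then - X l else 0) (fun l => if l == k then 2 * X l else X l).
Proof.
apply/seteqP; split => x /= H l; have := H l; case: (l == k) => //.
Qed.

Section Cylinder.
Variables (X : 'I_n -> R) (T : R).
Hypotheses (X0 : forall l, 0 < X l) (T0 : 0 < T).

Definition Qbar : set ('rV[R]_n * R) := cyl (cOmega X) T.
Definition dirsQ : set ('rV[R]_n * R) := range ekT `|` [set eT].

Lemma dirsQx k : dirsQ (ekT k). Proof. by left; exists k. Qed.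
Lemma dirsQt : dirsQ eT. Proof. by right. Qed.

Lemma Q_ekT x t s k : Qbar ((x, t) + s *: ekT k) <-> cOmega X (x + s *: ek k) /\ 0 <= t <= T.
Proof. by rewrite /Qbar /cyl /= /GRing.scale /= mulr0 addr0. Qed.

Lemma Q_eT x t s : Qbar ((x, t) + s *: eT) <-> cOmega X x /\ 0 <= t + s <= T.
Proof. by rewrite /Qbar /cyl /= scaler0 addr0 /GRing.scale /= mulr1. Qed.

Lemma accessible_Q : accessible dirsQ Qbar.
Proof.
move=> e [x t] [[k _ <-]|->] [/= Bx t0T].
  have [s0 s0n H] := @box_segment (fun=> 0) X x k X0 Bx.
  by apply: (segment_proper s0n) => r r01; apply/Q_ekT; split=> //; exact: H.
have [tm|tm] := leP t (T / 2).
- apply: (@segment_proper _ _ _ _ _ (T / 2)); first by rewrite gt_eqF// divr_gt0.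
  move=> r r01; apply/Q_eT; split=> //.
  have := mulr_ge0 (ltW T0) (_ : 0 <= 1 - r); nra.
- apply: (@segment_proper _ _ _ _ _ (- (T / 2))); first by rewrite oppr_eq0 gt_eqF// divr_gt0.
  by move=> r r01; apply/Q_eT; split=> //; nra.
Qed.

Lemma compact_Q : compact Qbar.
Proof.
have := compact_setX (@compact_box (fun=> 0) X) (@segment_compact R 0 T).
congr compact; apply/seteqP; split=> -[x t] /= [Bx]; by rewrite in_itv.
Qed.

(** Each point of the closed cylinder is joined to its centre; the half-open
    segment lies in the interior. *)
Lemma zero_on_Q (w : 'rV[R]_n * R -> R) : {within Qbar, continuous w} ->
  (forall x t, Omega X x -> 0 < t < T -> w (x, t) = 0) ->
  forall q, Qbar q -> w q = 0.
Proof.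
move=> cw w0 [x t] [/= Bx t0T].
pose c : 'rV[R]_n * R := (\row_l (X l / 2), T / 2).
have E s : (x, t) + s *: (c - (x, t)) =
    (x + s *: (\row_l (X l / 2) - x), t + s * (T / 2 - t)) by [].
apply: (zero_closure (e := c - (x, t)) cw) => s s01; rewrite E.
  split => /=; last by have := T0; nra.
  move=> l; rewrite !mxE; have := Bx l; have := X0 l; nra.
apply: w0; last by have := T0; nra.
move=> l; rewrite !mxE; have := Bx l; have := X0 l; nra.
Qed.

(** At interior points there is room for a square; then both sides extend by
    continuity. *)
Lemma schwarz_Q w k : Ck_on dirsQ Qbar 2 w -> forall q, Qbar q ->
  dt Qbar (dx Qbar k w) q = dx Qbar k (dt Qbar w) q.
Proof.
move=> Cw q Qq; apply/eqP; rewrite -subr_eq0; apply/eqP.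
apply: (zero_on_Q (w := fun q => dt Qbar (dx Qbar k w) q - dx Qbar k (dt Qbar w) q)) Qq.
  apply: (@Ck_cts _ _ _ dirsQ 0); apply: (CkB accessible_Q).
    by apply: Ck_dw dirsQt; apply: Ck_dw (dirsQx k).
  by apply: Ck_dw (dirsQx k); apply: Ck_dw dirsQt.
move=> x t Ox tT; apply/eqP; rewrite subr_eq0; apply/eqP.
have xk := Ox k.
(* half the side of a square around (x, t) in the plane of e_k and the time axis *)
pose r := Num.min (Num.min (x 0 k) (X k - x 0 k)) (Num.min t (T - t)).
have r0 : 0 < r by rewrite !lt_min; lra.
have rx : r <= x 0 k by rewrite !ge_min lexx.
have rX : r <= X k - x 0 k by rewrite !ge_min lexx orbT.
have rt : r <= t by rewrite !ge_min lexx !orbT.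
have rT : r <= T - t by rewrite !ge_min lexx !orbT.
apply: (schwarz_interior Cw dirsQt (dirsQx k) r0) => s s' sr s'r.
have -> : (x, t) + s *: eT + s' *: ekT k = (x + s' *: ek k, t + s).
  by rewrite /eT /ekT; congr (_, _); rewrite /= ?scaler0 ?addr0 /GRing.scale /= ?mulr1 ?mulr0 ?addr0.
move: sr s'r; rewrite !ler_norml => sr s'r.
split; last by rewrite /=; lra.
move=> l; rewrite /= shift_coord; case: eqP => [->|_]; first lra.
rewrite addr0; have := Ox l; lra.
Qed.

Lemma lift_is_dwithin w x t k l : Qbar (x, t) -> is_dwithin (cOmega X) (ek k) w x l ->
  is_dwithin Qbar (ekT k) (fun q => w q.1) (x, t) l.
Proof.
move=> Qxt wl A /wl.
apply: (@filterS _ (nbhs (0 : R)) _ (fun s => s != 0 ->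
  cOmega X (x + s *: ek k) -> A (dquot w x (ek k) s))) => s H s0 /Q_ekT[Bx _].
exact: H s0 Bx.
Qed.

Lemma lift_time_is_dwithin (w : 'rV[R]_n -> R) q : is_dwithin Qbar eT (fun q => w q.1) q 0.
Proof.
case: q => x t; rewrite /is_dwithin (_ : dquot _ _ _ = (fun=> 0)); first exact: cvg_cst.
by apply/funext => s; rewrite /dquot /= scaler0 addr0 subrr mulr0.
Qed.

Lemma dwithin_lift w x t k K : Qbar (x, t) -> smooth_space X K.+1 w ->
  dx Qbar k (fun q => w q.1) (x, t) = dwithin (cOmega X) (ek k) w x.
Proof.
move=> Qxt Cw; apply: is_dwithinE; first exact: (accessible_Q (dirsQx k)).
apply: lift_is_dwithin => //; apply: Ck_is_dwithin Cw _ _; first by exists k.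
by case: Qxt.
Qed.

(** Functions of x alone are differentiated as functions on the cylinder, so that
    one calculus serves sigma and u. *)
Lemma Ck_lift K w : smooth_space X K w -> Ck_on dirsQ Qbar K (fun q => w q.1).
Proof.
have cl (v : 'rV[R]_n -> R) : {within cOmega X, continuous v} ->
    {within Qbar, continuous (fun q => v q.1)}.
  move=> cv; apply: (@cts_comp _ _ _ Qbar (cOmega X) fst v) => [q|q []//|//].
  exact: cvg_fst.
elim: K w => [|K IH] w Cw; first by split=> //; apply: cl; exact: Ck_cts Cw.
split; first by apply: cl; exact: Ck_cts Cw.
move=> e [[k _ <-]|->]; split.
- move=> [x t] Qxt; apply: is_dwithin_derivable (lift_is_dwithin Qxt _); apply: Ck_is_dwithin Cw _ _.
    by exists k.
  by case: Qxt.
- apply: (@Ck_ext _ _ Qbar dirsQ K (fun q => dwithin (cOmega X) (ek k) w q.1)).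
    by move=> [x t] Qxt; rewrite -(dwithin_lift k Qxt Cw).
  by apply: IH; apply: Ck_dw Cw _; exists k.
- by move=> q _; apply: is_dwithin_derivable (lift_time_is_dwithin w q).
- apply: (@Ck_ext _ _ Qbar dirsQ K (fun=> 0)); last exact: (Ck_cst accessible_Q).
  move=> q Qq; apply/esym/is_dwithinE; first exact: (accessible_Q dirsQt).
  exact: lift_time_is_dwithin.
Qed.

Lemma dt_lift (w : 'rV[R]_n -> R) q : Qbar q -> dt Qbar (fun q => w q.1) q = 0.
Proof.
by move=> Qq; apply: is_dwithinE; [exact: (accessible_Q dirsQt) | exact: lift_time_is_dwithin].
Qed.

Lemma iter_dwithin_lift w k j K x t : Qbar (x, t) -> smooth_space X (j + K) w ->
  iter_dwithin Qbar (ekT k) j (fun q => w q.1) (x, t) = iter_dwithin (cOmega X) (ek k) j w x.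
Proof.
move=> Qxt; elim: j w => [//|j IH] w Cw.
rewrite !iter_dwithinSr -IH; last by apply: Ck_dw Cw _; exists k.
apply: iter_dwithin_ext Qxt => -[y r] Qyr; exact: dwithin_lift Qyr Cw.
Qed.

End Cylinder.
End Box.

(** * Expansions at the mesh points *)

Section Tail.
Context {R : realType} {I : Type}.
Variables (P : set I) (h : I -> R).
Hypothesis h01 : forall x, P x -> 0 < h x <= 1.

Lemma expansion_tail q F (c : nat -> I -> R) : expansion P h q.+1 F c ->
  expansion P h q (fun x => (F x - c 0%N x) / h x) (fun n => c n.+1).
Proof.
move=> [_ [F1 FE E1]]; apply: expansion_ext E1 => // x Px.
by have /andP[h0 _] := h01 Px; rewrite FE// addrAC subrr add0r mulrC mulKf// gt_eqF.
Qed.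

Context {E : normedModType R}.
Variables (D dirs : set E) (e : E) (y : I -> E).
Hypotheses (cD : compact D) (acc : accessible dirs D) (de : dirs e).
Hypothesis Dy : forall x, P x -> D (y x).

Lemma ubounded_jet n (v : E -> R) : Ck_on dirs D n v -> ubounded P (fun x => iter_dwithin D e n v (y x)).
Proof.
move=> Cv; have [|M _ vM] := @compact_bounded_fun _ _ D (iter_dwithin D e n v) cD.
  by apply: (@Ck_cts _ _ _ dirs 0); apply: Ck_iter_dwithin => //; rewrite addn0.
by exists M => x Px; apply: vM; exact: Dy.
Qed.

Lemma ubounded_jet_le q n (v : E -> R) : (n <= q)%N -> Ck_on dirs D q v ->
  ubounded P (fun x => iter_dwithin D e n v (y x)).
Proof. by move=> nq Cv; apply: ubounded_jet; apply: (Ck_le acc nq). Qed.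

(** Taylor's formula at a moving base point y.  Compactness of D makes the
    coefficients and the remainder uniform. *)
Lemma point_expansion q (v : E -> R) (z rho : R) : Ck_on dirs D q v ->
  (forall x, P x -> forall s, `|s| <= rho * h x -> D (y x + s *: e)) ->
  - rho <= z <= rho ->
  expansion P h q (fun x => v (y x + (z * h x) *: e))
             (fun n x => iter_dwithin D e n v (y x) / (n`!)%:R * z ^+ n).
Proof.
move=> Cv Ds zr; apply: expansion_of_bound => //.
  move=> n nq; apply: uboundedM; last exact: ubounded_cst.
  by apply: uboundedM; [exact: ubounded_jet_le (ltnW nq) Cv | exact: ubounded_cst].
have [|M M0 vM] := @compact_bounded_fun _ _ D (iter_dwithin D e q v) cD.
  by apply: (@Ck_cts _ _ _ dirs 0); apply: Ck_iter_dwithin => //; rewrite addn0.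
exists (M * rho ^+ q) => x Px; have /andP[h0 _] := h01 Px.
have r0 : 0 <= rho by lra.
have Dxs s : - (rho * h x) <= s <= rho * h x -> D (y x + s *: e).
  by move=> H; apply: Ds => //; rewrite ler_norml.
have rh : - (rho * h x) <= 0 <= rho * h x by have := mulr_ge0 r0 (ltW h0); lra.
have zh : - (rho * h x) <= z * h x <= rho * h x by nra.
have := taylor Cv de rh Dxs (fun s H => vM _ (Dxs s H)) zh.
rewrite horner_poly; under eq_bigr do rewrite exprMn mulrA.
move=> /le_trans; apply; rewrite -mulrA ler_wpM2l ?(ltW M0)// -exprMn.
by rewrite lerXn2r ?nnegrE ?mulr_ge0 ?(ltW h0)// ler_norml.
Qed.

End Tail.

Section MeshPoints.
Context {R : realType} {n : nat}.
Implicit Types (X h : 'I_n -> R) (N : 'I_n -> nat) (i : 'rV[int]_n) (k l : 'I_n).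

Lemma node_shift h i k : node h (i + ei k) = node h i + h k *: ek k.
Proof.
apply/rowP => l; rewrite shift_coord !mxE eqxx /=.
case: eqP => [->|_]; last by rewrite !addr0.
by rewrite intrD mulrDl mul1r.
Qed.

Lemma node_shiftN h i k : node h (i - ei k) = node h i - h k *: ek k.
Proof. by rewrite -[in RHS](subrK (ei k) i) node_shift addrK. Qed.

Lemma set_coordE (x : 'rV[R]_n) k (y : R) : set_coord x k y = x + (y - x 0 k) *: ek k.
Proof.
apply/rowP => l; rewrite shift_coord mxE; case: eqP => [->|_]; last by rewrite addr0.
by rewrite addrC subrK.
Qed.

Lemma set_coord_shift (x : 'rV[R]_n) k (s y : R) :
  set_coord (x + s *: ek k) k y = set_coord x k y.
Proof.
by apply/rowP => l; rewrite !mxE; case: eqP => // _; rewrite mulr0 addr0.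
Qed.

Lemma hat_minus_mean mr sigma h k i : hat_minus mr sigma h k i =
  mean_value mr (h k) (fun y => sigma (set_coord (node h i) k y)) (node h i 0 k).
Proof.
have nk : node h i 0 k = (i 0 k)%:~R * h k by rewrite mxE.
case: mr; rewrite /hat_minus /mean_value.
- by rewrite nk intrB mulrBl mul1r.
- rewrite node_shiftN !set_coordE.
  have -> : node h i 0 k - h k - node h i 0 k = - h k by ring.
  have -> : node h i 0 k - h k / 2 - node h i 0 k = - (h k / 2) by ring.
  have -> : node h i 0 k - node h i 0 k = 0 by ring.
  by rewrite scale0r addr0 !scaleNr.
set t := (2 * _)^-1; rewrite !set_coordE.
have -> : node h i 0 k - h k / 2 - t * h k - node h i 0 k = - (h k / 2) - t * h k by ring.
have -> : node h i 0 k - h k / 2 + t * h k - node h i 0 k = - (h k / 2) + t * h k by ring.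
by rewrite scalerBl scalerDl !scaleNr !addrA.
Qed.

(** The mean value over a cell whose right end is z steps away from the base point
    node h i, compared with the Taylor polynomial of sigma at the base point. *)
Lemma hat_approx (mr : mean_rule) (D dirs : set 'rV[R]_n) q sigma h k i j (z rho M : R) :
  0 < h k -> node h j = node h i + (z * h k) *: ek k ->
  Ck_on dirs D q sigma -> dirs (ek k) ->
  (forall s, `|s| <= rho * h k -> D (node h i + s *: ek k)) ->
  - rho <= z - 1 -> z <= rho -> 
  (forall x, D x -> `|iter_dwithin D (ek k) q sigma x| <= M) ->
  `|hat_minus mr sigma h k j - \sum_(l < q) iter_dwithin D (ek k) l sigma (node h i) / (l`!)%:R *
      rule_moment mr l z * h k ^+ l| <= M * (rho * h k) ^+ q.
Proof.
move=> h0 nj Cs de Ds zlo zhi sM.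
rewrite hat_minus_mean nj; under eq_fun do rewrite set_coord_shift set_coordE.
rewrite shift_coord eqxx /=.
set x := node h i 0 k.
have r0 : 0 <= rho by lra.
have Dxs s : - (rho * h k) <= s <= rho * h k -> D (node h i + s *: ek k).
  by move=> H; apply: Ds => //; rewrite ler_norml.
have rh : - (rho * h k) <= 0 <= rho * h k by have := mulr_ge0 r0 (ltW h0); lra.
pose phi y := sigma (node h i + (y - x) *: ek k).
apply: (@mean_approx _ mr (h k) phi x z
  (fun r => iter_dwithin D (ek k) r sigma (node h i) / (r`!)%:R)) => //.
  apply: (@cts_comp _ _ _ [set` `[x + (z - 1) * h k, x + z * h k]] D
      (fun y => node h i + (y - x) *: ek k) sigma).
  - move=> y; apply: cvgD; first exact: cvg_cst.
    by apply: cvgZl; apply: cvgB; [exact: cvg_id | exact: cvg_cst].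
  - by move=> y /=; rewrite in_itv /= => H; apply: Dxs; nra.
  - exact: Ck_cts Cs.
move=> y H; have ys : - (rho * h k) <= y - x <= rho * h k by nra.
have := taylor Cs de rh Dxs (fun s H => sM _ (Dxs s H)) ys.
rewrite horner_poly => /le_trans; apply.
have M0 : 0 <= M by apply: le_trans (sM _ (Dxs _ ys)).
by rewrite ler_wpM2l// lerXn2r ?nnegrE ?mulr_ge0 ?(ltW h0)// ler_norml.
Qed.

Section Steps.
Variables (X : 'I_n -> R) (T : R).
Hypotheses (X0 : forall l, 0 < X l) (T0 : 0 < T).

Lemma step_gt0 N l : (2 <= N l)%N -> 0 < step X N l.
Proof. by move=> N2; rewrite divr_gt0// ltr0n (leq_trans _ N2). Qed.

Lemma step_le_half N l : (2 <= N l)%N -> 2 * step X N l <= X l.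
Proof.
move=> N2; rewrite /step mulrA ler_pdivrMr ?ltr0n ?(leq_trans _ N2)//.
by rewrite mulrC ler_wpM2l ?(ltW (X0 l))// ler_nat.
Qed.

Lemma node_coord N i l : (2 <= N l)%N ->
  node (step X N) i 0 l = (i 0 l)%:~R * step X N l /\ (N l)%:R * step X N l = X l.
Proof.
move=> N2; split; first by rewrite mxE.
by rewrite /step mulrC divfK// pnatr_eq0 -lt0n (leq_trans _ N2).
Qed.

Lemma mesh_coord N i l : (2 <= N l)%N -> mesh N i ->
  step X N l <= node (step X N) i 0 l <= X l - step X N l.
Proof.
move=> N2 /(_ l) /andP[i1 i2]; have [-> <-] := node_coord i N2.
have h0 := step_gt0 N2.
have : (1 : int)%:~R <= (i 0 l)%:~R :> R by rewrite ler_int.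
have : (i 0 l)%:~R <= ((N l)%:Z - 1)%:~R :> R by rewrite ler_int.
by rewrite intrB /=; move: (i 0 l)%:~R => y; rewrite -pmulrn; nra.
Qed.

Lemma cmesh_cOmega N i : (forall l, (2 <= N l)%N) -> cmesh N i ->
  cOmega X (node (step X N) i).
Proof.
move=> N2 ci l; have /andP[i1 i2] := ci l; have [-> <-] := node_coord i (N2 l).
have h0 := step_gt0 (N2 l).
have : (0 : int)%:~R <= (i 0 l)%:~R :> R by rewrite ler_int.
have : (i 0 l)%:~R <= ((N l)%:Z)%:~R :> R by rewrite ler_int.
by move: (i 0 l)%:~R => y; rewrite -pmulrn; nra.
Qed.

Lemma mesh_segment N i k (s : R) : (forall l, (2 <= N l)%N) -> mesh N i ->
  `|s| <= step X N k -> cOmega X (node (step X N) i + s *: ek k).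
Proof.
move=> N2 mi sh l; rewrite shift_coord; have := mesh_coord (N2 l) mi.
have := step_gt0 (N2 l); move: sh; rewrite ler_norml.
by case: eqP => [->|_]; lra.
Qed.

Lemma mesh_segment_ext N i k (s : R) : (forall l, (2 <= N l)%N) -> mesh N i ->
  `|s| <= 2 * step X N k -> cOmega_ext X k (node (step X N) i + s *: ek k).
Proof.
move=> N2 mi sh l; rewrite shift_coord; have := mesh_coord (N2 l) mi.
have := step_gt0 (N2 l); have := step_le_half (N2 l); move: sh; rewrite ler_norml.
by case: eqP => [->|_]; lra.
Qed.

(** Mesh sizes, a multi-index and a time.  The time is a real number, so that the
    space discretization can be studied without a time mesh. *)
Definition mesh_point : Type := (('I_n -> nat) * 'rV[int]_n * R)%type.

Definition mp_step k (a : mesh_point) : R := step X a.1.1 k.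
Definition mp_node (a : mesh_point) : 'rV[R]_n := node (step X a.1.1) a.1.2.

Definition admissible k (d : R) : set mesh_point := [set a |
  [/\ forall l, (2 <= a.1.1 l)%N, mesh a.1.1 a.1.2, 0 <= a.2 <= T &
      step X a.1.1 k <= d]].

Lemma admissible_step k d : d <= 1 -> forall a, admissible k d a -> 0 < mp_step k a <= 1.
Proof. by move=> d1 a [N2 _ _ hd]; rewrite /mp_step step_gt0//= (le_trans hd). Qed.

Lemma admissible_Q k d a : admissible k d a -> Qbar X T (mp_node a, a.2).
Proof.
move=> [N2 mi t0 _]; split=> //= l; have := mesh_coord (N2 l) mi.
by have := step_gt0 (N2 l); rewrite /mp_node; lra.
Qed.

End Steps.
End MeshPoints.

(** * Consistency of the second difference *)

Section Consistency.
Context {R : realType} {n : nat}.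
Variables (X : 'I_n -> R) (T : R).
Hypotheses (X0 : forall l, 0 < X l) (T0 : 0 < T).
Implicit Types (k : 'I_n) (sigma : 'rV[R]_n -> R) (a : @mesh_point R n).

Notation QT := (Qbar X T).
Notation hstep := (mp_step X).
Notation xnode := (mp_node X).
Notation steps a := (step X a.1.1).

Lemma shift_ekT (x : 'rV[R]_n) (t s : R) k :
  (x, t) + s *: ekT k = (x + s *: ek k, t).
Proof. by rewrite /ekT; congr (_, _); rewrite /= /GRing.scale /= mulr0 addr0. Qed.

Lemma positive_lower_bound {E : normedModType R} (D : set E) (w : E -> R) :
  compact D -> {within D, continuous w} -> (forall x, D x -> 0 < w x) ->
  exists2 m, 0 < m & forall x, D x -> m <= w x.
Proof.
move=> cD cw w0.
have acc0 : accessible set0 D by move=> e x [].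
have w_neq0 x : D x -> w x != 0 by move=> /w0 wx; rewrite gt_eqF.
have [|M M0 wM] := @compact_bounded_fun _ _ D (fun x => (w x)^-1) cD.
  by apply: (@Ck_cts _ _ _ set0 0); apply: CkV => //; split.
exists M^-1; first by rewrite invr_gt0.
move=> x Dx; have wx := w0 x Dx; have := wM x Dx.
by rewrite ger0_norm ?invr_ge0 ?(ltW wx)// -[leRHS]invrK lef_pV2 ?posrE ?invr_gt0.
Qed.

(** Within rho h of the base point, sigma varies by at most M rho h.  This is how
    positivity is carried over to the cells that lie outside the domain. *)
Lemma hat_lower (mr : mean_rule) (D dirs : set 'rV[R]_n) sigma k (rho m : R) :
  compact D -> Ck_on dirs D 1 sigma -> dirs (ek k) -> 0 < m -> 0 < rho ->
  exists d, [/\ 0 < d, d <= 1 & forall (h : 'I_n -> R) i j (z : R),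
    0 < h k <= d -> node h j = node h i + (z * h k) *: ek k ->
    (forall s, `|s| <= rho * h k -> D (node h i + s *: ek k)) ->
    - rho <= z - 1 -> z <= rho -> 2 * m <= sigma (node h i) ->
    m <= hat_minus mr sigma h k j].
Proof.
move=> cD Cs de m0 r0.
have [|M M0 sM] := @compact_bounded_fun _ _ D (iter_dwithin D (ek k) 1 sigma) cD.
  by apply: (@Ck_cts _ _ _ dirs 0); apply: Ck_dw Cs _.
exists (Num.min 1 (m / (M * rho))); split.
- by rewrite lt_min ltr01 divr_gt0// mulr_gt0.
- by rewrite ge_min lexx.
move=> h i j z; rewrite le_min => /andP[h0 /andP[h1 hm]] nj Ds z1 z2 ms.
have := hat_approx mr h0 nj Cs de Ds z1 z2 sM.
rewrite big_ord_recl big_ord0 rule_moment_lt4// /unit_moment /= factRE expr0 expr1.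
rewrite ler_pdivlMr ?mulr_gt0// in hm.
have -> : sigma (node h i) / 1 * ((z ^+ 1 - (z - 1) ^+ 1) / 1) * 1 + 0 = sigma (node h i).
  by rewrite !expr1; field.
rewrite ler_norml; nra.
Qed.

Lemma hat_expansion (mr : mean_rule) (D dirs : set 'rV[R]_n) sigma k d q (rho z : R)
    (jj : mesh_point -> 'rV[int]_n) :
  d <= 1 -> compact D -> accessible dirs D -> Ck_on dirs D q sigma -> dirs (ek k) ->
  (forall a, admissible X T k d a -> D (xnode a) /\
     forall s, `|s| <= rho * hstep k a -> D (xnode a + s *: ek k)) ->
  - rho <= z - 1 -> z <= rho ->
  (forall a, admissible X T k d a -> node (steps a) (jj a) = xnode a + (z * hstep k a) *: ek k) ->
  expansion (admissible X T k d) (hstep k) q (fun a => hat_minus mr sigma (steps a) k (jj a))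
    (fun r a => iter_dwithin D (ek k) r sigma (xnode a) / (r`!)%:R * rule_moment mr r z).
Proof.
move=> d1 cD acc Cs de Ds z1 z2 nj.
apply: (expansion_of_bound (admissible_step X0 d1)).
  move=> r rq; apply: uboundedM; last exact: ubounded_cst.
  apply: uboundedM; last exact: ubounded_cst.
  by apply: (ubounded_jet_le cD acc de _ (ltnW rq) Cs) => a /Ds[].
have [|M M0 sM] := @compact_bounded_fun _ _ D (iter_dwithin D (ek k) q sigma) cD.
  by apply: (@Ck_cts _ _ _ dirs 0); apply: Ck_iter_dwithin => //; rewrite addn0.
exists (M * rho ^+ q) => a Pa; have /andP[h0 _] := admissible_step X0 d1 Pa.
rewrite -mulrA -exprMn.
exact: (hat_approx mr h0 (nj a Pa) Cs de (Ds a Pa).2 z1 z2 sM).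
Qed.

Section SecondDifference.
Variables (mr : mean_rule) (sigma : 'rV[R]_n -> R) (k : 'I_n).
Hypothesis sigma_gt0 : forall x, cOmega X x -> 0 < sigma x.

Definition spatial (v : 'rV[R]_n -> R) : 'rV[R]_n * R -> R := fun q => v q.1.

(** This is p = (1/sigma) dw/dx_k; by definition L_k w is its derivative. *)
Definition flux (w : 'rV[R]_n * R -> R) : 'rV[R]_n * R -> R :=
  fun q => (sigma q.1)^-1 * dx QT k w q.

Lemma sigma_neq0 q : QT q -> sigma q.1 != 0.
Proof. by move=> [Ox _]; rewrite gt_eqF// sigma_gt0. Qed.

Lemma Ck_flux K w : smooth_space X K sigma -> Ck_on dirsQ QT K.+1 w ->
  Ck_on dirsQ QT K (flux w).
Proof.
move=> Cs Cw; apply: (CkM (accessible_Q X0 T0)); last exact: Ck_dw (dirsQx k).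
by apply: (CkV (accessible_Q X0 T0) sigma_neq0); exact: (Ck_lift X0 T0).
Qed.

Lemma Ck_Lk K w : smooth_space X K.+1 sigma -> Ck_on dirsQ QT K.+2 w ->
  Ck_on dirsQ QT K (Lk QT sigma k w).
Proof. by move=> Cs Cw; apply: Ck_dw (dirsQx k); exact: Ck_flux. Qed.

Definition sig_jet r a : R := iter_dwithin QT (ekT k) r (spatial sigma) (xnode a, a.2).
Definition flux_jet w r a : R := iter_dwithin QT (ekT k) r (flux w) (xnode a, a.2).

Lemma dx_flux w q : QT q -> dx QT k w q = spatial sigma q * flux w q.
Proof. by move=> Qq; rewrite /flux /spatial mulVKf// sigma_neq0. Qed.

Lemma jet_flux d w r a : smooth_space X r sigma -> Ck_on dirsQ QT r.+1 w ->
  admissible X T k d a -> iter_dwithin QT (ekT k) r.+1 w (xnode a, a.2) =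
  leibniz (sig_jet^~ a) (flux_jet w ^~ a) r.
Proof.
move=> Cs Cw fa; rewrite iter_dwithinSr (iter_dwithin_ext _ _ (@dx_flux w)); last exact: admissible_Q fa.
apply: (@iter_dwithin_mul _ _ _ dirsQ _ 0); rewrite ?addn0.
- exact: accessible_Q.
- exact: (Ck_lift X0 T0).
- exact: Ck_flux.
- exact: dirsQx.
- exact: admissible_Q fa.
Qed.

(** On the closed cylinder (1/sigma) d/dx_k (sigma p') = sigma' p' / sigma + p'',
    which is differentiated once more. *)
Lemma Lk_sigma_Lk w d a : smooth_space X 3 sigma -> Ck_on dirsQ QT 4 w ->
  admissible X T k d a ->
  Lk QT sigma k (fun q => sigma q.1 * Lk QT sigma k w q) (xnode a, a.2) =
  flux2 sig_jet (flux_jet w) a.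
Proof.
move=> Cs Cw fa; have Qa := admissible_Q X0 fa.
have acc := accessible_Q X0 T0; have dk := @dirsQx R n k.
have Cl : Ck_on dirsQ QT 3 (spatial sigma) by exact: (Ck_lift X0 T0).
have Cf : Ck_on dirsQ QT 3 (flux w) by exact: Ck_flux.
pose s1 := dx QT k (spatial sigma); pose p1 := dx QT k (flux w); pose p2 := dx QT k p1.
have Cs1 : Ck_on dirsQ QT 2 s1 by exact: Ck_dw.
have Cp1 : Ck_on dirsQ QT 2 p1 by exact: Ck_dw.
have Cp2 : Ck_on dirsQ QT 1 p2 by exact: Ck_dw.
have E q : QT q -> (sigma q.1)^-1 * dx QT k (fun q => sigma q.1 * Lk QT sigma k w q) q =
    (spatial sigma q)^-1 * (s1 q * p1 q) + p2 q.
  move=> Qq; rewrite /dx (dwithin_mul acc (CkW acc Cl) Cp1 dk Qq) mulrDr mulKf//.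
  exact: sigma_neq0.
rewrite /Lk /dx (dwithin_ext _ E Qa).
apply: (is_dwithinE (acc _ _ dk Qa)).
have -> : flux2 sig_jet (flux_jet w) a = (- (s1 (xnode a, a.2) * (spatial sigma (xnode a, a.2))^-1 *
     (spatial sigma (xnode a, a.2))^-1)) * (s1 (xnode a, a.2) * p1 (xnode a, a.2)) +
   (spatial sigma (xnode a, a.2))^-1 * (dx QT k s1 (xnode a, a.2) * p1 (xnode a, a.2) +
     s1 (xnode a, a.2) * p2 (xnode a, a.2)) + dx QT k p2 (xnode a, a.2).
  rewrite /flux2 /sig_jet /flux_jet /iter_dwithin /= -!/(dx QT k _) -/s1 -/p1 -/p2.
  by field; exact: (sigma_neq0 Qa).
apply: is_dwithinD; last exact: (Ck_is_dwithin Cp2 dk Qa).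
apply: is_dwithinM; last first.
  by apply: is_dwithinM; [exact: (Ck_is_dwithin Cs1 dk Qa) | exact: (Ck_is_dwithin Cp1 dk Qa)].
exact: (is_dwithinV (w := spatial sigma) sigma_neq0 Qa (Ck_is_dwithin Cl dk Qa)).
Qed.

Lemma Lambda_difference (w : mesh_point -> 'rV[int]_n -> R) a :
  Lambda_k mr sigma (steps a) k (w a) a.1.2 =
  (hstep k a)^-1 *
   ((w a (a.1.2 + ei k) - w a a.1.2) / hstep k a / hat_plus mr sigma (steps a) k a.1.2 -
    (w a a.1.2 - w a (a.1.2 - ei k)) / hstep k a / hat_minus mr sigma (steps a) k a.1.2).
Proof.
rewrite /Lambda_k -/(hstep k a); congr (_ * (_ - _)).
  by rewrite -[RHS]mulrA -invfM [X in _ / X]mulrC.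
by rewrite -[RHS]mulrA -invfM [X in _ / X]mulrC.
Qed.

(** The expansion on which the whole proof rests.  The step must be small only for
    the mean values of sigma to be bounded below. *)
Lemma Lambda_expansion : smooth_space X 5 sigma ->
  exists d, [/\ 0 < d, d <= 1 & forall w, Ck_on dirsQ QT 6 w ->
    (exists C, forall a, admissible X T k d a ->
      `|Lambda_k mr sigma (steps a) k (fun j => w (node (steps a) j, a.2)) a.1.2
        - (Lk QT sigma k w (xnode a, a.2) + hstep k a ^+ 2 / 12 *
           Lk QT sigma k (fun q => sigma q.1 * Lk QT sigma k w q) (xnode a, a.2))|
      <= C * hstep k a ^+ 4) /\
    (exists C, forall a, admissible X T k d a ->
      `|Lambda_k mr sigma (steps a) k (fun j => w (node (steps a) j, a.2)) a.1.2
        - Lk QT sigma k w (xnode a, a.2)| <= C * hstep k a ^+ 2)].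
Proof.
move=> Cs.
have cO : compact (cOmega X) := @compact_box _ _ (fun=> 0) X.
have accO : accessible (range ek) (cOmega X) by exact: (@accessible_box _ _ (fun=> 0)).
have accQ := accessible_Q X0 T0.
have cQ : compact QT := @compact_Q R n X T.
have ekr : range (@ek R n) (ek k) by exists k.
have dk := @dirsQx R n k.
have [m m0 sm] := positive_lower_bound cO (Ck_cts Cs) sigma_gt0.
have m20 : 0 < m / 2 by lra.
have [d [d0 d1 hatm]] := hat_lower mr cO (Ck_le accO (isT : (1 <= 5)%N) Cs) ekr m20 ltr01.
exists d; split=> // w Cw.
have h01 := admissible_step X0 d1 (T := T) (k := k).
have seg a : admissible X T k d a -> cOmega X (xnode a) /\
    forall s, `|s| <= 1 * hstep k a -> cOmega X (xnode a + s *: ek k).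
  move=> fa; split; first by case: (admissible_Q X0 fa).
  by case: fa => N2 mi _ _ s; rewrite mul1r; exact: mesh_segment.
have segQ a : admissible X T k d a -> forall s, `|s| <= 1 * hstep k a ->
    QT ((xnode a, a.2) + s *: ekT k).
  by move=> fa s sh; apply/Q_ekT; split; [exact: (seg a fa).2 | case: fa].
have sj r a : (r <= 5)%N -> admissible X T k d a ->
    sig_jet r a = iter_dwithin (cOmega X) (ek k) r sigma (xnode a).
  move=> r5 fa; apply: (@iter_dwithin_lift _ _ _ _ X0 T0 _ _ _ 0); first exact: admissible_Q fa.
  by rewrite addn0; exact: Ck_le r5 Cs.
have nm a : admissible X T k d a -> node (steps a) a.1.2 = xnode a + (0 * hstep k a) *: ek k.
  by move=> _; rewrite mul0r scale0r addr0.
have np a : admissible X T k d a -> node (steps a) (a.1.2 + ei k) = xnode a + (1 * hstep k a) *: ek k.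
  by move=> _; rewrite mul1r node_shift.
have s0m a : admissible X T k d a -> m / 2 <= sig_jet 0 a.
  by move=> fa; apply: le_trans (sm _ (seg a fa).1); lra.
have am a : admissible X T k d a -> m / 2 <= hat_minus mr sigma (steps a) k a.1.2.
  move=> fa; apply: (hatm _ a.1.2 _ 0) => //.
  - by have [_ _ _ hd] := fa; have /andP[-> _] := h01 a fa.
  - exact: nm.
  - exact: (seg a fa).2.
  - lra.
  - by have := sm _ (seg a fa).1; rewrite -/(xnode a); lra.
have bm a : admissible X T k d a -> m / 2 <= hat_plus mr sigma (steps a) k a.1.2.
  move=> fa; apply: (hatm _ a.1.2 _ 1) => //.
  - by have [_ _ _ hd] := fa; have /andP[-> _] := h01 a fa.
  - exact: np.
  - exact: (seg a fa).2.
  - lra.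
  - by have := sm _ (seg a fa).1; rewrite -/(xnode a); lra.
have Qx a : admissible X T k d a -> QT (xnode a, a.2) by exact: admissible_Q.
have bs r : (r < 5)%N -> ubounded (admissible X T k d) (sig_jet r).
  by move=> r5; exact: (ubounded_jet_le cQ accQ dk Qx (ltnW r5) (Ck_lift X0 T0 Cs)).
have Cf : Ck_on dirsQ QT 5 (flux w) by exact: Ck_flux.
have bp r : (r < 5)%N -> ubounded (admissible X T k d) (flux_jet w r).
  by move=> r5; exact: (ubounded_jet_le cQ accQ dk Qx (ltnW r5) Cf).
(* the fourth moment of the rule on [0, 1], divided by 4! *)
pose kappa : R := rule_moment mr 4 1 / 24.
have Ea : expansion (admissible X T k d) (hstep k) 5
    (fun a => hat_minus mr sigma (steps a) k a.1.2) (hat_coef sig_jet kappa (-1)).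
  have := hat_expansion mr (jj := fun a => a.1.2) d1 cO accO Cs ekr seg
    (_ : - 1 <= 0 - 1) (_ : 0 <= 1) nm.
  move=> /(_ ltac:(lra) ltac:(lra)); apply: expansion_ext => // r a r5 fa.
  rewrite -(sj _ _ (ltnW r5) fa).
  have [r4|] := ltnP r 4; last first.
    rewrite leq_eqVlt ltnNge -ltnS r5 orbF => /eqP <-.
    by rewrite rule_moment4_sym /hat_coef /kappa /= factRE; field.
  rewrite rule_moment_lt4// /unit_moment /hat_coef.
  by case: r r4 {r5} => [|[|[|[|//]]]] _; rewrite /= ?factRE; field.
have Eb : expansion (admissible X T k d) (hstep k) 5
    (fun a => hat_plus mr sigma (steps a) k a.1.2) (hat_coef sig_jet kappa 1).
  have := hat_expansion mr (jj := fun a => a.1.2 + ei k) d1 cO accO Cs ekr seg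
    (_ : - 1 <= 1 - 1) (_ : 1 <= 1) np.
  move=> /(_ ltac:(lra) ltac:(lra)); apply: expansion_ext => // r a r5 fa.
  rewrite -(sj _ _ (ltnW r5) fa).
  have [r4|] := ltnP r 4; last first.
    rewrite leq_eqVlt ltnNge -ltnS r5 orbF => /eqP <-.
    by rewrite /hat_coef /kappa /= factRE; field.
  rewrite rule_moment_lt4// /unit_moment /hat_coef.
  by case: r r4 {r5} => [|[|[|[|//]]]] _; rewrite /= ?factRE; field.
have jf r a : (r < 5)%N -> admissible X T k d a -> iter_dwithin QT (ekT k) r.+1 w (xnode a, a.2) =
  leibniz (sig_jet^~ a) (flux_jet w ^~ a) r.
  move=> r5 fa; apply: jet_flux fa; first exact: (Ck_le accO (ltnW r5) Cs).
  exact: (Ck_le accQ (leqW r5) Cw).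
have Edu : expansion (admissible X T k d) (hstep k) 5
    (fun a => (w (node (steps a) (a.1.2 + ei k), a.2) - w (node (steps a) a.1.2, a.2)) / hstep k a)
    (fun r a => leibniz (sig_jet^~ a) (flux_jet w ^~ a) r / (r.+1`!)%:R).
  have := expansion_tail h01 (point_expansion h01 cQ accQ dk Qx Cw segQ
     (_ : - 1 <= 1 <= 1)).
  move=> /(_ ltac:(lra)); apply: expansion_ext => [a fa|r a r5 fa].
    by rewrite mul1r /iter_dwithin /= factRE expr0 divr1 mulr1 node_shift shift_ekT.
  by rewrite expr1n mulr1 jf.
have Edv : expansion (admissible X T k d) (hstep k) 5
    (fun a => (w (node (steps a) a.1.2, a.2) - w (node (steps a) (a.1.2 - ei k), a.2)) / hstep k a)
    (fun r a => (-1) ^+ r * leibniz (sig_jet^~ a) (flux_jet w ^~ a) r / (r.+1`!)%:R).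
  have := expansion_tail h01 (point_expansion h01 cQ accQ dk Qx Cw segQ
     (_ : - 1 <= -1 <= 1)).
  move=> /(_ ltac:(lra)) /(expansionZ (ubounded_cst (admissible X T k d) (-1))).
  apply: expansion_ext => [a fa|r a r5 fa]; last by rewrite jf// exprS; ring.
  rewrite /iter_dwithin /= factRE expr0 divr1 mulr1 node_shiftN shift_ekT !mulN1r -mulNr opprB.
  by rewrite scaleNr.
have [C4 H4] := flux_difference4 h01 m20 s0m am bm bs bp Ea Eb Edu Edv.
have [C2 H2] := flux_difference2 h01 m20 s0m am bm bs bp Ea Eb Edu Edv.
split.
  exists C4 => a fa; have /andP[h0 _] := h01 a fa.
  rewrite (Lambda_difference (fun a j => w (node (steps a) j, a.2))).
  rewrite (Lk_sigma_Lk _ _ fa); last 2 first.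
  - exact: (Ck_le accO (isT : (3 <= 5)%N) Cs).
  - exact: (Ck_le accQ (isT : (4 <= 6)%N) Cw).
  exact: H4.
exists C2 => a fa; have /andP[h0 _] := h01 a fa.
rewrite (Lambda_difference (fun a j => w (node (steps a) j, a.2))).
exact: H2.
Qed.

End SecondDifference.
End Consistency.

(** * The scheme with harmonic means *)

Section Tilde.
Context {R : realType} {n : nat}.
Variables (X : 'I_n -> R) (T : R).
Hypotheses (X0 : forall l, 0 < X l) (T0 : 0 < T).

Notation QT := (Qbar X T).
Notation hstep := (mp_step X).
Notation xnode := (mp_node X).
Notation steps a := (step X a.1.1).

(** Along the stencil the difference sigma^(k) - sigma is h^2 (r_0 + j h r_1) +
    O(h^4), and so is its product with U, with other r_0 and r_1; then
    [flux_difference_perturbation] applies. *)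
Lemma tilde_perturbation (mr : mean_rule) (sigma : 'rV[R]_n -> R) (k : 'I_n) :
  (forall x, cOmega X x -> 0 < sigma x) -> smooth_space X 0 sigma ->
  smooth_in k (cOmega_ext X k) 4 sigma ->
  exists d, [/\ 0 < d, d <= 1, forall a, admissible X T k d a ->
      sigma_tilde mr sigma (steps a) k a.1.2 != 0 & forall U, Ck_on dirsQ QT 4 U ->
    exists C, forall a, admissible X T k d a ->
      `|Lambda_k mr sigma (steps a) k
          (fun j => (sigma_tilde mr sigma (steps a) k j - sigma (node (steps a) j))
                    * U (node (steps a) j, a.2)) a.1.2|
      <= C * hstep k a ^+ 2].
Proof.
move=> sigma_gt0 Cs0 Cs; pose D := cOmega_ext X k.
have cO : compact (cOmega X) := @compact_box _ _ (fun=> 0) X.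
have cQ : compact QT := @compact_Q R n X T.
have cD : compact D by rewrite /D cOmega_extE; exact: compact_box.
have ekr : [set ek k : 'rV[R]_n] (ek k) by [].
have acc : accessible [set ek k] D.
  rewrite /D cOmega_extE; apply: accessible_box; last by move=> _ ->; exists k.
  by move=> l; have := X0 l; case: ifP => _; lra.
have accQ := accessible_Q X0 T0.
have dk := @dirsQx R n k.
have [m m0 sm] := positive_lower_bound cO (Ck_cts Cs0) sigma_gt0.
have m20 : 0 < m / 2 by lra.
have r20 : 0 < (2 : R) by lra.
have [d [d0 d1 hatm]] := hat_lower mr cD (Ck_le acc (isT : (1 <= 4)%N) Cs) ekr m20 r20.
have h01 := admissible_step X0 d1 (T := T) (k := k).
have Qx a : admissible X T k d a -> QT (xnode a, a.2) by exact: admissible_Q.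
have Ds a : admissible X T k d a -> forall s, `|s| <= 2 * hstep k a -> D (xnode a + s *: ek k).
  by case=> N2 mi _ _ s; exact: (mesh_segment_ext X0).
have seg a : admissible X T k d a -> D (xnode a) /\
    forall s, `|s| <= 2 * hstep k a -> D (xnode a + s *: ek k).
  move=> fa; split; last exact: Ds; have := Ds a fa 0; rewrite scale0r addr0 normr0; apply.
  by have /andP[/ltW h0 _] := h01 a fa; rewrite mulr_ge0.
have Dx a : admissible X T k d a -> D (xnode a) by move=> /seg[].
have segQ a : admissible X T k d a -> forall s, `|s| <= 1 * hstep k a ->
    QT ((xnode a, a.2) + s *: ekT k).
  move=> [N2 mi t0 _] s; rewrite mul1r => sh.
  by apply/Q_ekT; split=> //; exact: mesh_segment.
pose s r a := iter_dwithin D (ek k) r sigma (xnode a).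
have s0m a : admissible X T k d a -> m / 2 <= s 0%N a.
  by move=> fa; have := sm _ (Qx a fa).1; rewrite /s /iter_dwithin /=; lra.
have bs r : (r < 4)%N -> ubounded (admissible X T k d) (s r).
  by move=> r4; exact: (ubounded_jet_le cD acc ekr Dx (ltnW r4) Cs).
pose located (z : R) (jj : mesh_point -> 'rV[int]_n) :=
  forall a, admissible X T k d a -> node (steps a) (jj a) = xnode a + (z * hstep k a) *: ek k.
have hatge z jj : located z jj -> -1 <= z <= 2 -> forall a, admissible X T k d a ->
    m / 2 <= hat_minus mr sigma (steps a) k (jj a).
  move=> njj z12 a fa; apply: (hatm _ a.1.2 _ z).
  - by have [_ _ _ hd] := fa; have /andP[-> _] := h01 a fa.
  - exact: njj.
  - exact: Ds.
  - lra.
  - lra.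
  - by have := sm _ (Qx a fa).1; rewrite /= -/(xnode a); lra.
have hatE z jj : located z jj -> -1 <= z <= 2 -> expansion (admissible X T k d) (hstep k) 4
    (fun a => hat_minus mr sigma (steps a) k (jj a))
    (fun r a => s r a / (r`!)%:R * unit_moment r z).
  move=> njj z12; have := hat_expansion X0 mr d1 cD acc Cs ekr seg
    (_ : - 2 <= z - 1) (_ : z <= 2) njj.
  move=> /(_ ltac:(lra) ltac:(lra)); apply: expansion_ext => // r a r4 fa.
  by rewrite rule_moment_lt4.
have next z jj : located z jj -> located (z + 1) (fun a => jj a + ei k).
  by move=> njj a fa; rewrite node_shift njj// -addrA -scalerDl mulrDl mul1r.
have at0 : located 0 (fun a => a.1.2) by move=> a fa; rewrite mul0r scale0r addr0.
have atp : located 1 (fun a => a.1.2 + ei k).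
  by move=> a fa; rewrite mul1r node_shift.
have am := hatge _ _ at0 ltac:(lra).
have bm := hatge _ _ atp ltac:(lra).
exists d; split=> // [a fa|U CU].
  have a0 := lt_le_trans m20 (am a fa); have b0 := lt_le_trans m20 (bm a fa).
  by rewrite invr_eq0 gt_eqF// divr_gt0// addr_gt0// invr_gt0.
pose u r a := iter_dwithin QT (ekT k) r U (xnode a, a.2).
pose c r a := if r is 0%N then harm0 s a * u 0%N a else harm0 s a * u 1%N a + harm1 s a * u 0%N a.
have prodE z jj : located z jj -> -1 <= z <= 1 -> expansion (admissible X T k d) (hstep k) 4
    (fun a => (sigma_tilde mr sigma (steps a) k (jj a) - sigma (node (steps a) (jj a)))
              * U (node (steps a) (jj a), a.2))
    (fun r a => nth 0 [:: 0; 0; c 0%N a; z * c 1%N a] r).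
  move=> njj z1.
  have z12 : -1 <= z <= 2 by lra.
  have z12' : -1 <= z + 1 <= 2 by lra.
  have Es := point_expansion h01 cD acc ekr Dx Cs Ds (_ : - 2 <= z <= 2).
  have {}Es := Es ltac:(lra).
  have Ed := harmonic_mean_expansion h01 m20 s0m bs (hatge _ _ njj z12)
    (hatge _ _ (next _ _ njj) z12') (hatE _ _ njj z12) (hatE _ _ (next _ _ njj) z12') Es.
  have EU := point_expansion h01 cQ accQ dk Qx CU segQ (_ : - 1 <= z <= 1).
  have {}EU := EU ltac:(lra).
  apply: expansion_ext (expansionM h01 Ed EU).
    by move=> a fa; rewrite /sigma_tilde /hat_plus njj// shift_ekT.
  move=> r a r4 fa.
  by case: r r4 => [|[|[|[|//]]]] _; rewrite /c /u /= ?factRE ?expr0; field.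
have at1 : located (-1) (fun a => a.1.2 - ei k).
  by move=> a fa; rewrite mulN1r scaleNr node_shiftN.
have Ea : expansion (admissible X T k d) (hstep k) 4 (fun a => hat_minus mr sigma (steps a) k a.1.2)
    (hat_coef s 0 (-1)).
  apply: expansion_ext (hatE _ _ at0 ltac:(lra)) => // r a r4 fa; rewrite /unit_moment /hat_coef.
  by case: r r4 => [|[|[|[|//]]]] _; rewrite /= ?factRE; field.
have Eb : expansion (admissible X T k d) (hstep k) 4 (fun a => hat_plus mr sigma (steps a) k a.1.2)
    (hat_coef s 0 1).
  apply: expansion_ext (hatE _ _ atp ltac:(lra)) => // r a r4 fa; rewrite /unit_moment /hat_coef.
  by case: r r4 => [|[|[|[|//]]]] _; rewrite /= ?factRE; field.
(* the stencil: j = -1, 0, 1 *)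
have E1 := prodE _ _ at1 ltac:(lra).
have E0 := prodE _ _ at0 ltac:(lra).
have Ep := prodE _ _ atp ltac:(lra).
have [C HC] := flux_difference_perturbation (r := c) h01 m20 am bm Ea Eb E1 E0 Ep.
by exists C => a fa; exact: HC.
Qed.

End Tilde.

(** * Differences in time *)

Section TaylorCombination.
Context {R : realType}.
Variables (W : nat -> R) (M s : R).
Hypothesis s0 : 0 < s.

Let near_taylor q (a r : R) : Prop :=
  `|a - \sum_(j < q) W j / (j`!)%:R * r ^+ j| <= M * `|r| ^+ q.

Lemma central_difference2 (a b : R) : near_taylor 4 a s -> near_taylor 4 b (- s) ->
  `|(a - 2 * W 0%N + b) / s ^+ 2 - W 2%N| <= 2 * M * s ^+ 2.
Proof.
rewrite /near_taylor !big_ord_recr !big_ord0 /= normrN (gtr0_norm s0) !factRE => H1 H2.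
have -> : (a - 2 * W 0%N + b) / s ^+ 2 - W 2%N =
  (a - 2 * W 0%N + b - W 2%N * s ^+ 2) / s ^+ 2 by field; rewrite gt_eqF.
rewrite normrM normfV [`|s ^+ 2|]ger0_norm ?exprn_ge0 ?(ltW s0)//.
rewrite ler_pdivrMr ?exprn_gt0//.
have -> : 2 * M * s ^+ 2 * s ^+ 2 = 2 * (M * s ^+ 4) by ring.
move: H1 H2; rewrite !ler_norml; lra.
Qed.

Lemma central_difference4 (a b : R) : near_taylor 6 a s -> near_taylor 6 b (- s) ->
  `|(a - 2 * W 0%N + b) / s ^+ 2 - (W 2%N + s ^+ 2 / 12 * W 4%N)| <= 2 * M * s ^+ 4.
Proof.
rewrite /near_taylor !big_ord_recr !big_ord0 /= normrN (gtr0_norm s0) !factRE => H1 H2.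
have -> : (a - 2 * W 0%N + b) / s ^+ 2 - (W 2%N + s ^+ 2 / 12 * W 4%N) =
  (a - 2 * W 0%N + b - W 2%N * s ^+ 2 - W 4%N * s ^+ 4 / 12) / s ^+ 2.
  by field; rewrite gt_eqF.
rewrite normrM normfV [`|s ^+ 2|]ger0_norm ?exprn_ge0 ?(ltW s0)//.
rewrite ler_pdivrMr ?exprn_gt0//.
have -> : 2 * M * s ^+ 4 * s ^+ 2 = 2 * (M * s ^+ 6) by ring.
move: H1 H2; rewrite !ler_norml; lra.
Qed.

Lemma forward_difference4 (a : R) : near_taylor 5 a s ->
  `|(a - W 0%N) / s - (W 1%N + s / 2 * W 2%N + s ^+ 2 / 6 * W 3%N + s ^+ 3 / 24 * W 4%N)|
    <= M * s ^+ 4.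
Proof.
rewrite /near_taylor !big_ord_recr !big_ord0 /= (gtr0_norm s0) !factRE => H.
have -> : (a - W 0%N) / s - (W 1%N + s / 2 * W 2%N + s ^+ 2 / 6 * W 3%N + s ^+ 3 / 24 * W 4%N)
  = (a - (0 + W 0%N / 1 * s ^+ 0 + W 1%N / 1 * s ^+ 1 + W 2%N / 2 * s ^+ 2 +
   W 3%N / 6 * s ^+ 3 + W 4%N / 24 * s ^+ 4)) / s by field; rewrite gt_eqF.
rewrite normrM normfV (gtr0_norm s0) ler_pdivrMr//.
by have -> : M * s ^+ 4 * s = M * s ^+ 5 by ring.
Qed.

Lemma half_step_difference3 (a : R) : near_taylor 3 a (s / 2) ->
  `|a - W 0%N - (s / 2 * W 1%N + s ^+ 2 / 8 * W 2%N)| <= M * s ^+ 3 / 8.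
Proof.
rewrite /near_taylor !big_ord_recr !big_ord0 /= (gtr0_norm (_ : 0 < s / 2)) ?divr_gt0// !factRE.
have -> : a - W 0%N - (s / 2 * W 1%N + s ^+ 2 / 8 * W 2%N) =
  a - (0 + W 0%N / 1 * (s / 2) ^+ 0 + W 1%N / 1 * (s / 2) ^+ 1 + W 2%N / 2 * (s / 2) ^+ 2).
  by field.
by have -> : M * s ^+ 3 / 8 = M * (s / 2) ^+ 3 by field.
Qed.

End TaylorCombination.

Section TimeTaylor.
Context {R : realType} {n : nat}.
Variables (X : 'I_n -> R) (T : R).
Hypotheses (X0 : forall l, 0 < X l) (T0 : 0 < T).
Notation QT := (Qbar X T).

Lemma shift_eT (x : 'rV[R]_n) (t s : R) : (x, t) + s *: eT = (x, t + s).
Proof. by rewrite /eT; congr (_, _); rewrite /= ?scaler0 ?addr0 // /GRing.scale /= mulr1. Qed.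

Lemma time_taylor q w : Ck_on dirsQ QT q w -> exists2 M, 0 < M &
  forall x t s, cOmega X x -> 0 <= t <= T -> 0 <= t + s <= T ->
  `|w (x, t + s) - \sum_(j < q) iter_dwithin QT eT j w (x, t) / (j`!)%:R * s ^+ j| <= M * `|s| ^+ q.
Proof.
move=> Cw; have [|M M0 wM] := @compact_bounded_fun _ _ QT (iter_dwithin QT eT q w) (@compact_Q R n X T).
  by apply: (@Ck_cts _ _ _ dirsQ 0); apply: Ck_iter_dwithin dirsQt; rewrite addn0.
exists M => // x t s Ox t0 ts.
have ab0 : - t <= 0 <= T - t by lra.
have Dab r : - t <= r <= T - t -> QT ((x, t) + r *: eT).
  by move=> rt; apply/Q_eT; split=> //; lra.
have sab : - t <= s <= T - t by lra.
have := taylor Cw dirsQt ab0 Dab (fun r H => wM _ (Dab r H)) sab.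
by rewrite shift_eT horner_poly.
Qed.

Lemma central_difference_t2 w : Ck_on dirsQ QT 4 w -> exists2 C, 0 < C &
  forall x t s, cOmega X x -> 0 < s -> 0 <= t - s -> t + s <= T ->
  `|(w (x, t + s) - 2 * w (x, t) + w (x, t - s)) / s ^+ 2 - iter_dwithin QT eT 2 w (x, t)|
    <= C * s ^+ 2.
Proof.
move=> /time_taylor[M M0 wM]; exists (2 * M); first by rewrite mulr_gt0.
move=> x t s Ox s0 ts1 ts2.
apply: (central_difference2 (W := fun j => iter_dwithin QT eT j w (x, t)) s0); apply: wM => //; lra.
Qed.

Lemma central_difference_t4 w : Ck_on dirsQ QT 6 w -> exists2 C, 0 < C &
  forall x t s, cOmega X x -> 0 < s -> 0 <= t - s -> t + s <= T ->
  `|(w (x, t + s) - 2 * w (x, t) + w (x, t - s)) / s ^+ 2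
      - (iter_dwithin QT eT 2 w (x, t) + s ^+ 2 / 12 * iter_dwithin QT eT 4 w (x, t))| <= C * s ^+ 4.
Proof.
move=> /time_taylor[M M0 wM]; exists (2 * M); first by rewrite mulr_gt0.
move=> x t s Ox s0 ts1 ts2.
apply: (central_difference4 (W := fun j => iter_dwithin QT eT j w (x, t)) s0); apply: wM => //; lra.
Qed.

Lemma forward_difference_t4 w : Ck_on dirsQ QT 5 w -> exists2 C, 0 < C &
  forall x t s, cOmega X x -> 0 < s -> 0 <= t -> t + s <= T ->
  `|(w (x, t + s) - w (x, t)) / s - (iter_dwithin QT eT 1 w (x, t) + s / 2 * iter_dwithin QT eT 2 w (x, t)
      + s ^+ 2 / 6 * iter_dwithin QT eT 3 w (x, t) + s ^+ 3 / 24 * iter_dwithin QT eT 4 w (x, t))|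
    <= C * s ^+ 4.
Proof.
move=> /time_taylor[M M0 wM]; exists M => // x t s Ox s0 ts1 ts2.
apply: (forward_difference4 (W := fun j => iter_dwithin QT eT j w (x, t)) s0); apply: wM => //; lra.
Qed.

Lemma half_step_t3 w : Ck_on dirsQ QT 3 w -> exists2 C, 0 < C &
  forall x t s, cOmega X x -> 0 < s -> 0 <= t -> t + s <= T ->
  `|w (x, t + s / 2) - w (x, t) -
     (s / 2 * iter_dwithin QT eT 1 w (x, t) + s ^+ 2 / 8 * iter_dwithin QT eT 2 w (x, t))| <= C * s ^+ 3.
Proof.
move=> /time_taylor[M M0 wM]; exists (M / 8); first by rewrite divr_gt0.
move=> x t s Ox s0 ts1 ts2; rewrite [leRHS]mulrAC.
apply: (half_step_difference3 (W := fun j => iter_dwithin QT eT j w (x, t)) s0); apply: wM => //; lra.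
Qed.

End TimeTaylor.

(** * The equation on the closed cylinder and on its boundary *)

Section Equation.
Context {R : realType} {n : nat}.
Variables (X : 'I_n -> R) (T : R).
Hypotheses (X0 : forall l, 0 < X l) (T0 : 0 < T).
Variables (sigma c : 'rV[R]_n -> R).
Hypothesis sigma_gt0 : forall x, cOmega X x -> 0 < sigma x.
Hypothesis c_gt0 : forall x, cOmega X x -> 0 < c x.
Notation QT := (Qbar X T).
Notation accQ := (accessible_Q X0 T0).

(** As sigma does not depend on t, this is the symmetry of second derivatives,
    used once for the flux and once for w. *)
Lemma dt_Lk k w q : smooth_space X 2 sigma -> Ck_on dirsQ QT 3 w -> QT q ->
  dt QT (Lk QT sigma k w) q = Lk QT sigma k (dt QT w) q.
Proof.
move=> Cs Cw Qq.
have Cf : Ck_on dirsQ QT 2 (flux X T sigma k w) by exact: Ck_flux.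
rewrite [LHS](schwarz_Q X0 T0 _ Cf Qq); apply: dwithin_ext Qq => p Qp.
have Ci : Ck_on dirsQ QT 1 (fun q => (sigma q.1)^-1).
  apply: (CkV accQ (sigma_neq0 sigma_gt0)).
  exact: (CkW accQ (Ck_lift X0 T0 Cs)).
have Cd : Ck_on dirsQ QT 1 (dx QT k w).
  by apply: (CkW accQ); exact: Ck_dw (dirsQx k).
have Z : dwithin QT eT (fun q => (sigma q.1)^-1) p = 0 :=
  dt_lift X0 T0 (fun x => (sigma x)^-1) Qp.
rewrite /flux [LHS](dwithin_mul accQ Ci Cd dirsQt Qp) Z mul0r add0r.
by congr (_ * _); exact: (schwarz_Q X0 T0 _ (CkW accQ Cw) Qp).
Qed.

Lemma Ck_beta K : smooth_space X K sigma -> smooth_space X K c ->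
  Ck_on dirsQ QT K (fun q => beta sigma c q.1).
Proof.
move=> Cs Cc; apply: (CkV accQ).
  move=> q [Oq _]; rewrite gt_eqF// mulr_gt0 ?exprn_gt0//; [exact: sigma_gt0 | exact: c_gt0].
apply: (CkM accQ); first exact: (Ck_lift X0 T0).
by apply: (CkM accQ); exact: (Ck_lift X0 T0).
Qed.

(** Differentiating beta a = L b + f in t gives an equation of the same form; this
    is iterated in [equation_t]. *)
Lemma dt_equation (a b f : 'rV[R]_n * R -> R) :
  smooth_space X 2 sigma -> smooth_space X 2 c ->
  Ck_on dirsQ QT 1 a -> Ck_on dirsQ QT 3 b -> Ck_on dirsQ QT 1 f ->
  (forall q, QT q -> beta sigma c q.1 * a q = \sum_(k < n) Lk QT sigma k b q + f q) ->
  forall q, QT q -> beta sigma c q.1 * dt QT a q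
    = \sum_(k < n) Lk QT sigma k (dt QT b) q + dt QT f q.
Proof.
move=> Cs Cc Ca Cb Cf E q Qq.
have CL k : Ck_on dirsQ QT 1 (Lk QT sigma k b) by exact: Ck_Lk.
have Cbeta := CkW accQ (Ck_beta Cs Cc).
have := dwithin_ext eT E Qq; rewrite (dwithin_mul accQ Cbeta Ca dirsQt Qq).
have Z : dwithin QT eT (fun q => beta sigma c q.1) q = 0 :=
  dt_lift X0 T0 (beta sigma c) Qq.
rewrite Z mul0r add0r => ->.
rewrite (dwithin_add accQ (Ck_sum accQ xpredT CL) Cf dirsQt Qq).
rewrite (dwithin_sum accQ xpredT CL dirsQt Qq); congr (_ + _).
by apply: eq_bigr => k _; exact: dt_Lk.
Qed.

Variables (f g : 'rV[R]_n * R -> R) (phi0 phi1 : 'rV[R]_n -> R) (u : 'rV[R]_n * R -> R).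
Hypotheses (Csigma : smooth_space X 8 sigma) (Cc : smooth_space X 8 c).
Hypotheses (Cf : Ck_on dirsQ QT 8 f) (Cg : smooth_boundary X T 8 g).
Hypotheses (Cphi0 : smooth_space X 8 phi0) (Cphi1 : smooth_space X 8 phi1).
Hypothesis Cu : Ck_on dirsQ QT 8 u.
Hypothesis sol : is_solution X T sigma c f g phi0 phi1 u.

Let accO : accessible (range ek) (cOmega X).
Proof. exact: (@accessible_box _ _ (fun=> 0)). Qed.

Let Csig K : (K <= 8)%N -> smooth_space X K sigma.
Proof. by move=> K8; exact: (Ck_le accO K8 Csigma). Qed.

Let CuK K : (K <= 8)%N -> Ck_on dirsQ QT K u.
Proof. by move=> K8; exact: (Ck_le accQ K8 Cu). Qed.

Lemma equation_on_Q q : QT q ->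
  beta sigma c q.1 * dt QT (dt QT u) q = \sum_(k < n) Lk QT sigma k u q + f q.
Proof.
move=> Qq; have [E _ _ _] := sol.
apply/eqP; rewrite -subr_eq0; apply/eqP.
apply: (@zero_on_Q _ _ _ _ X0 T0 (fun q => beta sigma c q.1 * dt QT (dt QT u) q -
   (\sum_(k < n) Lk QT sigma k u q + f q))) Qq; last first.
  by move=> x t Ox tT; rewrite E// subrr.
apply: (@Ck_cts _ _ _ dirsQ 0); apply: (CkB accQ).
  apply: (CkM accQ).
    by apply: Ck_beta; [exact: Csig | exact: (Ck_le accO (leq0n _) Cc)].
  apply: Ck_dw dirsQt; apply: Ck_dw dirsQt; exact: CuK.
apply: (CkD accQ); last exact: (Ck_le accQ (leq0n _) Cf).
by apply: (Ck_sum accQ) => k; apply: Ck_Lk => //; [exact: Csig | exact: CuK].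
Qed.

Lemma zero_on_cOmega (w : 'rV[R]_n -> R) : {within cOmega X, continuous w} ->
  (forall x, Omega X x -> w x = 0) -> forall x, cOmega X x -> w x = 0.
Proof.
move=> cw w0 x Ox.
apply: (@zero_on_Q _ _ _ _ X0 T0 (fun q => w q.1)) (x, 0) _.
- apply: (@cts_comp _ _ _ QT (cOmega X) fst w) => // [q|q []//]; exact: cvg_fst.
- by move=> y t Oy _; exact: w0.
- by split=> //=; rewrite lexx ltW.
Qed.

(** The initial conditions are given in the open box only, but the scheme uses
    them at boundary nodes. *)
Lemma initial_trace (w : 'rV[R]_n * R -> R) (phi : 'rV[R]_n -> R) :
  {within QT, continuous w} -> {within cOmega X, continuous phi} ->
  (forall x, Omega X x -> w (x, 0) = phi x) ->
  forall x, cOmega X x -> w (x, 0) = phi x.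
Proof.
move=> cw cphi wphi x Ox; apply/eqP; rewrite -subr_eq0; apply/eqP.
apply: (zero_on_cOmega (w := fun x => w (x, 0) - phi x)) Ox; last first.
  by move=> y Oy; rewrite wphi// subrr.
apply: within_continuousB => //.
apply: (@cts_comp _ _ _ (cOmega X) QT (fun x => (x, 0)) w) => //.
  by move=> y; apply: (@cvg_pair _ _ _ (nbhs y) (nbhs y) (nbhs (0 : R)) _ _ _ id (cst 0));
    [exact: cvg_id | exact: cvg_cst].
by move=> y Oy; split=> //=; rewrite lexx ltW.
Qed.

Lemma u_phi0 x : cOmega X x -> u (x, 0) = phi0 x.
Proof.
apply: initial_trace; [exact: Ck_cts Cu | exact: Ck_cts Cphi0 |].
by case: sol.
Qed.

Lemma ut_phi1 x : cOmega X x -> dt QT u (x, 0) = phi1 x.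
Proof.
apply: initial_trace; [exact: Ck_cts (Ck_dw Cu dirsQt) | exact: Ck_cts Cphi1 |].
by case: sol.
Qed.

Lemma facet_boundary j b x : facet X j b x -> bOmega X x.
Proof.
move=> [Ox xj]; split=> // /(_ j); rewrite xj; case: b {xj}; rewrite ltxx ?andbF//.
Qed.

(** The boundary condition is given for 0 < t < T; it extends to t = 0 and t = T by
    continuity on the facet. *)
Lemma u_eq_g j b q : cyl (facet X j b) T q -> u q = g q.
Proof.
case: q => x t [/= Fx t0T]; have [_ ug _ _] := sol.
have Bx := facet_boundary Fx.
apply/eqP; rewrite -subr_eq0; apply/eqP.
have E s : (x, t) + s *: (0, T / 2 - t) = (x, t + s * (T / 2 - t)).
  by congr (_, _); rewrite /= scaler0 addr0.
have T0' := T0.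
apply: (@zero_closure _ _ (cyl (facet X j b) T) (fun q => u q - g q) _ (0, T / 2 - t)).
- apply: within_continuousB; last exact: Ck_cts (Cg j b).
  apply: continuous_subspaceW (Ck_cts Cu) => q [[Oq _] q2]; by split.
- by move=> s s01; rewrite E; split=> //=; nra.
- move=> s s01; rewrite E; apply/eqP; rewrite subr_eq0; apply/eqP; apply: ug => //; nra.
Qed.

Lemma facet_ekT j b l x t s : l != j -> facet X j b x ->
  cyl (facet X j b) T ((x, t) + s *: ekT l) <-> QT ((x, t) + s *: ekT l).
Proof.
move=> lj [Ox xj]; rewrite !shift_ekT; split; first by move=> [[]].
by move=> [/= Os ts]; split=> //; split=> //=; rewrite shift_coord eq_sym (negPf lj) addr0.
Qed.

Lemma facet_eT j b x t s : facet X j b x ->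
  cyl (facet X j b) T ((x, t) + s *: eT) <-> QT ((x, t) + s *: eT).
Proof. by move=> Fx; rewrite !shift_eT; split; [move=> [[] ]|move=> [] /=]. Qed.

(** On the facets orthogonal to e_k the equation is solved for L_k u, and all other
    derivatives are tangential. *)
Lemma boundary_uk j b k q : cyl (facet X j b) T q ->
  Lk QT sigma k u q = gk X T sigma c f g j b k q.
Proof.
set D := cyl (facet X j b) T.
have gu q' : D q' -> g q' = u q' by move=> /u_eq_g ->.
have dtD (w v : 'rV[R]_n * R -> R) : (forall q, D q -> w q = v q) ->
    forall q, D q -> dt D w q = dt QT v q.
  move=> wv [x t] Dq; apply: (dwithin_restrict _ wv Dq) => s.
  by apply: facet_eT; case: Dq.
have LD l : l != j -> forall q, D q -> Lk D sigma l g q = Lk QT sigma l u q.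
  have dxD (w v : 'rV[R]_n * R -> R) : l != j -> (forall q, D q -> w q = v q) ->
      forall q, D q -> dx D l w q = dx QT l v q.
    move=> lj wv [x t] Dq; apply: (dwithin_restrict _ wv Dq) => s.
    by apply: facet_ekT => //; case: Dq.
  by move=> lj q' Dq'; apply: (dxD) => // p Dp; congr (_ * _); exact: dxD.
move=> Dq; have Qq : QT q by case: Dq => [[Oq _] tq].
rewrite /gk -/D; case: eqP => [<-|/eqP jk]; last by rewrite LD// eq_sym.
rewrite (dtD _ (dt QT u))//; last by move=> p Dp; exact: dtD gu _ Dp.
rewrite equation_on_Q// (bigD1 j)//=.
have -> : \sum_(l < n | l != j) Lk D sigma l g q = \sum_(l < n | l != j) Lk QT sigma l u q.
  by apply: eq_bigr => l lj; exact: LD.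
by ring.
Qed.

End Equation.

(** * Truncation errors *)

Section Uniform.
Context {R : realType} {n : nat}.

(** Finitely many directions: the sum of the constants, and the harmonic sum of the
    bounds on the step, serve for all of them. *)
Lemma uniform_const (P : 'I_n -> R -> R -> Prop) :
  (forall k, exists d C, 0 < d /\ P k d C) ->
  (forall k d d' C C', d' <= d -> C <= C' -> P k d C -> P k d' C') ->
  exists d C, [/\ 0 < d, 0 < C & forall k, P k d C].
Proof.
move=> /choice[d /choice[C dC]] mono.
have S0 : 0 <= \sum_(k < n) (d k)^-1 by apply: sumr_ge0 => k _; rewrite invr_ge0 ltW// (dC k).1.
have S1 : 0 <= \sum_(k < n) `|C k| by exact: sumr_ge0.
exists (1 + \sum_(k < n) (d k)^-1)^-1, (1 + \sum_(k < n) `|C k|); split.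
- by rewrite invr_gt0; lra.
- lra.
move=> k; have [dk Pk] := dC k; apply: mono Pk.
  rewrite -[leRHS]invrK lef_pV2 ?posrE ?invr_gt0//; last lra.
  rewrite (bigD1 k)//= addrCA lerDl addr_ge0// sumr_ge0// => l _.
  by rewrite invr_ge0 ltW// (dC l).1.
rewrite (bigD1 k)//= addrCA; apply: le_trans (ler_norm _) _.
by rewrite lerDl addr_ge0// sumr_ge0.
Qed.

Lemma step_norm_ge0 (h : 'I_n -> R) : 0 <= step_norm h.
Proof. exact: sqrtr_ge0. Qed.

Lemma step_norm_sq (h : 'I_n -> R) : step_norm h ^+ 2 = \sum_(l < n) h l ^+ 2.
Proof. by rewrite sqr_sqrtr// sumr_ge0// => l _; exact: sqr_ge0. Qed.

Lemma le_step_norm (h : 'I_n -> R) k : h k <= step_norm h.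
Proof.
apply: le_trans (ler_norm _) _; rewrite -sqrtr_sqr ler_wsqrtr// (bigD1 k)//= lerDl.
by rewrite sumr_ge0// => l _; exact: sqr_ge0.
Qed.

Lemma ler_normM (x y a b : R) : `|x| <= a -> `|y| <= b -> `|x * y| <= a * b.
Proof. by move=> xa yb; rewrite normrM ler_pM. Qed.

(** The discrete equation is split into the fourth-order error of Lambda_k u, the
    second-order error of Lambda_k (sigma u_k), and the effect of replacing sigma
    by sigma^(k).  The last two carry the factor h^2 / 12. *)
Lemma defect_correction (h U Lu L1 L2 D C4 C2 Ct : R) : 0 < h ->
  `|Lu - (U + h ^+ 2 / 12 * L1)| <= C4 * h ^+ 4 -> `|L2 - L1| <= C2 * h ^+ 2 ->
  `|D| <= Ct * h ^+ 2 ->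
  `|U + h ^+ 2 / 12 * (L2 + D) - Lu| <= (`|C4| + `|C2| + `|Ct|) * h ^+ 4.
Proof.
move=> h0 H4 H2 Ht.
have le_norm (C : R) k : C * h ^+ k <= `|C| * h ^+ k.
  by rewrite ler_wpM2r ?exprn_ge0 ?(ltW h0)// ler_norm.
have {}H4 := le_trans H4 (le_norm _ _); have {}H2 := le_trans H2 (le_norm _ _).
have {}Ht := le_trans Ht (le_norm _ _).
have -> : U + h ^+ 2 / 12 * (L2 + D) - Lu =
  h ^+ 2 / 12 * (L2 - L1) + h ^+ 2 / 12 * D - (Lu - (U + h ^+ 2 / 12 * L1)) by ring.
have h2 : `|h ^+ 2 / 12| <= h ^+ 2.
  by rewrite ger0_norm ?divr_ge0 ?sqr_ge0// ler_pdivrMr// ler_peMr ?sqr_ge0// ler1n.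
apply: le_trans (ler_normB _ _) _.
rewrite [leRHS](_ : _ = (h ^+ 2 * (`|C2| * h ^+ 2) + h ^+ 2 * (`|Ct| * h ^+ 2))
   + `|C4| * h ^+ 4); last by ring.
by rewrite lerD// (le_trans (ler_normD _ _))// lerD// ler_normM.
Qed.

End Uniform.

Section Truncation.
Context {R : realType} {n : nat}.
Variables (X : 'I_n -> R) (T : R).
Hypotheses (X0 : forall l, 0 < X l) (T0 : 0 < T).
Variables (mr : mean_rule) (tilde : bool) (sigma : 'rV[R]_n -> R).
Hypothesis sigma_gt0 : forall x, cOmega X x -> 0 < sigma x.
Hypothesis Csigma : smooth_space X 8 sigma.
Notation QT := (Qbar X T).
Notation accQ := (accessible_Q X0 T0).
Notation hstep := (mp_step X).
Notation xnode := (mp_node X).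
Notation steps a := (step X a.1.1).

Lemma Lambda_k_local h k (w w' : 'rV[int]_n -> R) i :
  w i = w' i -> w (i + ei k) = w' (i + ei k) -> w (i - ei k) = w' (i - ei k) ->
  Lambda_k mr sigma h k w i = Lambda_k mr sigma h k w' i.
Proof. by rewrite /Lambda_k => -> -> ->. Qed.

Lemma Lambda_kD h k (w w' : 'rV[int]_n -> R) i :
  Lambda_k mr sigma h k (fun j => w j + w' j) i =
  Lambda_k mr sigma h k w i + Lambda_k mr sigma h k w' i.
Proof. by rewrite /Lambda_k; ring. Qed.

Let accO : accessible (range ek) (cOmega X).
Proof. exact: (@accessible_box _ _ (fun=> 0)). Qed.

Let Csig K : (K <= 8)%N -> smooth_space X K sigma.
Proof. by move=> K8; exact: (Ck_le accO K8 Csigma). Qed.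

Lemma admissible_le k d d' a : d' <= d -> admissible X T k d' a -> admissible X T k d a.
Proof. by move=> d'd [N2 mi t0 hd]; split=> //; exact: le_trans hd d'd. Qed.

Lemma mesh_neighbours N (i : 'rV[int]_n) k : (forall l, (2 <= N l)%N) -> mesh N i ->
  [/\ cOmega X (node (step X N) i), cOmega X (node (step X N) (i + ei k)) &
      cOmega X (node (step X N) (i - ei k))].
Proof.
move=> N2 mi; have h0 := step_gt0 X0 (N2 k); rewrite node_shiftN node_shift -scaleNr.
split; try by apply: (mesh_segment X0) => //; rewrite ?normrN gtr0_norm.
rewrite -[node _ _]addr0 -(scale0r (ek k)); apply: (mesh_segment X0) => //.
by rewrite normr0 ltW.
Qed.

(** The second-order part of the expansion, summed over the directions. *)
Lemma Lambda_truncation (w : 'rV[R]_n * R -> R) : Ck_on dirsQ QT 6 w ->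
  exists d C, [/\ 0 < d, 0 < C & forall N i t, (forall l, (2 <= N l)%N) -> mesh N i ->
    0 <= t <= T -> step_norm (step X N) <= d ->
    `|\sum_(k < n) Lambda_k mr sigma (step X N) k (fun j => w (node (step X N) j, t)) i
      - \sum_(k < n) Lk QT sigma k w (node (step X N) i, t)| <= C * step_norm (step X N) ^+ 2].
Proof.
move=> Cw; pose P k d C := forall a, admissible X T k d a ->
  `|Lambda_k mr sigma (steps a) k (fun j => w (node (steps a) j, a.2)) a.1.2
     - Lk QT sigma k w (xnode a, a.2)| <= C * hstep k a ^+ 2.
have [| |d [C [d0 C0 H]]] := @uniform_const _ _ P.
- move=> k; have [d [d0 _ /(_ w Cw)[_ [C HC]]]] :=
    Lambda_expansion X0 T0 mr k sigma_gt0 (Csig (isT : (5 <= 8)%N)).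
  by exists d, C.
- move=> k d d' C C' dd' CC' PdC a /(admissible_le dd') /PdC /le_trans; apply.
  by rewrite ler_wpM2r// sqr_ge0.
exists d, C; split=> // N i t N2 mi t0 hd.
rewrite -sumrB; apply: le_trans (ler_norm_sum _ _ _) _.
rewrite step_norm_sq mulr_sumr; apply: ler_sum => k _.
apply: (H k (N, i, t)); split=> //=; exact: le_trans (le_step_norm _ k) hd.
Qed.

(** Equations (b) and (e) have the same truncation error, at different times. *)
Lemma compact_scheme_truncation (u : 'rV[R]_n * R -> R) : Ck_on dirsQ QT 8 u ->
  (tilde -> forall k, smooth_in k (cOmega_ext X k) 8 sigma) ->
  exists d C, [/\ 0 < d, 0 < C & forall k a, admissible X T k d a ->
    `|s_k mr tilde sigma (steps a) k (fun j => sigma_k mr tilde sigma (steps a) k j *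
           Lk QT sigma k u (node (steps a) j, a.2)) a.1.2
      - Lambda_k mr sigma (steps a) k (fun j => u (node (steps a) j, a.2)) a.1.2|
      <= C * hstep k a ^+ 4].
Proof.
move=> Cu Ctilde; pose P k d C := forall a, admissible X T k d a ->
    `|s_k mr tilde sigma (steps a) k (fun j => sigma_k mr tilde sigma (steps a) k j *
           Lk QT sigma k u (node (steps a) j, a.2)) a.1.2
      - Lambda_k mr sigma (steps a) k (fun j => u (node (steps a) j, a.2)) a.1.2|
      <= C * hstep k a ^+ 4.
apply: (@uniform_const _ _ P) => [k|k d d' C C' dd' CC' PdC a /(admissible_le dd') /PdC /le_trans]; last first.
  by apply; rewrite ler_wpM2r// exprn_even_ge0.
(* two derivatives are used up by L_k; [Lambda_expansion] needs the other six *)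
have Cuk : Ck_on dirsQ QT 6 (Lk QT sigma k u) by apply: Ck_Lk => //; exact: Csig.
have [d [d0 d1 H]] := Lambda_expansion X0 T0 mr k sigma_gt0 (Csig (isT : (5 <= 8)%N)).
have [[C4 H4] _] := H u (Ck_le accQ (isT : (6 <= 8)%N) Cu).
have [_ [C2 H2]] := H (fun q => sigma q.1 * Lk QT sigma k u q)
  (CkM accQ (Ck_lift X0 T0 (Csig (isT : (6 <= 8)%N))) Cuk).
(* for sigma^(k) = sigma the perturbation is zero *)
have [dtil [Ct [dt0 Ht]]] : exists dtil Ct, 0 < dtil /\ forall a, admissible X T k dtil a ->
    sigma_k mr tilde sigma (steps a) k a.1.2 != 0 /\
    `|Lambda_k mr sigma (steps a) k (fun j => (sigma_k mr tilde sigma (steps a) k j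
         - sigma (node (steps a) j)) * Lk QT sigma k u (node (steps a) j, a.2)) a.1.2|
    <= Ct * hstep k a ^+ 2.
  rewrite /sigma_k; case: tilde Ctilde => [/(_ isT k) Cext|_].
    have accE : accessible [set ek k : 'rV[R]_n] (cOmega_ext X k).
      rewrite cOmega_extE; apply: accessible_box; last by move=> _ ->; exists k.
      by move=> l; have := X0 l; case: ifP => _; lra.
    have [dtil [dt0 _ nz /(_ _ (Ck_le accQ (isT : (4 <= 6)%N) Cuk))[Ct HC]]] :=
      tilde_perturbation X0 T0 mr sigma_gt0 (Csig (isT : (0 <= 8)%N))
        (Ck_le accE (isT : (4 <= 8)%N) Cext).
    by exists dtil, Ct; split=> // a fa; split; [exact: nz | exact: HC].
  exists 1, 0; split=> // a fa; split.
    by rewrite gt_eqF// sigma_gt0//; case: (admissible_Q X0 fa).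
  rewrite (@Lambda_k_local _ _ _ (fun=> 0)); try by rewrite /= addrN mul0r.
  by rewrite /Lambda_k addrN !mul0r addrN mulr0 normr0.
exists (Num.min d dtil), (`|C4| + `|C2| + `|Ct|); split; first by rewrite lt_min d0.
move=> a fa.
have fd : admissible X T k d a by apply: admissible_le fa; rewrite ge_min lexx.
have ft : admissible X T k dtil a by apply: admissible_le fa; rewrite ge_min lexx orbT.
have [nz {}Ht] := Ht a ft; have {}H4 := H4 a fd; have {}H2 := H2 a fd.
have /andP[h0 _] := admissible_step X0 d1 fd.
rewrite /s_k mulKf// -/(hstep k a).
have E : Lambda_k mr sigma (steps a) k (fun j => sigma_k mr tilde sigma (steps a) k j *
      Lk QT sigma k u (node (steps a) j, a.2)) a.1.2 =
  Lambda_k mr sigma (steps a) k (fun j => sigma (node (steps a) j) *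
      Lk QT sigma k u (node (steps a) j, a.2)) a.1.2 +
  Lambda_k mr sigma (steps a) k (fun j => (sigma_k mr tilde sigma (steps a) k j
         - sigma (node (steps a) j)) * Lk QT sigma k u (node (steps a) j, a.2)) a.1.2.
  by rewrite -Lambda_kD; apply: Lambda_k_local; ring.
by rewrite {}E; exact: defect_correction H4 H2 Ht.
Qed.

End Truncation.

Section Combination.
Context {R : realType}.
Variables (s e bi Cb : R).
Hypotheses (s0 : 0 <= s) (e0 : 0 <= e) (biC : `|bi| <= Cb).

Let Cb0 : 0 <= Cb. Proof. exact: le_trans biC. Qed.

Let s2_ge0 : 0 <= s ^+ 2. Proof. exact: exprn_ge0. Qed.

Lemma square_product_le : s ^+ 2 * e ^+ 2 <= e ^+ 4 + s ^+ 4.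
Proof. by have := sqr_ge0 (s ^+ 2 - e ^+ 2); have := sqr_ge0 (s ^+ 2 + e ^+ 2); nra. Qed.

Lemma scaled_le (a x y : R) : 0 <= a <= 1 -> `|x| <= y -> `|bi * (s ^+ 2 * a) * x|
  <= Cb * (s ^+ 2 * y).
Proof.
move=> /andP[a0 a1] xy; have y0 : 0 <= y by apply: le_trans xy.
rewrite -mulrA; apply: ler_normM => //; rewrite -mulrA; apply: ler_normM.
  by rewrite ger0_norm.
by rewrite -[leRHS]mul1r; apply: ler_normM => //; rewrite ger0_norm.
Qed.

(** The arithmetic of equation (a), with s = h_t, e = |h|, bi = 1/beta, and w2, w4
    the time derivatives of u.  The equation for w4 turns the fourth-order Taylor
    term into the corrections present in the scheme. *)
Lemma interior_combination (Lt w2 w4 LamW SL Lf ftt CA CB CF : R) :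
  0 <= CA -> 0 <= CB -> 0 <= CF -> w4 = bi * (SL + ftt) ->
  `|Lt - (w2 + s ^+ 2 / 12 * w4)| <= CA * s ^+ 4 ->
  `|LamW - SL| <= CB * e ^+ 2 -> `|Lf - ftt| <= CF * s ^+ 2 ->
  `|Lt - ((w2 + bi * (s ^+ 2 / 12) * LamW) + bi * (s ^+ 2 / 12) * Lf)|
    <= (CA + Cb * CB + Cb * CF) * (e ^+ 4 + s ^+ 4).
Proof.
move=> CA0 CB0 CF0 -> HA HB HF.
have -> : Lt - ((w2 + bi * (s ^+ 2 / 12) * LamW) + bi * (s ^+ 2 / 12) * Lf) =
  (Lt - (w2 + s ^+ 2 / 12 * (bi * (SL + ftt)))) - bi * (s ^+ 2 / 12) * (LamW - SL)
   - bi * (s ^+ 2 / 12) * (Lf - ftt) by ring.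
have a1 : 0 <= (12^-1 : R) <= 1 by lra.
have HB' := scaled_le a1 HB; have HF' := scaled_le a1 HF.
have e4 : 0 <= e ^+ 4 by exact: exprn_ge0.
have s4 : 0 <= s ^+ 4 by exact: exprn_ge0.
have st := square_product_le.
apply: le_trans (ler_normB _ _) _; rewrite mulrDl; apply: lerD.
  apply: le_trans (ler_normB _ _) _; rewrite mulrDl; apply: lerD.
    by apply: le_trans HA _; rewrite ler_wpM2l// lerDr.
  apply: le_trans HB' _; rewrite -mulrA ler_wpM2l// mulrCA ler_wpM2l//.
apply: le_trans HF' _; rewrite -mulrA ler_wpM2l// mulrCA ler_wpM2l//.
by rewrite -exprD lerDr.
Qed.

(** The arithmetic of equation (d).  The data f at t = h_t / 2 combine to
    the first and second time derivatives of f with the weights that the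
    equations for w3 and w4 require. *)
Lemma initial_combination (dl p1 w2 w3 w4 Lphi LamW SL1 SL2 Df ft ftt CA CB1 CB2 CF : R) :
  s <= 1 -> 0 <= CA -> 0 <= CB1 -> 0 <= CB2 -> 0 <= CF ->
  w3 = bi * (SL1 + ft) -> w4 = bi * (SL2 + ftt) ->
  `|dl - (p1 + s / 2 * w2 + s ^+ 2 / 6 * w3 + s ^+ 3 / 24 * w4)| <= CA * s ^+ 4 ->
  `|Lphi - SL1| <= CB1 * e ^+ 2 -> `|LamW - SL2| <= CB2 * e ^+ 2 ->
  `|Df - (s / 2 * ft + s ^+ 2 / 8 * ftt)| <= CF * s ^+ 3 ->
  `|dl - (p1 + s ^+ 2 / 6 * bi * Lphi
      + s / 2 * ((w2 + bi * (s ^+ 2 / 12) * LamW) + 2 / 3 * bi * Df))|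
    <= (CA + Cb * CB1 + Cb * CB2 + Cb * CF) * (e ^+ 4 + s ^+ 4).
Proof.
move=> s1 CA0 CB10 CB20 CF0 -> -> HA HB1 HB2 HF.
have -> : dl - (p1 + s ^+ 2 / 6 * bi * Lphi
      + s / 2 * ((w2 + bi * (s ^+ 2 / 12) * LamW) + 2 / 3 * bi * Df)) =
  (dl - (p1 + s / 2 * w2 + s ^+ 2 / 6 * (bi * (SL1 + ft)) + s ^+ 3 / 24 * (bi * (SL2 + ftt))))
  - bi * (s ^+ 2 * 6^-1) * (Lphi - SL1) - bi * (s ^+ 2 * (s / 24)) * (LamW - SL2)
  - bi * ((s / 3) * (Df - (s / 2 * ft + s ^+ 2 / 8 * ftt))) by field.
have a1 : 0 <= (6^-1 : R) <= 1 by lra.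
have a2 : 0 <= s / 24 <= 1 by have := s0; lra.
have HB1' := scaled_le a1 HB1; have HB2' := scaled_le a2 HB2.
have e4 : 0 <= e ^+ 4 by exact: exprn_ge0.
have s4 : 0 <= s ^+ 4 by exact: exprn_ge0.
have st := square_product_le.
apply: le_trans (ler_normB _ _) _; rewrite mulrDl; apply: lerD; last first.
  rewrite -[leRHS]mulrA; apply: ler_normM => //.
  apply: (@le_trans _ _ (s * (CF * s ^+ 3))).
    apply: ler_normM => //; rewrite ger0_norm ?divr_ge0// ler_pdivrMr// ler_peMr// ler1n//.
  by rewrite mulrCA -exprS ler_wpM2l// lerDr.
apply: le_trans (ler_normB _ _) _; rewrite mulrDl; apply: lerD; last first.
  by apply: le_trans HB2' _; rewrite -mulrA ler_wpM2l// mulrCA ler_wpM2l.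
apply: le_trans (ler_normB _ _) _; rewrite mulrDl; apply: lerD; last first.
  by apply: le_trans HB1' _; rewrite -mulrA ler_wpM2l// mulrCA ler_wpM2l.
by apply: le_trans HA _; rewrite ler_wpM2l// lerDr.
Qed.

End Combination.

Section Scheme.
Context {R : realType} {n : nat}.
Variables (X : 'I_n -> R) (T : R).
Hypotheses (X0 : forall l, 0 < X l) (T0 : 0 < T).
Variables (mr : mean_rule) (sigma c : 'rV[R]_n -> R).
Hypothesis sigma_gt0 : forall x, cOmega X x -> 0 < sigma x.
Hypothesis c_gt0 : forall x, cOmega X x -> 0 < c x.
Variables (f g : 'rV[R]_n * R -> R) (phi0 phi1 : 'rV[R]_n -> R) (u : 'rV[R]_n * R -> R).
Hypotheses (Csigma : smooth_space X 8 sigma) (Cc : smooth_space X 8 c).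
Notation QT := (Qbar X T).
Hypotheses (Cf : Ck_on dirsQ QT 8 f) (Cg : smooth_boundary X T 8 g).
Hypotheses (Cphi0 : smooth_space X 8 phi0) (Cphi1 : smooth_space X 8 phi1).
Hypothesis Cu : Ck_on dirsQ QT 8 u.
Hypothesis sol : is_solution X T sigma c f g phi0 phi1 u.
Notation accQ := (accessible_Q X0 T0).

Let binv (q : 'rV[R]_n * R) : R := (beta sigma c q.1)^-1.
Let u2 := iter_dwithin QT eT 2 u.
Let u4 := iter_dwithin QT eT 4 u.
Let uk (k : 'I_n) := Lk QT sigma k u.

Let CuK K : (K <= 8)%N -> Ck_on dirsQ QT K u.
Proof. by move=> K8; exact: (Ck_le accQ K8 Cu). Qed.

Let CfK K : (K <= 8)%N -> Ck_on dirsQ QT K f.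
Proof. by move=> K8; exact: (Ck_le accQ K8 Cf). Qed.

Let accO : accessible (range ek) (cOmega X).
Proof. exact: (@accessible_box _ _ (fun=> 0)). Qed.

Let Csig K : (K <= 8)%N -> smooth_space X K sigma.
Proof. by move=> K8; exact: (Ck_le accO K8 Csigma). Qed.

Let CcK K : (K <= 8)%N -> smooth_space X K c.
Proof. by move=> K8; exact: (Ck_le accO K8 Cc). Qed.

Let CutK j K : (j + K <= 8)%N -> Ck_on dirsQ QT K (iter_dwithin QT eT j u).
Proof. by move=> K8; apply: Ck_iter_dwithin dirsQt; exact: CuK. Qed.

Let CftK j K : (j + K <= 8)%N -> Ck_on dirsQ QT K (iter_dwithin QT eT j f).
Proof. by move=> K8; apply: Ck_iter_dwithin dirsQt; exact: CfK. Qed.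

Lemma beta_neq0 q : QT q -> beta sigma c q.1 != 0.
Proof.
by move=> [Oq _]; rewrite invr_eq0 gt_eqF// mulr_gt0 ?exprn_gt0 ?sigma_gt0 ?c_gt0.
Qed.

Let betaE q a b : QT q -> beta sigma c q.1 * a = b -> a = binv q * b.
Proof. by move=> Qq <-; rewrite /binv mulKf// beta_neq0. Qed.

(** For j = 0 this is the differential equation, extended by continuity to the
    closed cylinder; j = 1 is used at t = 0, and j = 2 for the terms with h_t^2. *)
Lemma equation_t j q : (j <= 2)%N -> QT q -> beta sigma c q.1 * iter_dwithin QT eT j.+2 u q
  = \sum_(k < n) Lk QT sigma k (iter_dwithin QT eT j u) q + iter_dwithin QT eT j f q.
Proof.
elim: j q => [|j IH] q j2 Qq; first exact: (equation_on_Q X0 T0 sigma_gt0 c_gt0 Csigma Cc Cf Cu sol).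
apply: (dt_equation X0 T0 sigma_gt0 c_gt0 (a := iter_dwithin QT eT j.+2 u)
  (b := iter_dwithin QT eT j u) (f := iter_dwithin QT eT j f)) Qq => //.
- exact: Csig.
- exact: CcK.
- by apply: CutK; case: j {IH} j2 => [|[|]].
- by apply: CutK; case: j {IH} j2 => [|[|]].
- by apply: CftK; case: j {IH} j2 => [|[|]].
- by move=> p; apply: IH; exact: ltnW.
Qed.

Lemma binv_bound : exists2 C, 0 < C & forall q, QT q -> `|binv q| <= C.
Proof.
apply: compact_bounded_fun; first exact: compact_Q.
apply: (@Ck_cts _ _ _ dirsQ 0); apply: (CkV accQ); first exact: beta_neq0.
by apply: Ck_beta => //; [exact: Csig | exact: CcK].
Qed.

Section MeshData.
Variables (N : 'I_n -> nat) (M : nat).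
Hypotheses (N2 : forall l, (2 <= N l)%N) (M2 : (2 <= M)%N).
Let h := step X N.
Let ht := T / M%:R.
Let v := restr h ht u.
Let vk k := restr h ht (uk k).

Lemma ht_gt0 : 0 < ht.
Proof. by rewrite divr_gt0// ltr0n (leq_trans _ M2). Qed.

Lemma time_level_le m : (m <= M)%N -> 0 <= m%:R * ht <= T.
Proof.
move=> mM; rewrite mulr_ge0 ?(ltW ht_gt0)//= /ht mulrCA ler_piMr ?(ltW T0)//.
by rewrite ler_pdivrMr ?ltr0n ?(leq_trans _ M2)// mul1r ler_nat.
Qed.

(** This includes boundary nodes and m = 0, because the equation holds on the closed
    cylinder. *)
Lemma W_u2 i m : cOmega X (node h i) -> (m <= M)%N ->
  (beta sigma c (node h i))^-1 * (\sum_(k < n) vk k i m + restr h ht f i m)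
  = u2 (node h i, m%:R * ht).
Proof.
move=> Oi mM; have Qi : QT (node h i, m%:R * ht) by split=> //; exact: time_level_le.
by apply/esym; apply: (betaE Qi); exact: (@equation_t 0).
Qed.

Lemma Lambda_W i m : mesh N i -> (m <= M)%N ->
  Lambda mr sigma h (fun j => (beta sigma c (node h j))^-1 *
     (\sum_(k < n) vk k j m + restr h ht f j m)) i
  = \sum_(k < n) Lambda_k mr sigma h k (fun j => u2 (node h j, m%:R * ht)) i.
Proof.
move=> mi mM; apply: eq_bigr => k _.
have [xi xp xm] := mesh_neighbours X0 k N2 mi.
by apply: Lambda_k_local; rewrite W_u2.
Qed.

End MeshData.

Lemma interior_truncation : exists d C, [/\ 0 < d, 0 < C &
  forall N M i m, (forall l, (2 <= N l)%N) -> (2 <= M)%N ->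
  step_norm (step X N) <= d -> mesh N i -> (1 <= m <= M - 1)%N ->
  `|resid_a mr sigma c f (step X N) (T / M%:R) (restr (step X N) (T / M%:R) u)
      (fun k => restr (step X N) (T / M%:R) (uk k)) i m|
    <= C * (step_norm (step X N) ^+ 4 + (T / M%:R) ^+ 4)].
Proof.
have [d [CB [d0 CB0 HB]]] := Lambda_truncation X0 T0 mr sigma_gt0 Csigma
  (CutK (isT : (2 + 6 <= 8)%N)).
have [CA CA0 HA] := central_difference_t4 (CuK (isT : (6 <= 8)%N)).
have [CF CF0 HF] := central_difference_t2 (CfK (isT : (4 <= 8)%N)).
have [Cb Cb0 Hb] := binv_bound.
exists d, (CA + Cb * CB + Cb * CF); split=> //.
  by rewrite !addr_gt0// mulr_gt0.
move=> N M i m N2 M2 hd mi /andP[m1 mM].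
have mM' : (m < M)%N by move: mM; rewrite subn1 -ltnS prednK// (leq_trans _ M2).
have s0 := ht_gt0 M2; set s := T / M%:R in s0 *; set h := step X N in hd *.
have tm := time_level_le M2 (ltnW mM'); rewrite -/s in tm.
have Oi : cOmega X (node h i).
  by move=> l; have := mesh_coord X0 (N2 l) mi; have := step_gt0 X0 (N2 l); rewrite /h; lra.
have Qi : QT (node h i, m%:R * s) by [].
have tp : m.+1%:R * s = m%:R * s + s by rewrite -natr1 mulrDl mul1r.
have tp' : m.-1%:R * s = m%:R * s - s.
  by rewrite -[in RHS](prednK m1) -natr1 mulrDl mul1r addrK.
have tT : m%:R * s + s <= T by rewrite -tp; case/andP: (time_level_le M2 mM').
have tT' : 0 <= m%:R * s - s by rewrite -tp' mulr_ge0// ltW.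
rewrite /resid_a (Lambda_W N2 M2 mi (ltnW mM')) (W_u2 M2 Oi (ltnW mM')).
rewrite /Lambda_t /restr tp tp' -/s -/h.
apply: (interior_combination (w4 := u4 (node h i, m%:R * s))
   (SL := \sum_(k < n) Lk QT sigma k u2 (node h i, m%:R * s))
   (ftt := iter_dwithin QT eT 2 f (node h i, m%:R * s)) (ltW s0) (step_norm_ge0 h) (Hb _ Qi));
  try exact: ltW.
- by apply: (betaE Qi); exact: (@equation_t 2).
- exact: HA.
- exact: HB.
- exact: HF.
Qed.

Lemma initial_truncation : exists d C, [/\ 0 < d, 0 < C &
  forall N M i, (forall l, (2 <= N l)%N) -> (2 <= M)%N ->
  step_norm (step X N) <= d -> T / M%:R <= d -> mesh N i ->
  `|resid_d mr sigma c f phi1 (step X N) (T / M%:R) (restr (step X N) (T / M%:R) u)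
      (fun k => restr (step X N) (T / M%:R) (uk k)) i|
    <= C * (step_norm (step X N) ^+ 4 + (T / M%:R) ^+ 4)].
Proof.
have [d [CB2 [d0 CB20 HB2]]] := Lambda_truncation X0 T0 mr sigma_gt0 Csigma
  (CutK (isT : (2 + 6 <= 8)%N)).
have [d' [CB1 [d'0 CB10 HB1]]] := Lambda_truncation X0 T0 mr sigma_gt0 Csigma
  (CutK (isT : (1 + 6 <= 8)%N)).
have [CA CA0 HA] := forward_difference_t4 (CuK (isT : (5 <= 8)%N)).
have [CF CF0 HF] := half_step_t3 (CfK (isT : (3 <= 8)%N)).
have [Cb Cb0 Hb] := binv_bound.
exists (Num.min 1 (Num.min d d')), (CA + Cb * CB1 + Cb * CB2 + Cb * CF); split=> //.
- by rewrite !lt_min ltr01 d0.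
- by rewrite !addr_gt0// mulr_gt0.
move=> N M i N2 M2; rewrite !le_min => /andP[_ /andP[hd hd']] /andP[s1 _] mi.
have s0 := ht_gt0 M2; set s := T / M%:R in s0 s1 *; set h := step X N in hd hd' *.
have Oi : cOmega X (node h i).
  by move=> l; have := mesh_coord X0 (N2 l) mi; have := step_gt0 X0 (N2 l); rewrite /h; lra.
have t0 : 0 <= (0 : R) <= T by rewrite lexx ltW.
have Qi : QT (node h i, 0) by [].
have sT : 0 + s <= T.
  rewrite add0r; have /andP[_] := time_level_le M2 (leq_trans (isT : (1 <= 2)%N) M2).
  by rewrite mul1r.
have Lphi : Lambda mr sigma h (fun j => phi1 (node h j)) i =
    \sum_(k < n) Lambda_k mr sigma h k (fun j => iter_dwithin QT eT 1 u (node h j, 0)) i.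
  apply: eq_bigr => k _; have [xi xp xm] := mesh_neighbours X0 k N2 mi.
  by apply: Lambda_k_local; rewrite -(ut_phi1 X0 T0 Cphi1 Cu sol).
rewrite /resid_d (Lambda_W N2 M2 mi (leq0n _)) (W_u2 M2 Oi (leq0n _)) Lphi.
rewrite -(ut_phi1 X0 T0 Cphi1 Cu sol Oi) /delta_t /restr mul0r mul1r -/s -/h.
have ss : s = 0 + s by rewrite add0r.
have ss2 : s / 2 = 0 + s / 2 by rewrite add0r.
rewrite [in u _]ss [in f _]ss2.
apply: (initial_combination (w3 := iter_dwithin QT eT 3 u (node h i, 0)) (w4 := u4 (node h i, 0))
   (SL1 := \sum_(k < n) Lk QT sigma k (iter_dwithin QT eT 1 u) (node h i, 0))
   (SL2 := \sum_(k < n) Lk QT sigma k u2 (node h i, 0))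
   (ft := iter_dwithin QT eT 1 f (node h i, 0))
   (ftt := iter_dwithin QT eT 2 f (node h i, 0)) (ltW s0) (step_norm_ge0 h) (Hb _ Qi) s1);
  try exact: ltW.
- by apply: (betaE Qi); exact: (@equation_t 1).
- by apply: (betaE Qi); exact: (@equation_t 2).
- exact: HA.
- exact: HB1.
- exact: HB2.
- exact: HF.
Qed.

End Scheme.

Theorem mainTheorem3 (R : realType) :
  exists K : nat,
  forall (n : nat) (X : 'I_n -> R) (T : R)
    (sigma c : 'rV[R]_n -> R) (f g : 'rV[R]_n * R -> R)
    (phi0 phi1 : 'rV[R]_n -> R) (u : 'rV[R]_n * R -> R)
    (mr : mean_rule) (tilde : bool),
  (1 <= n)%N -> (forall l, 0 < X l) -> 0 < T ->
  (forall x, cOmega X x -> 0 < sigma x) ->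
  (forall x, cOmega X x -> 0 < c x) ->
  smooth_space X K sigma -> smooth_space X K c ->
  (tilde -> forall k, smooth_in k (cOmega_ext X k) K sigma) ->
  smooth_spacetime X T K f -> smooth_boundary X T K g ->
  smooth_space X K phi0 -> smooth_space X K phi1 ->
  smooth_spacetime X T K u ->
  is_solution X T sigma c f g phi0 phi1 u ->
  let uk k := Lk (cyl (cOmega X) T) sigma k u in
  (exists C h0 : R, [/\ 0 < C, 0 < h0 &
    forall (N : 'I_n -> nat) (M : nat),
    (forall l, (2 <= N l)%N) -> (2 <= M)%N ->
    let h := step X N in
    let ht := T / M%:R in
    let v := restr h ht u in
    let vk k := restr h ht (uk k) in
    step_norm h <= h0 -> ht <= h0 ->
    forall i : 'rV[int]_n, mesh N i ->
    [/\ forall m : nat, (1 <= m <= M - 1)%N ->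
          `|resid_a mr sigma c f h ht v vk i m|
            <= C * (step_norm h ^+ 4 + ht ^+ 4),
        forall (k : 'I_n) (m : nat), (1 <= m <= M - 1)%N ->
          `|resid_b mr tilde sigma h v vk k i m| <= C * h k ^+ 4,
        `|resid_d mr sigma c f phi1 h ht v vk i|
            <= C * (step_norm h ^+ 4 + ht ^+ 4)
      & forall k : 'I_n,
          `|resid_e mr tilde sigma phi0 h vk k i| <= C * h k ^+ 4]]) /\
  (forall (N : 'I_n -> nat) (M : nat),
    (forall l, (2 <= N l)%N) -> (2 <= M)%N ->
    let h := step X N in
    let ht := T / M%:R in
    let v := restr h ht u in
    let vk k := restr h ht (uk k) in
    forall (i : 'rV[int]_n) (m : nat), bmesh N i -> (m <= M)%N ->
    v i m - restr h ht g i m = 0 /\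
    forall (j : 'I_n) (b : bool), on_single_facet X j b (node h i) ->
    forall k : 'I_n,
      vk k i m - restr h ht (gk X T sigma c f g j b k) i m = 0).

Proof.
(* two derivatives for u_tt or L_k u, and six for the expansion of its second difference *)
exists 8%N => n X T sigma c f g phi0 phi1 u mr tilde _ X0 T0 sigma_gt0 c_gt0.
move=> Csigma Cc Cext Cf Cg Cphi0 Cphi1 Cu sol uk; split.
  have [da [Ca [da0 Ca0 Ha]]] :=
    interior_truncation X0 T0 mr sigma_gt0 c_gt0 Csigma Cc Cf Cu sol.
  have [dd [Cd [dd0 Cd0 Hd]]] :=
    initial_truncation X0 T0 mr sigma_gt0 c_gt0 Csigma Cc Cf Cphi1 Cu sol.
  have [db [Cb [db0 Cb0 Hb]]] :=
    compact_scheme_truncation X0 T0 mr sigma_gt0 Csigma Cu Cext.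
  exists (Ca + Cd + Cb), (Num.min da (Num.min dd db)); split.
  - by rewrite !addr_gt0.
  - by rewrite !lt_min da0 dd0.
  move=> N M N2 M2 h ht v vk; rewrite !le_min => /and3P[ha hd hb] /and3P[_ td _] i mi.
  have s0 := ht_gt0 T0 M2; rewrite -/ht in s0.
  have e4 : 0 <= step_norm h ^+ 4 + ht ^+ 4.
    by rewrite addr_ge0// exprn_ge0 ?step_norm_ge0// ltW.
  have b_bound k m : (m <= M)%N ->
      `|resid_b mr tilde sigma h v vk k i m| <= (Ca + Cd + Cb) * h k ^+ 4.
    move=> mM; apply: le_trans (Hb k (N, i, m%:R * ht) _) _.
      split=> //=; first exact: time_level_le.
      exact: le_trans (le_step_norm h k) hb.
    by rewrite ler_wpM2r ?exprn_even_ge0// lerDr addr_ge0// ltW.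
  split.
  - move=> m mM; apply: le_trans (Ha N M i m N2 M2 ha mi mM) _.
    by rewrite ler_wpM2r// -addrA lerDl addr_ge0// ltW.
  - by move=> k m /andP[_ mM]; apply: b_bound; exact: leq_trans mM (leq_subr _ _).
  - apply: le_trans (Hd N M i N2 M2 hd td mi) _.
    by rewrite ler_wpM2r// addrAC lerDr addr_ge0// ltW.
  - move=> k; suff -> : resid_e mr tilde sigma phi0 h vk k i =
        resid_b mr tilde sigma h v vk k i 0 by exact: b_bound.
    have [xi xp xm] := mesh_neighbours X0 k N2 mi.
    by congr (_ - _); apply: Lambda_k_local; rewrite /v /restr mul0r (u_phi0 X0 T0 Cphi0 Cu sol).
move=> N M N2 M2 h ht v vk i m [ci nmi] mM.
have Oi := cmesh_cOmega X0 N2 ci; have tm := time_level_le T0 M2 mM.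
split.
  have [j [b Fi]] : exists j b, facet X j b (node h i).
    apply: contrapT => nF; apply: nmi => l.
    have [nl XE] := node_coord X i (N2 l); have h0 := step_gt0 X0 (N2 l).
    have /andP[i0 iN] := ci l.
    have il0 : i 0 l != 0.
      by apply/eqP => il; apply: nF; exists l, false; split=> //; rewrite nl il mul0r.
    have ilN : i 0 l != (N l)%:Z.
      by apply/eqP => il; apply: nF; exists l, true; split=> //; rewrite nl il -pmulrn XE.
    by move: i0 iN il0 ilN; lia.
  apply/eqP; rewrite subr_eq0; apply/eqP.
  have Dq : cyl (facet X j b) T (node h i, m%:R * ht) by [].
  exact: (u_eq_g T0 Cg Cu sol Dq).
move=> j b [Fi _] k; apply/eqP; rewrite subr_eq0; apply/eqP.
have Dq : cyl (facet X j b) T (node h i, m%:R * ht) by [].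
exact: (boundary_uk X0 T0 sigma_gt0 c_gt0 Csigma Cc Cf Cg Cu sol k Dq).
Qed.
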